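(* Let $f\in H^{-1}(\Omega)$. If $\partial F_{\mathrm{D}}(f)\neq\emptyset$, then $$\partial F_{\mathrm{D}}(f)=\left\{-(-\Delta_{\mathrm{D}})\operatorname{div}\mathbf{g}\ \left|\ \begin{array}{l}\mathbf{g}\in L^{p/(p-1)}(\Omega;\mathbb{R}^d)\text{ satisfying that }\operatorname{div}\mathbf{g}\in H^1_0(\Omega),\\ \mathbf{g}(\mathbf{x})\in\partial\sigma(\nabla\widetilde f(\mathbf{x}))\text{ for a.e. }\mathbf{x}\in\Omega,\\ \langle h,\operatorname{div}\mathbf{g}\rangle+\int_\Omega\langle\nabla\widetilde h(\mathbf{x}),\mathbf{g}(\mathbf{x})\rangle_{\mathbb{R}^d}d\mathbf{x}=0\ \ \forall h\in X_{\mathrm{D}}\end{array}\right.\right\}.$$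
   Context: Let $d\in\mathbb{N}$, $p\in(1,\infty)$, $\mu>0$, and let $\Omega\subset\mathbb{R}^d$ be open and bounded. All functions are real valued. $W^{1,p}_0(\Omega)$ is normed by $\|\nabla\cdot\|_{L^p(\Omega;\mathbb{R}^d)}$ and $H^1_0(\Omega)$ has inner product $\int_\Omega\langle\nabla f,\nabla g\rangle_{\mathbb{R}^d}d\mathbf{x}$. $H^{-1}(\Omega)$ is the topological dual of $H^1_0(\Omega)$, $\langle\cdot,\cdot\rangle$ denotes the duality pairing (in either order), and $-\Delta_{\mathrm{D}}:H^1_0(\Omega)\to H^{-1}(\Omega)$ is the (Riesz) isometry $\langle-\Delta_{\mathrm{D}}f,\phi\rangle=\int_\Omega\langle\nabla f,\nabla\phi\rangle_{\mathbb{R}^d}d\mathbf{x}$. $H^{-1}(\Omega)$ is a Hilbert space with inner product $\langle f,g\rangle_{H^{-1}(\Omega)}=\langle(-\Delta_{\mathrm{D}})^{-1}f,g\rangle$. $X_{\mathrm{D}}$ is the set of $f\in H^{-1}(\Omega)$ for which there exists $\widetilde f\in W^{1,p}_0(\Omega)$ such that, for every $\phi\in H^1_0(\Omega)$, $\langle f,\phi\rangle=\lim_{n\to\infty}\int_\Omega\widetilde f\phi_n\,d\mathbf{x}$ for any sequence $\{\phi_n\}\subset C_0^\infty(\Omega)$ converging to $\phi$ in $H^1_0(\Omega)$. Such $\widetilde f$ is unique; for $h\in X_{\mathrm{D}}$ the corresponding function is denoted $\widetilde h$. $\sigma:\mathbb{R}^d\to\mathbb{R}$, $\sigma(\mathbf{y})=|\mathbf{y}|+\frac{\mu}{p}|\mathbf{y}|^p$;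 its subdifferential is $\partial\sigma(\mathbf{x})=\{\mathbf{y}\in\mathbb{R}^d\mid\langle\mathbf{y},\mathbf{z}\rangle_{\mathbb{R}^d}+\sigma(\mathbf{x})\le\sigma(\mathbf{x}+\mathbf{z})\ \forall\mathbf{z}\in\mathbb{R}^d\}$. $F_{\mathrm{D}}:H^{-1}(\Omega)\to\mathbb{R}\cup\{\infty\}$ is $F_{\mathrm{D}}(f)=\int_\Omega\sigma(\nabla\widetilde f(\mathbf{x}))d\mathbf{x}$ if $f\in X_{\mathrm{D}}$ and $F_{\mathrm{D}}(f)=\infty$ otherwise. Its subdifferential is $$\partial F_{\mathrm{D}}(f)=\{g\in H^{-1}(\Omega)\mid\langle g,h\rangle_{H^{-1}(\Omega)}+F_{\mathrm{D}}(f)\le F_{\mathrm{D}}(f+h)\ \forall h\in H^{-1}(\Omega)\}.$$ (If $\partial F_{\mathrm{D}}(f)\ne\emptyset$ then $f\in X_{\mathrm{D}}$, so $\widetilde f$ is defined.) The divergence $\operatorname{div}\mathbf{g}$ is taken in the sense of distributions on $\Omega$. *)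

(* Defs.v *)
From HB Require Import structures.
From mathcomp Require Import all_boot all_order all_algebra.
From mathcomp Require Import all_classical all_reals all_analysis.
From mathcomp Require Import measurable_realfun.

Set Implicit Arguments.
Unset Strict Implicit.
Unset Printing Implicit Defensive.

Import Order.TTheory GRing.Theory Num.Theory.
Import numFieldNormedType.Exports.

Local Open Scope classical_set_scope.
Local Open Scope ring_scope.

Section Borel.
Context (R : realType) (d : nat).

Definition borel_rV : set (set 'rV[R]_d) := <<s open >>.

HB.instance Definition _ := @isMeasurable.Build default_measure_display
  'rV[R]_d borel_rV (@sigma_algebra0 _ setT open) (@sigma_algebraC _ open)
  (@sigma_algebra_bigcup _ setT open).

Lemma open_measurable_rV (A : set 'rV[R]_d) : open A -> measurable A.
Proof. exact: sub_sigma_algebra. Qed.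

Lemma measurable_coord (i : 'I_d) :
  measurable_fun [set: 'rV[R]_d] (fun x => x ord0 i).
Proof.
apply: (measurability _ (RGenOpens.measurableE R)).
move=> _ [_ [a [b ->] <-]]; rewrite setTI; apply: open_measurable_rV.
by apply: open_comp; [move=> ? _; exact: coord_continuous | exact: interval_open].
Qed.

Lemma open_bigcup_rat_ball (A : set 'rV[R]_d) : open A ->
  A = \bigcup_(q in [set q : 'rV[rat]_d * nat |
        ball (map_mx ratr q.1 : 'rV[R]_d) (q.2.+1%:R^-1) `<=` A])
      ball (map_mx ratr q.1 : 'rV[R]_d) (q.2.+1%:R^-1).
Proof.
move=> oA; apply/seteqP; split=> [x Ax | x [q]]; last exact.
have /nbhs_ballP [e /= e0 xeA] : nbhs x A by exact: open_nbhs_nbhs.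
have e20 : 0 < e / 2 by rewrite divr_gt0.
have [k _ /(_ k (leqnn k)) /= ke] := near_infty_natSinv_lt (PosNum e20).
set r : R := k.+1%:R^-1 in ke.
have r0 : 0 < r by rewrite invr_gt0.
have xq i : {q : rat | ball (x ord0 i) r (ratr q)}.
  apply: cid; have /rat_in_itvoo [q qx] : x ord0 i - r < x ord0 i + r.
    by rewrite ltrD2l gtrN.
  by exists q; rewrite /ball /= ltr_distlC; move: qx; rewrite in_itv.
pose q : 'rV[rat]_d := \row_i sval (xq i).
have bxq : ball x r (map_mx ratr q : 'rV[R]_d).
  by split=> // i j; rewrite !mxE [i]ord1; exact: svalP (xq j).
exists (q, k) => /=; last exact: ball_sym.
move=> y qy; apply: xeA; apply: le_ball (ball_triangle bxq qy).
by rewrite [leRHS]splitr lerD// ltW.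
Qed.

Lemma measurable_fun_rVP d' (T : measurableType d') (f : T -> 'rV[R]_d) :
  measurable_fun setT f <->
  forall i, measurable_fun setT (fun x => f x ord0 i).
Proof.
split=> [mf i|mf].
  exact: (measurableT_comp (measurable_coord i) mf).
have mE : @measurable _ 'rV[R]_d = <<s open >> by [].
apply: (measurability _ mE) => _ [A oA <-]; rewrite setTI.
rewrite (open_bigcup_rat_ball oA) preimage_bigcup bigcup_mkcond.
apply: countable_bigcupT_measurable => // q; case: ifP => // _.
rewrite (_ : _ @^-1` _ = \bigcap_(i in [set: 'I_d])
  ((fun x => f x ord0 i) @^-1` ball (ratr (q.1 ord0 i) : R) q.2.+1%:R^-1)).
  apply: fin_bigcap_measurable => // i _; rewrite -[X in measurable X]setTI.
  apply: mf => //; rewrite ball_itv; exact: measurable_itv.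
apply/seteqP; split => [x [_ qx] i _|x qx]; first by have := qx ord0 i; rewrite !mxE.
split; first by rewrite invr_gt0.
by move=> i j; rewrite !mxE [i]ord1; exact: qx.
Qed.

End Borel.

Section Lebesgue.
Context (R : realType).

(* (t, v) |-> (t, v_0, ..., v_(n-1)) *)
Definition cons_rV n (tv : R * 'rV[R]_n) : 'rV[R]_n.+1 :=
  \row_i oapp (tv.2 ord0) tv.1 (unlift ord0 i).

Definition uncons_rV n (v : 'rV[R]_n.+1) : R * 'rV[R]_n :=
  (v ord0 ord0, \row_i v ord0 (lift ord0 i)).

Lemma cons_rVK n : cancel (@cons_rV n) (@uncons_rV n).
Proof.
move=> [t v]; rewrite /uncons_rV mxE unlift_none; congr pair.
by apply/rowP => i; rewrite !mxE liftK.
Qed.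

Lemma measurable_cons_rV n : measurable_fun setT (@cons_rV n).
Proof.
apply/measurable_fun_rVP => i; under eq_fun do rewrite mxE.
case: unliftP => [j _|_]; last exact: measurable_fst.
exact: (measurableT_comp (measurable_coord j) measurable_snd).
Qed.

Lemma measurable_uncons_rV n : measurable_fun setT (@uncons_rV n).
Proof.
apply: measurable_fun_pair; first exact: measurable_coord.
by apply/measurable_fun_rVP => i; under eq_fun do rewrite mxE; exact: measurable_coord.
Qed.

HB.instance Definition _ n :=
  @isMeasurableFun.Build _ _ _ _ (@cons_rV n) (@measurable_cons_rV n).

Section step.
Context (n : nat) (m : {sigma_finite_measure set 'rV[R]_n -> \bar R}).

Definition lebesgue_step : set 'rV[R]_n.+1 -> \bar R :=
  pushforward (@lebesgue_measure R \x m)%E (@cons_rV n).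

Let push : {measure set 'rV[R]_n.+1 -> \bar R} :=
  measure_function_pushforward__canonical__measure_function_Measure
    (@lebesgue_measure R \x m)%E (@measurable_cons_rV n).

HB.instance Definition _ := isMeasure.Build _ _ _ lebesgue_step
  (measure0 push) (measure_ge0 push) (@measure_semi_sigma_additive _ _ _ push).

Let step_sigma_finite : sigma_finite setT lebesgue_step.
Proof.
have /sigma_finiteP[F [TF ndF Foo]] := sigma_finiteT (@lebesgue_measure R).
have /sigma_finiteP[G [TG ndG Goo]] := sigma_finiteT m.
exists (fun k => @uncons_rV n @^-1` (F k `*` G k)) => [|k].
  rewrite -preimage_bigcup -(preimage_setT (@uncons_rV n)); congr (_ @^-1` _).
  rewrite -setXTT TF TG; apply/seteqP; split=> -[x y]; last first.
    by move=> [k _ []/= ? ?]; split; exists k.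
  move=> [/= [i _ Fix] [j _ Gjy]]; exists (maxn i j) => //; split.
    by move: x Fix; exact/subsetPset/ndF/leq_maxl.
  by move: y Gjy; exact/subsetPset/ndG/leq_maxr.
have [mF Fk] := Foo k; have [mG Gk] := Goo k; split.
  rewrite -[X in measurable X]setTI; apply: measurable_uncons_rV => //.
  exact: measurableX.
rewrite /lebesgue_step /pushforward -comp_preimage.
rewrite (_ : _ \o _ = id); last by apply/funext => x /=; rewrite cons_rVK.
by rewrite preimage_id product_measure1E// lte_mul_pinfty// ge0_fin_numE.
Qed.

HB.instance Definition _ := Measure_isSigmaFinite.Build _ _ _ lebesgue_step
  step_sigma_finite.

End step.

Fixpoint lebesgue_rV n : {sigma_finite_measure set 'rV[R]_n -> \bar R} :=
  if n is n'.+1 then lebesgue_step (lebesgue_rV n') else dirac (0 : 'rV[R]_0).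

Lemma lebesgue_rV_box n (A : 'I_n -> set R) : (forall i, measurable (A i)) ->
  lebesgue_rV n [set x | forall i, A i (x ord0 i)] =
  (\prod_(i < n) lebesgue_measure (A i))%E.
Proof.
elim: n => [|n IHn] in A *; move=> mA.
  by rewrite big_ord0 /= diracE mem_set// => -[].
rewrite big_ord_recl -IHn//= /lebesgue_step /pushforward.
rewrite -product_measure1E//.
- congr (_ _); apply/seteqP; split => [tv /= Atv|tv /= [At Av] i].
    split; first by have := Atv ord0; rewrite mxE unlift_none.
    by move=> i; have := Atv (lift ord0 i); rewrite mxE liftK.
  by rewrite mxE; case: unliftP => [j|] ->; [exact: Av|exact: At].
- exact: mA.
rewrite [X in measurable X](_ : _ = \bigcap_(i in [set: 'I_n])
    ((fun x : 'rV[R]_n => x ord0 i) @^-1` A (lift ord0 i))).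
  apply: fin_bigcap_measurable => // i _; rewrite -[X in measurable X]setTI.
  exact: measurable_coord.
by apply/seteqP; split=> [x Ax i _|x Ax i]; [exact: Ax|exact: Ax].
Qed.

End Lebesgue.

Section Spaces.
Context (R : realType) (d : nat).
Local Notation E := 'rV[R]_d.
Local Notation lam := (@lebesgue_rV R d).
Implicit Types (Omega : set E) (p q : R).

Definition dotv (x y : E) : R := \sum_(i < d) x ord0 i * y ord0 i.

(* The canonical norm `|x| of 'rV[R]_d is the sup norm. *)
Definition enorm (x : E) : R := Num.sqrt (dotv x x).

(* Measurability is with respect to the Borel sets; every class of Lebesgue
   measurable functions has a Borel representative. *)
Definition memLp Omega q (u : E -> R) : Prop := u \_ Omega \in Lfun lam q%:E.

Definition memLpV Omega q (g : E -> E) : Prop :=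
  forall i : 'I_d, memLp Omega q (fun x => g x ord0 i).

Definition normLp Omega q (u : E -> R) : \bar R :=
  ('N[lam]_(q%:E) [EFin \o (u \_ Omega)])%E.

Definition grad (phi : E -> R) (x : E) : E :=
  \row_i 'D_(delta_mx ord0 i) phi x.

(* All iterated directional derivatives are (Frechet) differentiable. *)
Definition smooth (phi : E -> R) : Prop :=
  forall (vs : seq E) (x : E),
    differentiable (foldr (fun v psi => 'D_v psi) phi vs) x.

Definition test_fun Omega (phi : E -> R) : Prop :=
  let supp := closure [set x | phi x != 0] in
  [/\ smooth phi, compact supp & supp `<=` Omega].

Definition loc_integrable Omega (u : E -> R) : Prop :=
  forall K : set E, compact K -> K `<=` Omega -> lam.-integrable K (EFin \o u).

Definition is_weak_grad Omega (u : E -> R) (g : E -> E) : Prop :=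
  [/\ loc_integrable Omega u,
      (forall i : 'I_d, loc_integrable Omega (fun x => g x ord0 i)) &
      forall (phi : E -> R) (i : 'I_d), test_fun Omega phi ->
        \int[lam]_(x in Omega) (u x * grad phi x ord0 i) =
        - \int[lam]_(x in Omega) (g x ord0 i * phi x)].

(* The weak gradient is unique up to a null set of Omega; [wgrad] selects a
   representative, and is the null field if there is none. *)
Definition wgrad Omega (u : E -> R) : E -> E :=
  xget (fun=> 0) [set g | is_weak_grad Omega u g].

(* The closure of the test functions in W^{1,p}(Omega). *)
Definition W01 Omega p : set (E -> R) := [set u | exists g : E -> E,
  [/\ memLp Omega p u, memLpV Omega p g, is_weak_grad Omega u g &
    exists phi : nat -> E -> R,
      [/\ forall n, test_fun Omega (phi n),
          normLp Omega p (u \- phi n) @[n --> \oo] --> 0%E &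
          normLp Omega p (fun x => enorm (g x - grad (phi n) x))
            @[n --> \oo] --> 0%E]]].

Definition H10 Omega : set (E -> R) := W01 Omega 2.

Definition dotH10 Omega (u v : E -> R) : R :=
  \int[lam]_(x in Omega) dotv (wgrad Omega u x) (wgrad Omega v x).

Definition normH10 Omega (u : E -> R) : R := Num.sqrt (dotH10 Omega u u).

(* Elements of H10 Omega are representatives; the first condition expresses
   linearity together with independence of the representative. *)
Definition Hm1 Omega : set (H10 Omega -> R) := [set f |
  (forall (a : R) (u v w : H10 Omega),
     {ae lam, forall x, Omega x -> val w x = a * val u x + val v x} ->
     f w = a * f u + f v) /\
  (forall u : H10 Omega, forall e : R, 0 < e -> exists2 r : R, 0 < r &
     forall v : H10 Omega, normH10 Omega (val v \- val u) < r ->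
       `|f v - f u| < e)].

Lemma test_fun0 Omega : test_fun Omega (fun=> 0).
Proof.
have s0 vs : foldr (fun v psi => 'D_v psi) (fun=> 0 : R) vs = (fun=> 0) :> (E -> R).
  by elim: vs => //= v vs ->; apply/funext => x; rewrite derive_cst.
rewrite /test_fun.
rewrite (_ : [set _ | _] = set0); last by apply/seteqP; split=> x //=; rewrite eqxx.
rewrite closure0; split=> //; last exact: compact0.
by move=> vs x; rewrite s0; exact: differentiable_cst.
Qed.

Lemma memLp0 Omega q : 0 < q -> memLp Omega q (fun=> 0).
Proof.
move=> q0; rewrite /memLp (_ : _ \_ _ = cst 0); last first.
  by apply/funext => x; rewrite patchE if_same.
by rewrite inE; apply/andP; rewrite !inE /=; split=> //; rewrite /finite_norm Lnorm0// eqe gt_eqF.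
Qed.

Lemma normLp0 Omega q : 0 < q -> normLp Omega q (fun=> 0) = 0%E.
Proof.
move=> q0; rewrite /normLp (_ : _ \_ _ = cst 0) ?Lnorm0// ?eqe ?gt_eqF//.
by apply/funext => x; rewrite patchE if_same.
Qed.

Lemma loc_integrable0 Omega : loc_integrable Omega (fun=> 0).
Proof. by move=> K cK _; apply: integrable0. Qed.

Lemma H10_0 Omega : (fun=> 0) \in H10 Omega.
Proof.
have gE (x : E) : grad (fun=> 0 : R) x = 0.
  by apply/rowP => i; rewrite !mxE derive_cst.
rewrite inE; exists (fun=> 0); split.
- exact: memLp0.
- by move=> i; under eq_fun do rewrite mxE; exact: memLp0.
- split; first exact: loc_integrable0.
    by move=> i; under eq_fun do rewrite mxE; exact: loc_integrable0.
  move=> phi i _; under eq_Rintegral do rewrite mul0r.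
  by under [in RHS]eq_Rintegral do rewrite mxE mul0r; rewrite /Rintegral integral0 oppr0.
- exists (fun _ _ => 0); split=> [_||].
  + exact: test_fun0.
  + rewrite (_ : (fun=> _) = cst 0%E); first exact: cvg_cst.
    apply/funext => n; rewrite -[RHS](normLp0 Omega (ltr0n R 2))//.
    by congr normLp; apply/funext => x /=; rewrite subrr.
  + rewrite (_ : (fun=> _) = cst 0%E); first exact: cvg_cst.
    apply/funext => n; rewrite -[RHS](normLp0 Omega (ltr0n R 2))//.
    congr normLp; apply/funext => x /=; rewrite gE subrr /enorm /dotv.
    by rewrite big1 ?sqrtr0// => i _; rewrite mxE mul0r.
Qed.

(* The Dirichlet operator - Delta_D : H10 -> H^{-1}. *)
Definition mDelta Omega (u : H10 Omega) : H10 Omega -> R :=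
  fun phi => dotH10 Omega (val u) (val phi).

(* The default value is irrelevant on Hm1 Omega, where - Delta_D is onto. *)
Definition mDelta_inv Omega (f : H10 Omega -> R) : H10 Omega :=
  xget (SigSub (H10_0 Omega)) [set u | mDelta u = f].

(* <f, g>_{H^{-1}} = <(- Delta_D)^{-1} f, g> *)
Definition dotHm1 Omega (f g : H10 Omega -> R) : R := g (mDelta_inv f).

Definition is_tilde Omega p (f : H10 Omega -> R) (ft : E -> R) : Prop :=
  W01 Omega p ft /\
  forall (phi : H10 Omega) (phin : nat -> E -> R),
    (forall n, test_fun Omega (phin n)) ->
    normH10 Omega (phin n \- val phi) @[n --> \oo] --> 0 ->
    \int[lam]_(x in Omega) (ft x * phin n x) @[n --> \oo] --> f phi.

Definition XD Omega p : set (H10 Omega -> R) :=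
  [set f | Hm1 f /\ exists ft, is_tilde p f ft].

(* Unique up to a null set of Omega on XD. *)
Definition tilde Omega p (f : H10 Omega -> R) : E -> R :=
  xget (fun=> 0) [set ft | is_tilde p f ft].

Definition sigma p mu (y : E) : R := enorm y + mu / p * enorm y `^ p.

Definition subdiff_sigma p mu (x : E) : set E :=
  [set y | forall z : E, dotv y z + sigma p mu x <= sigma p mu (x + z)].

Definition FD Omega p mu (f : H10 Omega -> R) : \bar R :=
  if `[< XD p f >] then
    (\int[lam]_(x in Omega) (sigma p mu (wgrad Omega (tilde p f) x))%:E)%E
  else +oo%E.

Definition subdiff_FD Omega p mu (f : H10 Omega -> R) : set (H10 Omega -> R) :=
  [set g | Hm1 g /\ forall h : H10 Omega -> R, Hm1 h ->
    ((dotHm1 g h)%:E + FD p mu f <= FD p mu (f \+ h)%R)%E].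

(* w = div g in the sense of distributions on Omega *)
Definition is_div Omega (g : E -> E) (w : E -> R) : Prop :=
  forall phi : E -> R, test_fun Omega phi ->
    \int[lam]_(x in Omega) (w x * phi x) =
    - \int[lam]_(x in Omega) dotv (g x) (grad phi x).

End Spaces.

(* Main.v *)
From HB Require Import structures.
Require Import Defs.
From mathcomp Require Import all_boot all_order all_algebra.
From mathcomp Require Import all_classical all_reals all_analysis.
From mathcomp Require Import measurable_realfun.
From mathcomp Require Import ring lra.

(** Write [W] for the gradient of the representative of [f].  The gradient of the
representative of [h] depends linearly on [h], up to null sets, so [k] is a
subgradient at [f] exactly when, for [u] the inverse Dirichlet Laplacian of [k]
and for every [h] in [XD],
  h u <= int (sigma (W + grad h~) - sigma W)
([subdiffP]).  Both inclusions of the theorem are about this inequality.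

If [g] is a pointwise subgradient of [sigma] along [W] and satisfies the
orthogonality relation with [u = - div g], then [h u] is the integral of the
scalar product of [grad h~] and [g], and the inequality is the integral of the
pointwise one ([subgradient_of_field]).

Conversely, the inequality says that the linear map [grad h~ |-> h u] lies
below the convex functional [y |-> int (sigma (W + y) - sigma W)], and
Hahn-Banach extends it to a linear map [L] on all fields with p-integrable
components, still below that functional ([hahn_banach]).  The functional tends
to 0 along dominated pointwise convergence to 0, hence so does [L] ([dual_cvg]).
Therefore the value of [L] on the indicator of [A] in a coordinate direction is
a charge in [A] without mass on null sets, and the Radon-Nikodym densities of
these charges form a field [g] ([indic_charge_density]).  Testing the majorant with
indicators times rational vectors gives that [g] is almost everywhere a
subgradient of [sigma] along [W] ([ae_subgradient]).  As [sigma] grows like the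
power p, its subgradients grow like the power p - 1, which puts [g] in the
conjugate space ([density_LpV]) and lets one pass from simple to arbitrary
fields: [L] is integration against [g] ([L_dotv]).  On gradients of
representatives this is the orthogonality relation; on gradients of test
functions, which represent integration against themselves, it says that
[- u] is the distributional divergence of [g] ([field_of_subgradient]).

Three facts make this meaningful for functions instead of classes.  A locally
integrable function orthogonal to all test functions vanishes almost everywhere
([loc_integral_test0]), so that weak gradients and representatives are unique
up to null sets.  The Dirichlet Laplacian maps onto the dual space
([riesz_H10]): a functional is represented by the limit of a minimizing sequence
of test functions, which is Cauchy for the Dirichlet norm, hence for the norm of
square integrable functions by the Poincare inequality ([poincare_test]).
Finally a bounded functional takes the same value on two functions with the same
Dirichlet Laplacian ([mDelta_inj]), so the choices made in inverting it are
harmless.  The calculus underneath is the vanishing of the integral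
of a derivative of a compactly supported smooth function
([integral_derive0]). *)

Set Implicit Arguments.
Unset Strict Implicit.
Unset Printing Implicit Defensive.

Import Order.TTheory GRing.Theory Num.Theory.
Import numFieldNormedType.Exports.

Local Open Scope classical_set_scope.
Local Open Scope ring_scope.

(** * Boxes and the translation invariance of Lebesgue measure *)

Section Boxes.
Context (R : realType) (d : nat).
Local Notation E := 'rV[R]_d.
Local Notation lam := (@lebesgue_rV R d).

Definition obox (a b : E) : set E :=
  [set x | forall i, a ord0 i < x ord0 i < b ord0 i].

Definition oboxes : set (set E) := [set B | exists a b, B = obox a b].

Lemma measurable_rVE : @measurable _ E = <<s open >>.
Proof. by []. Qed.

Lemma measurable_obox (a b : E) : measurable (obox a b).
Proof.
rewrite (_ : obox a b = \bigcap_(i in [set: 'I_d])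
    ((fun x : E => x ord0 i) @^-1` `]a ord0 i, b ord0 i[)).
  apply: fin_bigcap_measurable => // i _; rewrite -[X in measurable X]setTI.
  by apply: measurable_coord => //; exact: measurable_itv.
apply/seteqP; split=> x xab i.
  by move=> _ /=; rewrite in_itv/=; exact: xab.
by have := xab i I; rewrite /= in_itv.
Qed.

Lemma oboxI (a b a' b' : E) : obox a b `&` obox a' b' =
  obox (\row_i Num.max (a ord0 i) (a' ord0 i)) (\row_i Num.min (b ord0 i) (b' ord0 i)).
Proof.
apply/seteqP; split=> [x [xab xab'] i|x xab].
  by rewrite !mxE gt_max lt_min; move: (xab i) (xab' i) => /andP[-> ->] /andP[-> ->].
by split=> i; have := xab i; rewrite !mxE gt_max lt_min =>
   /andP[/andP[? ?] /andP[? ?]]; apply/andP.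
Qed.

Lemma oboxesI : setI_closed oboxes.
Proof. by move=> _ _ [a [b ->]] [a' [b' ->]]; rewrite oboxI; eexists; eexists. Qed.

Lemma ball_obox (c : E) (r : R) : 0 < r ->
  ball c r = obox (c - const_mx r) (c + const_mx r).
Proof.
move=> r0; apply/seteqP; split=> [x [_ cx] i|x cx].
  by have := cx ord0 i; rewrite /ball/= !mxE ltr_distlC.
split=> // i j; rewrite (ord1 i); have := cx j.
by rewrite !mxE /ball/= ltr_distlC.
Qed.

Lemma measurable_rV_oboxes : @measurable _ E = <<s oboxes >>.
Proof.
apply/seteqP; split; last first.
  apply: smallest_sub; first exact: sigma_algebra_measurable.
  by move=> _ [a [b ->]]; exact: measurable_obox.
rewrite measurable_rVE; apply: smallest_sub; first exact: smallest_sigma_algebra.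
move=> A oA; rewrite (open_bigcup_rat_ball oA) bigcup_mkcond.
have [_ _ sU] := smallest_sigma_algebra [set: E] oboxes.
have : forall q : 'rV[rat]_d * nat, <<s oboxes >>
    (if q \in [set q : 'rV[rat]_d * nat |
        ball (map_mx ratr q.1 : 'rV[R]_d) (q.2.+1%:R^-1) `<=` A]
     then ball (map_mx ratr q.1 : E) (q.2.+1%:R^-1) else set0).
  move=> q; case: ifPn => _.
    apply: sub_sigma_algebra; rewrite ball_obox ?invr_gt0//.
    by eexists; eexists.
  by have [] := smallest_sigma_algebra [set: E] oboxes.
move=> mF.
apply: (@countable_bigcupT_measurable _ (g_sigma_algebraType oboxes)) => //.
Qed.

Lemma lebesgue_obox (a b : E) :
  lam (obox a b) = (\prod_(i < d) lebesgue_measure `]a ord0 i, b ord0 i[%classic)%E.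
Proof.
rewrite -(@lebesgue_rV_box R d (fun i => `]a ord0 i, b ord0 i[%classic)); last first.
  by move=> i; exact: measurable_itv.
congr (lam _); apply/seteqP; split=> x xab i; have := xab i; by rewrite /= in_itv.
Qed.

Lemma lebesgue_obox_fin (a b : E) : (lam (obox a b) < +oo)%E.
Proof.
rewrite lebesgue_obox -ge0_fin_numE; last first.
  by apply: prode_ge0 => i _; exact: measure_ge0.
apply/prode_fin_num => i _; rewrite lebesgue_measure_itv /=.
by case: ifP.
Qed.

Definition grow_box (n : nat) : set E := obox (const_mx (- n%:R)) (const_mx n%:R).

Lemma bigcup_grow_box : \bigcup_n grow_box n = [set: E].
Proof.
apply/seteqP; split=> // x _.
(* the sum bounds every coordinate at once *)
exists (\sum_(i < d) (Num.truncn `|x ord0 i|).+1)%N => // i.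
rewrite !mxE -ltr_norml (lt_le_trans (truncnS_gt _))// ler_nat.
by rewrite (bigD1 i)//= leq_addr.
Qed.

(** Boxes generate the Borel sets, are stable under intersection and exhaust the
space by sets of finite measure. *)
Lemma oboxes_unique (m1 m2 : {measure set E -> \bar R}) :
  (forall a b, m1 (obox a b) = m2 (obox a b)) ->
  (forall a b, (m1 (obox a b) < +oo)%E) ->
  forall A, measurable A -> m1 A = m2 A.
Proof.
move=> m12 m1oo; apply: (@measure_unique _ _ _ oboxes grow_box) => //.
- exact: measurable_rV_oboxes.
- exact: oboxesI.
- by move=> n; rewrite /oboxes /grow_box; eexists; eexists.
- exact: bigcup_grow_box.
- by move=> _ [a [b ->]].
- by move=> k; exact: m1oo.
Qed.

Lemma measurable_shift (w : E) : measurable_fun [set: E] (fun x : E => x + w).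
Proof.
apply/measurable_fun_rVP => i; under eq_fun do rewrite mxE.
by apply: measurable_funD => //; exact: measurable_coord.
Qed.

Lemma lebesgue_rV_shift (w : E) (A : set E) : measurable A ->
  pushforward lam (fun x => x + w) A = lam A.
Proof.
have mw := measurable_shift w.
pose m1 : {measure set E -> \bar R} :=
   measure_function_pushforward__canonical__measure_function_Measure lam mw.
move=> mA; rewrite -[LHS]/(m1 A); apply: oboxes_unique mA => a b.
- have -> : m1 (obox a b) = lam (obox (a - w) (b - w)).
    rewrite /m1/= /pushforward; congr (lam _).
    by apply/seteqP; split=> x /= xab i; have := xab i;
       rewrite !mxE ltrBlDr ltrBrDr.
  rewrite lebesgue_obox [RHS]lebesgue_obox.
  apply: eq_bigr => i _; rewrite !lebesgue_measure_itv/= !mxE !lte_fin ltrD2r.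
  by case: ifP => // _; rewrite -!EFinD; congr (_%:E); lra.
- rewrite /m1/= /pushforward.
  rewrite (_ : _ @^-1` _ = obox (a - w) (b - w)) ?lebesgue_obox_fin//.
  by apply/seteqP; split=> x /= xab i; have := xab i;
     rewrite !mxE ltrBlDr ltrBrDr.
Qed.

(** The pushforward of the measure under a translation is the measure itself, as
both give a box the product of the lengths of its sides. *)
Lemma integral_shift (w : E) (f : E -> R) : measurable_fun setT f ->
  lam.-integrable setT (EFin \o f) ->
  \int[lam]_x f (x + w) = \int[lam]_x f x.
Proof.
move=> mf intf.
have mw := measurable_shift w.
pose m1 : {measure set E -> \bar R} :=
   measure_function_pushforward__canonical__measure_function_Measure lam mw.
have m1E A : measurable A -> A `<=` setT -> m1 A = lam A.
  by move=> mA _; exact: lebesgue_rV_shift.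
rewrite /Rintegral; congr fine.
rewrite -[RHS](@eq_measure_integral _ _ _ _ _ m1)//.
have /integrableP[mEf intf'] := intf.
rewrite (@integral_pushforward _ _ _ _ _ _ mw)//.
rewrite preimage_setT; apply/integrableP; split.
  exact: measurableT_comp.
apply: le_lt_trans intf'.
rewrite -[leRHS](@eq_measure_integral _ _ _ _ _ m1)//.
rewrite (@ge0_integral_pushforward _ _ _ _ _ _ mw)//.
  by apply: measurableT_comp.
Qed.

End Boxes.

(** * Smooth functions *)

Section Smooth.
Context (R : realType) (d : nat).
Local Notation E := 'rV[R]_d.
Local Notation lam := (@lebesgue_rV R d).
Implicit Types (f g : E -> R).

(** All iterated derivatives stay in a class of differentiable functions that is
stable under directional derivatives; this replaces inductions on the list of
directions. *)
Lemma smooth_coind (C : (E -> R) -> Prop) :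
  (forall f, C f -> (forall x, differentiable f x) /\ forall v : E, C ('D_v f)) ->
  forall f, C f -> smooth f.
Proof.
move=> HC f Cf vs x; suff /HC[] : C (foldr (fun v psi => 'D_v psi) f vs) by [].
by elim: vs => //= v vs /HC[_]; exact.
Qed.

Lemma smooth_differentiable f x : smooth f -> differentiable f x.
Proof. by move=> /(_ [::] x). Qed.

Lemma smooth_derive f (v : E) : smooth f -> smooth ('D_v f).
Proof. by move=> sf vs x; have := sf (rcons vs v) x; rewrite foldr_rcons. Qed.

Lemma smooth_derivable f x v : smooth f -> derivable f x v.
Proof. by move=> sf; apply: diff_derivable; exact: smooth_differentiable. Qed.

Lemma smooth_continuous f : smooth f -> continuous f.
Proof. by move=> sf x; apply: differentiable_continuous; exact: smooth_differentiable. Qed.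

(** The algebra generated by [B].  By the Leibniz rule it suffices that the
derivatives of the generators lie in it, even if they are not generators
themselves. *)
Inductive smooth_alg (B : (E -> R) -> Prop) : (E -> R) -> Prop :=
| smooth_alg_base f : B f -> smooth_alg B f
| smooth_algD f g : smooth_alg B f -> smooth_alg B g -> smooth_alg B (f + g)
| smooth_algM f g : smooth_alg B f -> smooth_alg B g -> smooth_alg B (f * g).

Lemma smooth_alg_smooth B :
  (forall f, B f -> (forall x, differentiable f x) /\
                    forall v : E, smooth_alg B ('D_v f)) ->
  forall f, smooth_alg B f -> smooth f.
Proof.
move=> HB; apply: smooth_coind => f; elim=> {f}
  [f /HB //|f g Bf [df Df] Bg [dg Dg]|f g Bf [df Df] Bg [dg Dg]].
- split=> [x|v]; first exact: differentiableD.
  rewrite (_ : 'D_v _ = 'D_v f + 'D_v g); first exact: smooth_algD.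
  by apply/funext => x; rewrite deriveD//; exact: diff_derivable.
- split=> [x|v]; first exact: differentiableM.
  rewrite (_ : 'D_v _ = f * 'D_v g + g * 'D_v f).
    by apply: smooth_algD; exact: smooth_algM.
  by apply/funext => x; rewrite deriveM//; exact: diff_derivable.
Qed.

Let smooth_alg_smooth_id f : smooth_alg (@smooth R d) f -> smooth f.
Proof.
apply: smooth_alg_smooth => {}f sf; split=> [x|v]; first exact: smooth_differentiable.
by apply: smooth_alg_base; exact: smooth_derive.
Qed.

Lemma smoothD f g : smooth f -> smooth g -> smooth (f + g).
Proof. by move=> ? ?; apply/smooth_alg_smooth_id/smooth_algD; exact: smooth_alg_base. Qed.

Lemma smoothM f g : smooth f -> smooth g -> smooth (f * g).
Proof. by move=> ? ?; apply/smooth_alg_smooth_id/smooth_algM; exact: smooth_alg_base. Qed.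

Lemma smooth_cst (c : R) : smooth (cst c : E -> R).
Proof.
apply: (@smooth_coind (fun f => exists c, f = cst c)); last by exists c.
move=> _ [{}c ->]; split=> [x|v]; first exact: differentiable_cst.
by exists 0; apply/funext => x; rewrite derive_cst.
Qed.

Lemma smooth_prod (I : Type) (s : seq I) (F : I -> E -> R) :
  (forall i, smooth (F i)) -> smooth (fun x => \prod_(i <- s) F i x).
Proof.
move=> sF; elim: s => [|i s IHs].
  by under eq_fun do rewrite big_nil; exact: smooth_cst.
by under eq_fun do rewrite big_cons; exact: smoothM.
Qed.

Lemma derive_coord (i : 'I_d) (x v : E) : 'D_v (fun y : E => y ord0 i) x = v ord0 i.
Proof.
have /= := @derive_mx R E 1 d id x v (@derivable_id _ _ x v).
by rewrite derive_id => /matrixP/(_ ord0 i); rewrite mxE => ->.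
Qed.

Lemma smooth_coord (i : 'I_d) : smooth (fun x : E => x ord0 i).
Proof.
apply: (@smooth_alg_smooth (fun f => f = (fun x : E => x ord0 i) \/ exists c, f = cst c)).
  move=> _ [->|[c ->]]; split=> [x|v].
  - exact: differentiable_coord.
  - apply: smooth_alg_base; right; exists (v ord0 i).
    by apply/funext => x; rewrite derive_coord.
  - exact: differentiable_cst.
  - apply: smooth_alg_base; right; exists 0.
    by apply/funext => x; rewrite derive_cst.
by apply: smooth_alg_base; left.
Qed.

Lemma derive_comp_real (r r' : R -> R) (a : E -> R) (x v : E) :
  is_derive (a x) 1 r (r' (a x)) -> differentiable a x ->
  differentiable (r \o a) x /\ 'D_v (r \o a) x = r' (a x) * 'D_v a x.
Proof.
move=> [dr rE] da.
have dr' : differentiable r (a x) by exact/derivable1_diffP.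
split; first exact: differentiable_comp.
rewrite !deriveE//; last exact: differentiable_comp.
by rewrite diff_comp//= deriv1E//= derive1E rE mulrC.
Qed.

End Smooth.

Section Bump.
Context (R : realType).

(** Differentiating [s^-k expR (- s^-1)] produces other powers of [s^-1], so the
whole family is introduced at once: it spans a space stable under derivation. *)
Definition flat (k : nat) (s : R) : R :=
  if 0 < s then s^-1 ^+ k * expR (- s^-1) else 0.

Lemma flat_ge0 k s : 0 <= flat k s.
Proof.
by rewrite /flat; case: ifPn => // s0; rewrite mulr_ge0 ?expR_ge0// exprn_ge0// invr_ge0 ltW.
Qed.

Lemma flat0_le1 s : flat 0 s <= 1.
Proof.
rewrite /flat; case: ifPn => // s0; rewrite expr0 mul1r -expR0 ler_expR.
by rewrite oppr_le0 invr_ge0 ltW.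
Qed.

(** The exponential beats the power: [s^-(k+1) <= (k+1)! expR s^-1]. *)
Lemma flat_le k s : flat k s <= (k.+1)`!%:R * `|s|.
Proof.
rewrite /flat; case: ifPn => s0; last by rewrite mulr_ge0.
have y0 : 0 < s^-1 by rewrite invr_gt0.
rewrite gtr0_norm// expRN.
have h := expR_ge1Dxn k (ltW y0).
have {h} h : s^-1 ^+ k.+1 / (k.+1)`!%:R <= expR s^-1 by apply: le_trans h; rewrite lerDr.
have f0 : 0 < (k.+1)`!%:R :> R by rewrite ltr0n fact_gt0.
rewrite ler_pdivrMr ?expR_gt0// -mulrA -ler_pdivrMl//.
rewrite -ler_pdivrMl//; apply: le_trans h.
by rewrite mulrCA mulrC exprS; lra.
Qed.

Lemma is_derive_flat k (s : R) :
  is_derive s 1 (flat k) (flat k.+2 s - k%:R * flat k.+1 s).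
Proof.
have [s0|s0|->] := ltgtP s 0.
- have -> : flat k.+2 s - k%:R * flat k.+1 s = 0.
    by rewrite /flat ltNge (ltW s0)/= mulr0 subr0.
  apply: (@near_eq_is_derive _ _ _ (cst 0)) => //.
  near=> t; rewrite /flat ltNge ifF//; apply/negbTE; rewrite negbK ltW//.
  by near: t; exact: lt_nbhsl.
- have -> : flat k.+2 s - k%:R * flat k.+1 s =
    s^-1 ^+ k * (- (- s ^- 2 * expR (- s^-1))) + expR (- s^-1) * (k%:R * s^-1 ^+ k.-1 * - s ^- 2).
    rewrite /flat s0; have sn : s != 0 by rewrite gt_eqF.
    case: k => [|k]; rewrite /= ?exprS ?expr0 ?expr1; field; exact: sn.
  apply: (@near_eq_is_derive _ _ _ ((fun t => t^-1 ^+ k) * (fun t => expR (- t^-1)))).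
  + by near=> t; rewrite /flat ifT//; near: t; exact: lt_nbhsr.
  + have iV : is_derive s 1 (fun t : R => t^-1) (- s ^- 2).
      have := @is_deriveV R id s 1 1 (lt0r_neq0 s0) (is_derive_id s 1).
      by rewrite [_ *: _]mulr1.
    have iX : is_derive s 1 (fun t : R => t^-1 ^+ k) (k%:R * s^-1 ^+ k.-1 * - s ^- 2).
      have := is_deriveX k iV.
      by rewrite (_ : (fun t : R => t^-1) ^+ k = (fun t => t^-1 ^+ k)) // exprfctE.
    have iE : is_derive s 1 (fun t : R => expR (- t^-1)) (expR (- s^-1) * - - s ^- 2).
      exact: (is_derive1_comp (is_derive_expR _) (is_deriveN iV)).
    have := is_deriveM iX iE; congr is_derive.
    by rewrite /GRing.scale/=; ring.
(* at 0 the difference quotient of [flat k] is [flat k.+1], which [flat_le]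
   sends to 0 *)
- have flat00 j : flat j 0 = 0 by rewrite /flat ltxx.
  rewrite !flat00 mulr0 subr0.
  have H : h^-1 *: ((flat k \o shift 0) (h *: 1) - flat k 0) @[h --> 0^'] --> (0 : R).
    have E h : h^-1 *: ((flat k \o shift 0) (h *: 1) - flat k 0) = flat k.+1 h.
      rewrite flat00 subr0 /= addr0 [h *: _]mulr1 /flat; case: ifP => _; last by rewrite scaler0.
      by rewrite exprS -mulrA.
    under eq_fun do rewrite E.
    apply/cvgrPdist_le => e e0; near=> h.
    rewrite sub0r normrN ger0_norm ?flat_ge0// (le_trans (flat_le _ _))//.
    rewrite -ler_pdivlMl ?ltr0n ?fact_gt0//.
    near: h; apply: dnbhs0_le; rewrite mulr_gt0// invr_gt0 ltr0n fact_gt0//.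
  by apply: DeriveDef; [apply/cvg_ex; exists 0|exact/cvg_lim].
Unshelve. all: end_near. Qed.
End Bump.

(** * Bump functions on boxes *)

Section BoxBump.
Context (R : realType) (d : nat).
Local Notation E := 'rV[R]_d.

Lemma derive_affine (i : 'I_d) (c e : R) (x v : E) :
  'D_v (fun y : E => c * y ord0 i + e) x = c * v ord0 i.
Proof.
have dc := @smooth_derivable R d _ x v (@smooth_coord R d i).
have -> : (fun y : E => c * y ord0 i + e) = (c \*: (fun y : E => y ord0 i)) + cst e by [].
rewrite deriveD//; last exact: derivableZ.
by rewrite deriveZ// derive_cst addr0 derive_coord.
Qed.

(** The composites of the [flat k] with one fixed affine function, together with
the constants, generate an algebra stable under derivation. *)
Lemma smooth_flat_affine (k : nat) (i : 'I_d) (c e : R) :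
  smooth (fun x : E => flat k (c * x ord0 i + e)).
Proof.
pose a := fun x : E => c * x ord0 i + e.
have sa : smooth a.
  apply: smoothD; last exact: smooth_cst.
  by apply: smoothM; [exact: smooth_cst|exact: smooth_coord].
pose B (f : E -> R) := (exists k, f = flat k \o a) \/ exists c, f = cst c.
have Bk j : smooth_alg B (flat j \o a).
  by apply: smooth_alg_base; left; exists j.
have Bc r : smooth_alg B (cst r) by apply: smooth_alg_base; right; exists r.
apply: (smooth_alg_smooth _ (Bk k)) => _ [[j ->]|[r ->]]; last first.
  split=> [x|v]; first exact: differentiable_cst.
  rewrite (_ : 'D_v _ = cst 0); first exact: Bc.
  by apply/funext => x; rewrite derive_cst.
have H x v := @derive_comp_real R d (flat j) (fun s => flat j.+2 s - j%:R * flat j.+1 s)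
   a x v (is_derive_flat j (a x)) (smooth_differentiable x sa).
split=> [x|v]; first by have [] := H x 0.
rewrite (_ : 'D_v _ =
    (flat j.+2 \o a + cst (- j%:R) * (flat j.+1 \o a)) * cst (c * v ord0 i)).
  by apply: smooth_algM => //; apply: smooth_algD => //; apply: smooth_algM.
apply/funext => x; have [_ ->] := H x v; rewrite derive_affine.
by rewrite -[RHS]/((flat j.+2 (a x) + - j%:R * flat j.+1 (a x)) * (c * v ord0 i)) mulNr.
Qed.

(** Positive exactly on the open box; the factor [n.+1] steepens the walls, so that
the bumps tend to the indicator of the box. *)
Definition box_bump (a b : E) (n : nat) (x : E) : R :=
  \prod_(i < d) (flat 0 (n.+1%:R * x ord0 i + - (n.+1%:R * a ord0 i)) *
                 flat 0 (- n.+1%:R * x ord0 i + n.+1%:R * b ord0 i)).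

Lemma smooth_box_bump a b n : smooth (box_bump a b n).
Proof.
by apply: smooth_prod => i; apply: smoothM; exact: smooth_flat_affine.
Qed.

Lemma box_bump_ge0 a b n x : 0 <= box_bump a b n x.
Proof. by apply: prodr_ge0 => i _; rewrite mulr_ge0// flat_ge0. Qed.

Lemma box_bump_le1 a b n x : box_bump a b n x <= 1.
Proof.
apply: prodr_ile1 => i _; rewrite mulr_ge0 ?flat_ge0//=.
by rewrite mulr_ile1 ?flat_ge0// flat0_le1.
Qed.

Lemma box_bump_supp a b n : [set x | box_bump a b n x != 0] `<=` obox a b.
Proof.
move=> x /=; rewrite prodf_seq_neq0 => /allP H i.
have := H i (mem_index_enum i); rewrite /= mulf_eq0 negb_or /flat.
case: ifPn => [h1|]; last by rewrite eqxx.
move=> H2; have {H2} h2 : 0 < - n.+1%:R * x ord0 i + n.+1%:R * b ord0 i.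
  by move: H2; case: ifPn => //; rewrite eqxx andbF.
rewrite -mulrBr pmulr_rgt0 ?ltr0n// subr_gt0 in h1.
by rewrite mulNr addrC -mulrBr pmulr_rgt0 ?ltr0n// subr_gt0 in h2; rewrite h1 h2.
Qed.

Lemma flat0_cvg1 (s : R) : 0 < s -> flat 0 (n.+1%:R * s) @[n --> \oo] --> (1 : R).
Proof.
move=> s0.
have -> : (fun n => flat 0 (n.+1%:R * s)) = (fun n => expR (- (n.+1%:R^-1 * s^-1))).
  by apply/funext => n; rewrite /flat mulr_gt0// expr0 mul1r invfM.
have h : - (n.+1%:R^-1 * s^-1) @[n --> \oo] --> (0 : R).
  rewrite -[X in _ --> X]oppr0; apply: cvgN.
  by rewrite -[X in _ --> X](mul0r s^-1); apply: cvgMl; exact: cvg_harmonic.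
by have := cvg_comp _ _ h (@continuous_expR R 0); rewrite expR0.
Qed.

Lemma box_bump_cvg (a b x : E) : obox a b x -> box_bump a b n x @[n --> \oo] --> (1 : R).
Proof.
move=> xab; rewrite (_ : 1 = \prod_(i < d) (1 * 1)); last first.
  by rewrite mulr1 big1_eq.
rewrite /box_bump; apply: cvg_big => [|i _].
  by move=> r; apply: mul_continuous.
have /andP[ax xb] := xab i; apply: cvgM.
  under eq_fun do rewrite -mulrBr; by apply: flat0_cvg1; rewrite subr_gt0.
under eq_fun do rewrite mulNr addrC -mulrBr; by apply: flat0_cvg1; rewrite subr_gt0.
Qed.

Definition cbox (a b : E) : set E :=
  [set x | forall i, a ord0 i <= x ord0 i <= b ord0 i].

Lemma compact_cbox a b : compact (cbox a b).
Proof.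
rewrite (_ : cbox a b = [set x | forall i, `[a ord0 i, b ord0 i]%classic (x ord0 i)]).
  by apply: (@rV_compact _ _ (fun i => `[a ord0 i, b ord0 i]%classic)) => i; exact: segment_compact.
by apply/seteqP; split=> x H i; have := H i; rewrite /= in_itv.
Qed.

Lemma compact_rV_closed (K : set E) : compact K -> closed K.
Proof. by apply: compact_closed; exact: norm_hausdorff. Qed.

Lemma test_fun_sub (Omega K : set E) (phi : E -> R) : smooth phi -> compact K ->
  K `<=` Omega -> [set x | phi x != 0] `<=` K -> test_fun Omega phi.
Proof.
move=> sphi cK KO pK.
have cpK : closure [set x | phi x != 0] `<=` K.
  by rewrite (closure_id K).1; [exact: closure_subset|exact: compact_rV_closed].
split=> //; last exact: subset_trans KO.
by apply: subclosed_compact cK cpK; exact: closed_closure.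
Qed.

Lemma test_box_bump (Omega : set E) a b n : cbox a b `<=` Omega ->
  test_fun Omega (box_bump a b n).
Proof.
move=> abO; apply: (test_fun_sub _ (@compact_cbox a b)) => //.
  exact: smooth_box_bump.
move=> x /box_bump_supp xab i; have /andP[/ltW -> /ltW ->] := xab i.
by [].
Qed.

Lemma test_fun_out (Omega : set E) phi x : test_fun Omega phi -> ~ Omega x -> phi x = 0.
Proof.
move=> [_ _ sO] nO; apply/eqP/negPn/negP => px; apply: nO; apply: sO.
exact: subset_closure.
Qed.

Lemma test_funM (Omega : set E) phi psi : test_fun Omega phi -> smooth psi ->
  test_fun Omega (phi * psi).
Proof.
move=> [sphi cK KO] spsi; apply: (test_fun_sub (smoothM sphi spsi) cK KO).
move=> x /= H; apply: subset_closure => /=; apply: contra_neq H => H.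
by rewrite /GRing.mul/= H mul0r.
Qed.

Lemma test_funD (Omega : set E) phi psi : test_fun Omega phi -> test_fun Omega psi ->
  test_fun Omega (phi + psi).
Proof.
move=> [sphi cK KO] [spsi cL LO].
apply: (test_fun_sub (smoothD sphi spsi) (compactU cK cL)); first by rewrite subUset.
move=> x /= H; have [px|px] := eqVneq (phi x) 0; last by left; exact: subset_closure.
right; apply: subset_closure => /=; apply: contra_neq H => H.
by rewrite -[LHS]/(phi x + psi x) px H addr0.
Qed.

Lemma test_funZ (Omega : set E) phi (c : R) : test_fun Omega phi ->
  test_fun Omega (fun x => c * phi x).
Proof.
move=> tp; have := test_funM tp (@smooth_cst R d c).
congr test_fun; apply/funext => x; exact: mulrC.
Qed.

End BoxBump.

(** * Integration by parts *)

Section RealIntegrable.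
Context d (T : measurableType d) (R : realType) (mu : {measure set T -> \bar R}).
Context (D : set T) (mD : measurable D).
Implicit Types f g : T -> R.
Local Notation intg f := (mu.-integrable D (EFin \o f)).

Lemma integrable_measurable f : intg f -> measurable_fun D f.
Proof. by move=> /integrableP[/measurable_EFinP]. Qed.

Lemma rintegrableD f g : intg f -> intg g -> intg (fun x => f x + g x).
Proof. by move=> fi gi; exact: (integrableD mD fi gi). Qed.

Lemma rintegrableB f g : intg f -> intg g -> intg (fun x => f x - g x).
Proof. by move=> fi gi; exact: (integrableB mD fi gi). Qed.

Lemma rintegrableZ (k : R) f : intg f -> intg (fun x => k * f x).
Proof. by move=> fi; exact: (integrableZl mD k fi). Qed.

Lemma rintegrable_sum (I : Type) (s : seq I) (F : I -> T -> R) :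
  (forall i, intg (F i)) -> intg (fun x => \sum_(i <- s) F i x).
Proof.
move=> Fi; elim: s => [|i s IHs].
  by under [fun x => _]eq_fun do rewrite big_nil; exact: integrable0.
by under [fun x => _]eq_fun do rewrite big_cons; exact: rintegrableD.
Qed.

Lemma le_rintegrable f g : measurable_fun D f -> (forall x, D x -> `|f x| <= g x) ->
  intg g -> intg f.
Proof.
move=> mf fg; apply: le_integrable => //; first exact/measurable_EFinP.
by move=> x Dx; rewrite /= lee_fin (le_trans (fg x Dx))// ler_norm.
Qed.

Lemma rintegrable_abs f : intg f -> intg (fun x => `|f x|).
Proof. exact: integrable_norm. Qed.

Lemma RintegralN f : intg f -> \int[mu]_(x in D) (- f x) = - \int[mu]_(x in D) f x.
Proof.
move=> fi; rewrite -mulN1r -RintegralZl//.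
by apply: eq_Rintegral => x _; rewrite mulN1r.
Qed.

Lemma Rintegral_sum (I : Type) (s : seq I) (F : I -> T -> R) :
  (forall i, intg (F i)) ->
  \int[mu]_(x in D) (\sum_(i <- s) F i x) = \sum_(i <- s) \int[mu]_(x in D) F i x.
Proof.
move=> Fi; elim: s => [|i s IHs].
  rewrite big_nil; under eq_Rintegral do rewrite big_nil.
  by rewrite /Rintegral integral0.
rewrite big_cons; under eq_Rintegral do rewrite big_cons.
by rewrite RintegralD//; [rewrite IHs|exact: rintegrable_sum].
Qed.

Lemma EFin_Rintegral f : intg f -> (\int[mu]_(x in D) f x)%:E = (\int[mu]_(x in D) (f x)%:E)%E.
Proof. by move=> fi; rewrite /Rintegral fineK//; exact: integrable_fin_num. Qed.

Lemma ae_eq_Rintegral f g : measurable_fun D f -> measurable_fun D g ->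
  {ae mu, forall x, D x -> f x = g x} ->
  \int[mu]_(x in D) f x = \int[mu]_(x in D) g x.
Proof.
move=> mf mg fg; rewrite /Rintegral; congr fine; apply: ae_eq_integral => //.
- exact/measurable_EFinP.
- exact/measurable_EFinP.
- by apply: filterS fg => x h Dx; rewrite /= h.
Qed.

Lemma ae_eq_rintegrable f g : measurable_fun D g ->
  {ae mu, forall x, D x -> f x = g x} -> intg f -> intg g.
Proof.
move=> mg fg /integrableP[mf fi]; apply/integrableP; split.
  exact/measurable_EFinP.
rewrite (@ae_eq_integral _ _ _ mu D (fun x => `|(EFin \o f) x|%E))//.
- by apply: measurableT_comp => //; exact/measurable_EFinP.
- exact: measurableT_comp.
- by apply: filterS fg => x h Dx; rewrite /= h.
Qed.

Lemma RintegralDCT (f_ : (T -> R)^nat) f g :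
  (forall n, measurable_fun D (f_ n)) -> measurable_fun D f ->
  (forall x, D x -> f_ n x @[n --> \oo] --> f x) -> intg g ->
  (forall n x, D x -> `|f_ n x| <= g x) ->
  intg f /\ \int[mu]_(x in D) f_ n x @[n --> \oo] --> \int[mu]_(x in D) f x.
Proof.
move=> mf_ mf f_f gi f_g.
have fi_ n : intg (f_ n).
  by apply: le_rintegrable gi => // x Dx; exact: f_g.
have [||||fi _ h] := @dominated_convergence _ _ _ mu D mD
  (fun n => EFin \o f_ n) (EFin \o f) _ _ _ _ gi.
- by move=> n; exact/measurable_EFinP.
- exact/measurable_EFinP.
- by apply/aeW => x Dx; apply: cvg_EFin; [exact: nearW|exact: f_f].
- by apply/aeW => x n Dx; rewrite /= lee_fin; exact: f_g.
split=> //; rewrite /Rintegral; apply: fine_cvg.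
by rewrite fineK//; exact: integrable_fin_num.
Qed.

End RealIntegrable.

Section IntegrateByParts.
Context (R : realType) (d : nat).
Local Notation E := 'rV[R]_d.
Local Notation lam := (@lebesgue_rV R d).

Lemma continuous_measurable_rV (f : E -> R) : continuous f -> measurable_fun setT f.
Proof.
move=> cf; apply: (measurability _ (RGenOpens.measurableE R)).
move=> _ [_ [a [b ->] <-]]; rewrite setTI; apply: open_measurable_rV.
by apply: open_comp; [move=> ? _; exact: cf | exact: interval_open].
Qed.

Lemma bounded_rV_ex (K : set E) : bounded_set K ->
  exists2 r : R, 0 < r & forall x, K x -> `|x| < r.
Proof.
move=> [M [_ HM]]; exists (Num.max M 0 + 1); first by rewrite ltr_wpDl// le_max lexx orbT.
move=> x Kx; rewrite (@le_lt_trans _ _ (Num.max M 0 + 1 / 2))//; last by rewrite ltrD2l; lra.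
by apply: HM => //; rewrite (@le_lt_trans _ _ (Num.max M 0))// ?le_max ?lexx// ltrDl; lra.
Qed.

Lemma normr_lt_obox (x : E) (r : R) : `|x| < r -> obox (const_mx (- r)) (const_mx r) x.
Proof.
move=> xr i; rewrite !mxE -ltr_norml; apply: le_lt_trans xr.
rewrite [leRHS]/Num.Def.normr/= mx_normrE.
exact: (le_bigmax _ (fun ij => `|x ij.1 ij.2|) (ord0, i)).
Qed.

Lemma bounded_rV_finite (K : set E) : bounded_set K -> measurable K -> (lam K < +oo)%E.
Proof.
move=> /bounded_rV_ex[r r0 Kr] mK.
apply: le_lt_trans (lebesgue_obox_fin (const_mx (- r) : E) (const_mx r)).
apply: le_measure; rewrite ?inE//; first exact: measurable_obox.
by move=> x /Kr; exact: normr_lt_obox.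
Qed.

Lemma integrable_cst_obox (M : R) (a b : E) :
  lam.-integrable setT (EFin \o (fun x => M * \1_(obox a b) x)).
Proof.
have mB := measurable_obox a b.
rewrite (_ : EFin \o _ = (fun x => M%:E * (EFin \o \1_(obox a b)) x)%E)//.
apply: integrableZl => //; apply/integrableP; split.
  by apply/measurable_EFinP; exact: measurable_indic.
rewrite (eq_integral (fun x => (\1_(obox a b) x)%:E)); last first.
  by move=> t _; rewrite gee0_abs// lee_fin.
by rewrite integral_indic// setIT lebesgue_obox_fin.
Qed.

Lemma bounded_box_integrable (f : E -> R) (M r : R) : measurable_fun setT f ->
  (forall x, `|f x| <= M) -> (forall x, r <= `|x| -> f x = 0) ->
  lam.-integrable setT (EFin \o f).
Proof.
move=> mf fM f0.
pose B : set E := obox (const_mx (- r)) (const_mx r).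
have mB : measurable B by exact: measurable_obox.
apply: (@le_integrable _ _ _ _ _ measurableT _ (EFin \o (fun x => M * \1_B x))).
- exact: measurableT_comp.
- move=> x _; rewrite /= lee_fin; have [xr|xr] := leP r `|x|.
    by rewrite f0// normr0.
  rewrite indicE mem_set; last exact: normr_lt_obox.
  by rewrite mulr1 (le_trans (fM x))// ler_norm.
- exact: integrable_cst_obox.
Qed.

Lemma compact_supp_bounded (F : E -> R) (K : set E) : continuous F -> compact K ->
  (forall x, ~ K x -> F x = 0) -> exists2 M : R, 0 <= M & forall x, `|F x| <= M.
Proof.
move=> cF cK F0.
have /compact_bounded[M [_ HM]] : compact (F @` K).
  by apply: continuous_compact => //; exact: continuous_subspaceT.
exists (Num.max M 0 + 1); first by rewrite addr_ge0// le_max lexx orbT.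
move=> x; have [Kx|/F0 ->] := pselect (K x).
  by apply: HM; [rewrite ltr_pwDr// le_max lexx|exists x].
by rewrite normr0 addr_ge0// le_max lexx orbT.
Qed.

Lemma is_derive_line (F : E -> R) (x v : E) (t : R) : smooth F ->
  is_derive t 1 (fun s : R => F (s *: v + x)) ('D_v F (t *: v + x)).
Proof.
move=> sF; pose l (s : R) : E := s *: v + x.
have il : is_diff t l ( *:%R^~ v).
  have -> : ( *:%R^~ v) = ( *:%R^~ v) + (0 : R -> E) by rewrite addr0.
  exact: is_diffD.
have dF := smooth_differentiable (l t) sF.
have dl : differentiable l t by case: il.
have dFl : differentiable (F \o l) t by exact: differentiable_comp.
apply: DeriveDef; first exact: diff_derivable.
rewrite [LHS](deriveE _ dFl) diff_comp//= deriveE//.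
have -> : ('d l t : R -> E) = *:%R^~ v by exact: diff_val.
by rewrite scale1r.
Qed.

Lemma smooth_lipschitz (F : E -> R) (v : E) (M : R) : smooth F ->
  (forall x, `|'D_v F x| <= M) ->
  forall x (h : R), 0 < h -> `|F (h *: v + x) - F x| <= M * h.
Proof.
move=> sF FM x h h0.
have ic : {within `[0, h], continuous (fun s : R => F (s *: v + x))}.
  apply: continuous_subspaceT => t.
  apply: differentiable_continuous; apply/derivable1_diffP.
  by case: (is_derive_line x v t sF).
have [c _] := MVT h0 (fun t _ => is_derive_line x v t sF) ic.
rewrite scale0r add0r subr0 => ->; rewrite normrM (gtr0_norm h0).
by rewrite ler_pM2r.
Qed.

Lemma derive_out (F : E -> R) (K : set E) (v x : E) : closed K ->
  (forall y, ~ K y -> F y = 0) -> ~ K x -> 'D_v F x = 0.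
Proof.
move=> cK F0 nKx; rewrite (@near_eq_derive _ _ _ _ (cst 0)) ?derive_cst//.
have : nbhs x (~` K) by apply: open_nbhs_nbhs; split => //; exact: closed_openC.
by apply: filterS => y /F0.
Qed.

Lemma diffquot_cvg (F : E -> R) (x v : E) : smooth F ->
  n.+1%:R * (F (n.+1%:R^-1 *: v + x) - F x) @[n --> \oo] --> 'D_v F x.
Proof.
move=> sF.
have /cvgr_dnbhsP dF := @smooth_derivable R d F x v sF.
rewrite (_ : (fun n => _) = (fun n => n.+1%:R^-1^-1 *:
    ((F \o shift x) (n.+1%:R^-1 *: v) - F x))); last first.
  by apply/funext => n; rewrite invrK.
apply: (dF (fun n => n.+1%:R^-1)); split=> [n|]; last exact: cvg_harmonic.
by rewrite invr_neq0.
Qed.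

(** Translation invariance of the integral, differentiated under the integral
sign: every difference quotient of [F] integrates to 0, and those with step at
most 1 are bounded by the supremum of the derivative and vanish outside one
box. *)
Lemma integral_derive0 (F : E -> R) (K : set E) (v : E) : smooth F -> compact K ->
  (forall x, ~ K x -> F x = 0) -> \int[lam]_x 'D_v F x = 0.
Proof.
move=> sF cK F0.
have clK : closed K by exact: compact_rV_closed.
have cF := smooth_continuous sF.
have cD := smooth_continuous (smooth_derive v sF).
have D0 x : ~ K x -> 'D_v F x = 0 by exact: derive_out.
have [M M0 DM] := compact_supp_bounded cD cK D0.
have [N N0 FN] := compact_supp_bounded cF cK F0.
have [r r0 Kr] := bounded_rV_ex (compact_bounded cK).
have mF := continuous_measurable_rV cF.
have out x (s : R) : `|x| >= r + s -> 0 <= s -> F x = 0.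
  move=> xr s0; apply: F0 => /Kr; apply/negP; rewrite -leNgt (le_trans _ xr)//.
  by rewrite lerDl.
have iF : lam.-integrable setT (EFin \o F).
  apply: (@bounded_box_integrable F N (r + 0)) => // x xr.
  exact: (out x 0).
pose q n x := n.+1%:R * (F (n.+1%:R^-1 *: v + x) - F x).
have mshift (w : E) : measurable_fun setT (fun x => F (w + x)).
  under eq_fun do rewrite addrC.
  exact: (measurableT_comp mF (measurable_shift w)).
have mq n : measurable_fun setT (q n).
  by apply: measurable_funM => //; apply: measurable_funB.
have n0 n : 0 < n.+1%:R^-1 :> R by rewrite invr_gt0.
have n1 n : n.+1%:R^-1 <= 1 :> R by rewrite invf_le1// ler1n.
have hn n : `|n.+1%:R^-1 *: v| <= `|v|.
  by rewrite normrZ gtr0_norm// ler_piMl.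
have qM n x : `|q n x| <= M.
  rewrite /q normrM gtr0_norm// -ler_pdivlMl// mulrC.
  exact: smooth_lipschitz.
have q0 n x : r + `|v| <= `|x| -> q n x = 0.
  move=> xr; rewrite /q (out x `|v|)// (out _ 0) ?subrr ?mulr0//.
  rewrite addr0 -(lerD2r `|v|) (le_trans xr)//.
  rewrite -[x in leLHS](addKr (n.+1%:R^-1 *: v)) (le_trans (ler_normD _ _))//.
  by rewrite normrN addrC lerD.
have iB := integrable_cst_obox M (const_mx (- (r + `|v|))) (const_mx (r + `|v|)).
have mD := continuous_measurable_rV cD.
have [x _|n x _|_ h] := @RintegralDCT _ _ _ lam _ measurableT q _ _ mq mD _ iB.
- exact: diffquot_cvg.
- have [xr|xr] := leP (r + `|v|) `|x|.
    by rewrite q0// normr0 mulr_ge0.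
  by rewrite indicE mem_set ?mulr1//; exact: normr_lt_obox.
apply: (cvg_unique _ h) => //.
rewrite (_ : (fun n => _) = cst 0); first exact: cvg_cst.
apply/funext => n /=.
have iq : lam.-integrable setT (EFin \o q n).
  by apply: (bounded_box_integrable (mq n) (qM n)) => x; exact: q0.
have ish : lam.-integrable setT (EFin \o (fun x => F (n.+1%:R^-1 *: v + x))).
  apply: (@bounded_box_integrable _ N (r + `|v|)) => // x xr.
  apply: (out _ 0) => //.
  rewrite addr0 -(lerD2r `|v|) (le_trans xr)//.
  rewrite -[x in leLHS](addKr (n.+1%:R^-1 *: v)) (le_trans (ler_normD _ _))//.
  by rewrite normrN addrC lerD.
rewrite RintegralZl//; last exact: rintegrableB.
rewrite RintegralB//.
under eq_Rintegral do rewrite addrC.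
by rewrite integral_shift// subrr mulr0.
Qed.

End IntegrateByParts.

(** * The fundamental lemma of the calculus of variations *)

Section FundamentalLemma.
Context (R : realType) (d : nat).
Local Notation E := 'rV[R]_d.
Local Notation lam := (@lebesgue_rV R d).

Lemma cont_compact_integrable (F : E -> R) (K : set E) : continuous F -> compact K ->
  (forall x, ~ K x -> F x = 0) -> lam.-integrable setT (EFin \o F).
Proof.
move=> cF cK F0; have [M M0 FM] := compact_supp_bounded cF cK F0.
have [r r0 Kr] := bounded_rV_ex (compact_bounded cK).
apply: (@bounded_box_integrable _ _ F M r) => //; first exact: continuous_measurable_rV.
by move=> x xr; apply: F0 => /Kr; rewrite ltNge xr.
Qed.

Lemma test_fun_grad (Omega : set E) phi (v : E) : test_fun Omega phi ->
  test_fun Omega ('D_v phi).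
Proof.
move=> [sphi cK KO]; apply: (test_fun_sub (smooth_derive v sphi) cK KO) => x /= H.
apply: contrapT => nK; move: H; rewrite (derive_out v (@closed_closure _ _) _ nK) ?eqxx//.
by move=> y nKy; apply/eqP/negPn/negP => py; apply: nKy; exact: subset_closure.
Qed.

Lemma Rintegral_testl (Omega : set E) (f phi : E -> R) : test_fun Omega phi ->
  \int[lam]_(x in Omega) (phi x * f x) = \int[lam]_x (phi x * f x).
Proof.
move=> tp; rewrite Rintegral_mkcond; apply: eq_Rintegral => x _.
rewrite patchE; case: ifPn => // /negP nO.
by rewrite (test_fun_out tp) ?mul0r// => Ox; apply: nO; rewrite inE.
Qed.

(** The derivative of the product [phi * psi] integrates to 0. *)
Lemma integral_test_by_parts (Omega : set E) (phi psi : E -> R) (v : E) :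
  test_fun Omega phi -> smooth psi ->
  \int[lam]_(x in Omega) (phi x * 'D_v psi x) =
  - \int[lam]_(x in Omega) ('D_v phi x * psi x).
Proof.
move=> tp spsi; have [sphi cK KO] := tp.
rewrite (Rintegral_testl _ tp) (Rintegral_testl _ (test_fun_grad v tp)).
have supp0 x : ~ closure [set x | phi x != 0] x -> phi x = 0.
  by move=> nK; apply/eqP/negPn/negP => px; apply: nK; exact: subset_closure.
have supp1 x : ~ closure [set x | phi x != 0] x -> 'D_v phi x = 0.
  by move=> nK; apply: (derive_out v (@closed_closure _ _) _ nK).
have := @integral_derive0 R d (phi * psi) _ v (smoothM sphi spsi) cK.
have DE : 'D_v (phi * psi) = (fun x => phi x * 'D_v psi x + 'D_v phi x * psi x).
  apply/funext => x; rewrite deriveM; [|exact: smooth_derivable..].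
  by rewrite /GRing.scale/= [psi x * _]mulrC.
rewrite DE RintegralD//.
- move=> H; apply/eqP; rewrite -addr_eq0; apply/eqP; apply: H => x nK.
  by rewrite -[LHS]/(phi x * psi x) supp0// mul0r.
- apply: (cont_compact_integrable _ cK) => [|x nK]; last by rewrite supp0// mul0r.
  exact: smooth_continuous (smoothM sphi (smooth_derive v spsi)).
- apply: (cont_compact_integrable _ cK) => [|x nK]; last by rewrite supp1// mul0r.
  exact: smooth_continuous (smoothM (smooth_derive v sphi) spsi).
Qed.

Lemma obox_cbox (a b : E) : obox a b `<=` cbox a b.
Proof. by move=> x xab i; have /andP[/ltW -> /ltW ->] := xab i. Qed.

Lemma measurable_cbox (a b : E) : measurable (cbox a b).
Proof.
rewrite -[cbox a b]setCK; apply: measurableC; apply: open_measurable_rV.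
by apply: closed_openC; apply: compact_rV_closed; exact: compact_cbox.
Qed.

(** Closed boxes inside [Omega] are compact, so local integrability applies to
them; countably many suffice to argue almost everywhere. *)
Lemma open_box_cover (Omega : set E) : open Omega ->
  exists (a b : nat -> E) (P : set nat),
    (forall n, P n -> cbox (a n) (b n) `<=` Omega) /\
    Omega = \bigcup_(n in P) obox (a n) (b n).
Proof.
move=> oO.
pose q n : 'rV[rat]_d * nat := odflt (0, 0%N) (unpickle n).
pose r n : R := (q n).2.+1%:R^-1.
pose c n : E := map_mx ratr (q n).1.
pose a n := c n - const_mx (r n).
pose b n := c n + const_mx (r n).
exists a, b, [set n | cbox (a n) (b n) `<=` Omega]; split => //.
apply/seteqP; split=> [x Ox|x [n /= nO] /obox_cbox /nO//].
have /nbhs_ballP [e /= e0 xeO] : nbhs x Omega by exact: open_nbhs_nbhs.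
have e20 : 0 < e / 2 by rewrite divr_gt0.
have [k _ /(_ k (leqnn k)) /= ke] := near_infty_natSinv_lt (PosNum e20).
have rk0 : 0 < k.+1%:R^-1 :> R by rewrite invr_gt0.
have ob : open (ball x (k.+1%:R^-1 : R)) by apply: ball_open.
have : ball x k.+1%:R^-1 x by exact: ballxx.
rewrite {1}(open_bigcup_rat_ball ob) => -[[q0 j] /= qx _].
have /qx xq : ball (map_mx ratr q0 : E) j.+1%:R^-1 (map_mx ratr q0 : E).
  by apply: ballxx; rewrite invr_gt0.
have qE : q (pickle (q0, k)) = (q0, k) by rewrite /q pickleK.
exists (pickle (q0, k)); last first.
  rewrite /a /b /c /r qE /= -ball_obox//; exact: ball_sym.
move=> y yab; apply: xeO; split=> // i j'; have -> : i = ord0 by rewrite ord1; exact: val_inj.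
have := yab j'; rewrite /a /b /c /r qE/= !mxE => /andP[h1 h2].
have := xq.2 ord0 j'; rewrite /ball/= !mxE ltr_distlC => /andP[h3 h4].
(* [y] is within [2 / k.+1] of [x], and [k] was chosen for [e / 2] *)
rewrite ltr_distlC; move: (y ord0 j') (x ord0 j') (ratr _ : R)
  (k.+1%:R^-1) h1 h2 h3 h4 ke
  => yy xx qq kk; clear; move=> *; by apply/andP; split; lra.
Qed.

Lemma loc_integrable_measurable (Omega : set E) (u : E -> R) : open Omega ->
  loc_integrable Omega u -> measurable_fun Omega u.
Proof.
move=> oO lu; have [a [b [P [PO ->]]]] := open_box_cover oO.
rewrite bigcup_mkcond; apply/measurable_fun_bigcup => n.
  by case: ifP => // _; exact: measurable_obox.
case: ifPn => [|_]; last exact: measurable_fun_set0.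
rewrite inE => /PO abO.
apply: (measurable_funS (measurable_cbox (a n) (b n))); first exact: obox_cbox.
apply: integrable_measurable; apply: lu abO; exact: compact_cbox.
Qed.

(** The bumps of the box are test functions and tend to its indicator. *)
Lemma integral_obox0 (Omega : set E) (u : E -> R) (a b : E) : open Omega ->
  loc_integrable Omega u ->
  (forall phi, test_fun Omega phi -> \int[lam]_(x in Omega) (u x * phi x) = 0) ->
  cbox a b `<=` Omega -> \int[lam]_(x in obox a b) u x = 0.
Proof.
move=> oO lu u0 abO; have mb := measurable_cbox a b.
have iu := lu _ (@compact_cbox R d a b) abO.
have mu := integrable_measurable iu.
have mbump n : measurable_fun (cbox a b) (box_bump a b n).
  apply: measurable_funTS; apply: continuous_measurable_rV.
  exact/smooth_continuous/smooth_box_bump.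
have mob : measurable (obox a b) by exact: measurable_obox.
have [||x||n x _|_ h] := @RintegralDCT _ _ _ lam _ mb (fun n x => u x * box_bump a b n x)
  (fun x => u x * \1_(obox a b) x) (fun x => `|u x|).
- by move=> n; exact: measurable_funM.
- by apply: measurable_funM => //; apply: measurable_funTS; exact: measurable_indic.
- move=> _; apply: cvgM; first exact: cvg_cst.
  have [xab|nxab] := pselect (obox a b x).
    by rewrite indicE mem_set//; exact: box_bump_cvg.
  rewrite indicE memNset//.
  rewrite (_ : box_bump a b ^~ x = cst 0); first exact: cvg_cst.
  by apply/funext => n; apply/eqP/negPn/negP => /box_bump_supp.
- exact: rintegrable_abs.
- by rewrite normrM ler_piMr// ger0_norm ?box_bump_ge0// box_bump_le1.
have h0 : \int[lam]_(x in cbox a b) (u x * \1_(obox a b) x) = 0.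
  apply: (cvg_unique _ h) => //.
  rewrite (_ : (fun n => _) = cst 0); first exact: cvg_cst.
  apply/funext => n /=; rewrite -[RHS](u0 _ (test_box_bump n abO)).
  rewrite [LHS]Rintegral_mkcond [RHS]Rintegral_mkcond; apply: eq_Rintegral => x _.
  rewrite !patchE; case: ifPn => [|]; rewrite ?inE => xab.
    by rewrite mem_set//; exact: abO.
  case: ifP => // _; rewrite (_ : box_bump a b n x = 0) ?mulr0//.
  apply/eqP/negPn/negP => /box_bump_supp/obox_cbox xab'.
  by move: xab; rewrite mem_set.
rewrite -h0 [LHS]Rintegral_mkcond [RHS]Rintegral_mkcond; apply: eq_Rintegral => x _.
rewrite !patchE indicE; case: ifPn => [|_]; last first.
  by case: ifP => _ //; rewrite mulr0.
rewrite inE => xab.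
by rewrite mem_set ?mulr1//; exact: obox_cbox.
Qed.

(** The integral of [u] vanishes on all open boxes inside the box [obox a b],
hence, by a Dynkin argument, on all its Borel subsets. *)
Lemma loc_integral0_box (Omega : set E) (u : E -> R) (a b : E) : open Omega ->
  loc_integrable Omega u ->
  (forall phi, test_fun Omega phi -> \int[lam]_(x in Omega) (u x * phi x) = 0) ->
  cbox a b `<=` Omega -> {ae lam, forall x, obox a b x -> u x = 0}.
Proof.
move=> oO lu u0 abO.
have iu : lam.-integrable (obox a b) (EFin \o u).
  apply: (integrableS (measurable_cbox a b)); [exact: measurable_obox|exact: obox_cbox|].
  by apply: lu abO; exact: compact_cbox.
have mab := measurable_obox a b.
have P0 A : measurable A -> (\int[lam]_(x in A `&` obox a b) (u x)%:E = 0)%E.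
  rewrite measurable_rV_oboxes.
  have iuA B : measurable B -> lam.-integrable (B `&` obox a b) (EFin \o u).
    move=> mB; apply: (integrableS mab) => //; exact: measurableI.
  have box0 a' b' : cbox a' b' `<=` cbox a b -> (\int[lam]_(x in obox a' b') (u x)%:E = 0)%E.
    move=> s; rewrite -EFin_Rintegral ?(integral_obox0 oO lu u0)//.
    - exact: subset_trans abO.
    - exact: measurable_obox.
    - apply: (integrableS (measurable_cbox a' b')); [exact: measurable_obox|exact: obox_cbox|].
      by apply: lu; [exact: compact_cbox|exact: subset_trans abO].
  apply: (@dynkin_induction _ E (@oboxes R d)
    (fun A => \int[lam]_(x in A `&` obox a b) (u x)%:E = 0)%E).
  - exact: measurable_rV_oboxes.
  - exact: oboxesI.
  - by rewrite setTI box0.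
  - move=> _ [a' [b' ->]].
    rewrite oboxI box0// => x xab i; have := xab i.
    by rewrite !mxE ge_max le_min => /andP[/andP[_ ->] /andP[_ ->]].
  - move=> S mS S0.
    have m1 : measurable (S `&` obox a b) by exact: measurableI.
    have m2 : measurable (~` S `&` obox a b) by apply: measurableI => //; exact: measurableC.
    have SE : (S `&` obox a b) `|` (~` S `&` obox a b) = obox a b.
      by rewrite -setIUl setUv setTI.
    have m3 : measurable_fun ((S `&` obox a b) `|` (~` S `&` obox a b)) (EFin \o u).
      by rewrite SE; case/integrableP: iu.
    have dj : [disjoint S `&` obox a b & ~` S `&` obox a b].
      by apply/disj_setPS => x [[Sx _] [nSx _]].
    have := @integral_setU _ _ _ lam _ _ _ m1 m2 m3 dj.
    by rewrite SE S0 add0e /comp box0.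
  - move=> F mF tF F0.
    rewrite setI_bigcupl integral_bigcup.
    + by apply: eseries0 => i _ _; exact: F0.
    + exact: trivIset_setIr.
    + by move=> k; exact: measurableI.
    + by rewrite -setI_bigcupl; apply: iuA; exact: bigcupT_measurable.
have H A : A `<=` obox a b -> measurable A ->
    (\int[lam]_(x in A) (EFin \o u) x = \int[lam]_(x in A) cst 0 x)%E.
  by move=> Aab mA; rewrite -{1}(setIidl Aab) P0// integral0.
have := @integral_ae_eq _ _ _ lam _ mab (cst 0%E) (EFin \o u) iu (measurable_cst _) H.
by apply: filterS => x h xab; have /= := h xab; case.
Qed.

(** The fundamental lemma of the calculus of variations; [Omega] is a countable union
of boxes to which [loc_integral0_box] applies. *)
Lemma loc_integral_test0 (Omega : set E) (u : E -> R) : open Omega ->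
  loc_integrable Omega u ->
  (forall phi, test_fun Omega phi -> \int[lam]_(x in Omega) (u x * phi x) = 0) ->
  {ae lam, forall x, Omega x -> u x = 0}.
Proof.
move=> oO lu u0; have [a [b [P [PO OE]]]] := open_box_cover oO.
have : {ae lam, forall x, forall n, P n -> obox (a n) (b n) x -> u x = 0}.
  apply/ae_foralln => n; have [Pn|nPn] := pselect (P n); last exact: aeW.
  by apply: filterS (loc_integral0_box oO lu u0 (PO n Pn)) => x h _.
by apply: filterS => x h; rewrite OE => -[n Pn]; exact: h.
Qed.

End FundamentalLemma.

(** * Spaces of functions with integrable powers *)

Section LpSpaces.
Context d (T : measurableType d) (R : realType) (mu : {measure set T -> \bar R}).
Context (D : set T) (mD : measurable D) (Doo : (mu D < +oo)%E).
Implicit Types u v : T -> R.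
Local Notation intg f := (mu.-integrable D (EFin \o f)).

(** Asking for an integrable power, instead of a finite norm, gives direct access
to the theory of the integral. *)
Definition Lp (p : R) u : Prop :=
  measurable_fun D u /\ intg (fun x => `|u x| `^ p).

Lemma powR_le (p a b : R) : 0 <= p -> 0 <= a -> a <= b -> a `^ p <= b `^ p.
Proof.
by move=> p0 a0 ab; apply: ge0_ler_powR; rewrite ?nnegrE// (le_trans a0).
Qed.

(** A crude substitute for Minkowski, by comparing both terms with the larger one. *)
Lemma powR_add_le (p a b : R) : 0 <= p -> 0 <= a -> 0 <= b ->
  (a + b) `^ p <= 2 `^ p * (a `^ p + b `^ p).
Proof.
move=> p0; wlog ab : a b / a <= b.
  move=> H a0 b0; have [ab|/ltW ba] := leP a b; first exact: H.
  by rewrite addrC [X in _ * X]addrC; exact: H.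
move=> a0 b0; apply: (@le_trans _ _ ((2 * b) `^ p)).
  apply: powR_le; rewrite ?addr_ge0//.
  by rewrite mulrDl mul1r lerD2r.
rewrite powRM//; apply: ler_wpM2l; first exact: powR_ge0.
by rewrite lerDr powR_ge0.
Qed.

Lemma measurable_powRabs (p : R) u : measurable_fun D u ->
  measurable_fun D (fun x => `|u x| `^ p).
Proof.
move=> mu'; apply: (measurableT_comp (measurable_powR p)).
exact: measurableT_comp.
Qed.

Section fixed_p.
Context (p : R) (p0 : 0 < p).

Lemma Lp_measurable u : Lp p u -> measurable_fun D u.
Proof. by case. Qed.

Lemma Lp_le u v : measurable_fun D u -> (forall x, D x -> `|u x| <= `|v x|) ->
  Lp p v -> Lp p u.
Proof.
move=> mu' uv [mv iv]; split=> //; apply: le_rintegrable iv => //.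
  exact: measurable_powRabs.
move=> x Dx; rewrite ger0_norm ?powR_ge0//.
by apply: powR_le; [exact: ltW|exact: normr_ge0|exact: uv].
Qed.

Lemma LpD u v : Lp p u -> Lp p v -> Lp p (fun x => u x + v x).
Proof.
move=> [mu' iu] [mv iv]; split; first exact: measurable_funD.
have := rintegrableZ mD (2 `^ p) (rintegrableD mD iu iv).
apply: le_rintegrable => //; first by apply: measurable_powRabs; exact: measurable_funD.
move=> x Dx; rewrite ger0_norm ?powR_ge0//.
apply: le_trans (powR_add_le _ _ _); rewrite ?(ltW p0)//.
by apply: powR_le; [exact: ltW|exact: normr_ge0|exact: ler_normD].
Qed.

Lemma LpZ (c : R) u : Lp p u -> Lp p (fun x => c * u x).
Proof.
move=> [mu' iu]; split; first exact: measurable_funM.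
have := rintegrableZ mD (`|c| `^ p) iu.
by congr (mu.-integrable D (EFin \o _)); apply/funext => x; rewrite normrM powRM.
Qed.

Lemma LpN u : Lp p u -> Lp p (fun x => - u x).
Proof. by move=> /(LpZ (-1)); congr (Lp p _); apply/funext => x; rewrite mulN1r. Qed.

Lemma LpB u v : Lp p u -> Lp p v -> Lp p (fun x => u x - v x).
Proof. by move=> Lu Lv; apply: LpD => //; exact: LpN. Qed.

Lemma Lp0 : Lp p (fun=> 0).
Proof.
split=> //; rewrite (_ : _ \o _ = cst 0%E); first exact: integrable0.
by apply/funext => x; rewrite /= normr0 powR0// gt_eqF.
Qed.

Lemma Lp_sum (I : Type) (s : seq I) (F : I -> T -> R) :
  (forall i, Lp p (F i)) -> Lp p (fun x => \sum_(i <- s) F i x).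
Proof.
move=> Fi; elim: s => [|i s IHs].
  by under [fun x => _]eq_fun do rewrite big_nil; exact: Lp0.
by under [fun x => _]eq_fun do rewrite big_cons; exact: LpD.
Qed.

Lemma rintegrable_cst (c : R) : intg (fun=> c).
Proof.
apply: measurable_bounded_integrable => //.
by exists `|c|; split; [exact: num_real|move=> M cM x _ /=; exact: ltW].
Qed.

Lemma Lp_bounded u (M : R) : measurable_fun D u -> (forall x, D x -> `|u x| <= M) -> Lp p u.
Proof.
move=> mu' uM; split=> //; apply: le_rintegrable (rintegrable_cst (M `^ p)) => //.
  exact: measurable_powRabs.
move=> x Dx; rewrite ger0_norm ?powR_ge0//.
by apply: powR_le; [exact: ltW|exact: normr_ge0|exact: uM].
Qed.

Lemma Lp_abs u : Lp p u -> Lp p (fun x => `|u x|).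
Proof.
move=> Lu; have mu' := Lp_measurable Lu.
apply: (Lp_le _ _ Lu) => [|x _]; last by rewrite normr_id.
exact: measurableT_comp.
Qed.

Lemma Lp_ae_eq u v : measurable_fun D v -> {ae mu, forall x, D x -> u x = v x} ->
  Lp p u -> Lp p v.
Proof.
move=> mv uv [mu' iu]; split=> //; apply: ae_eq_rintegrable iu => //.
  exact: measurable_powRabs.
by apply: filterS uv => x h Dx; rewrite h.
Qed.

(** The [p]-th power of the distance.  Only convergence to 0 matters, so the root
is left out. *)
Definition Lpdist u v : R := \int[mu]_(x in D) (`|u x - v x| `^ p).

Lemma Lpdist_ge0 u v : 0 <= Lpdist u v.
Proof. by apply: Rintegral_ge0 => x _; exact: powR_ge0. Qed.

Lemma LpdistD u u' v v' : Lp p u -> Lp p u' -> Lp p v -> Lp p v' ->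
  Lpdist (fun x => u x + v x) (fun x => u' x + v' x) <=
  2 `^ p * (Lpdist u u' + Lpdist v v').
Proof.
move=> Lu Lu' Lv Lv'.
have [_ i1] := LpB Lu Lu'; have [_ i2] := LpB Lv Lv'.
have [_ i3] := LpB (LpD Lu Lv) (LpD Lu' Lv').
rewrite /Lpdist -RintegralD// -RintegralZl//; last exact: rintegrableD.
apply: le_Rintegral => //; first by apply: rintegrableZ => //; exact: rintegrableD.
move=> x Dx; apply: le_trans (powR_add_le _ _ _); rewrite ?(ltW p0)//.
apply: powR_le; [exact: ltW|exact: normr_ge0|].
by rewrite opprD addrACA ler_normD.
Qed.

Lemma LpdistZ c u u' : Lp p u -> Lp p u' ->
  Lpdist (fun x => c * u x) (fun x => c * u' x) = `|c| `^ p * Lpdist u u'.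
Proof.
move=> Lu Lu'; have [_ i1] := LpB Lu Lu'.
rewrite /Lpdist -RintegralZl//; apply: eq_Rintegral => x _.
by rewrite -mulrBr normrM powRM.
Qed.

Definition Lpcvg (un : nat -> T -> R) u := Lpdist u (un n) @[n --> \oo] --> 0.

Lemma LpcvgD un u vn v : Lp p u -> Lp p v ->
  (forall n, Lp p (un n)) -> (forall n, Lp p (vn n)) ->
  Lpcvg un u -> Lpcvg vn v ->
  Lpcvg (fun n x => un n x + vn n x) (fun x => u x + v x).
Proof.
move=> Lu Lv Lun Lvn cu cv.
have h : 2 `^ p * (Lpdist u (un n) + Lpdist v (vn n)) @[n --> \oo] --> 2 `^ p * (0 + 0 : R).
  by apply: cvgMr; exact: cvgD.
rewrite addr0 mulr0 in h.
apply: (squeeze_cvgr _ (cvg_cst 0) h); apply: nearW => n.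
by rewrite Lpdist_ge0/= LpdistD.
Qed.

Lemma LpcvgZ c un u : Lp p u -> (forall n, Lp p (un n)) ->
  Lpcvg un u -> Lpcvg (fun n x => c * un n x) (fun x => c * u x).
Proof.
move=> Lu Lun cu; have h : `|c| `^ p * Lpdist u (un n) @[n --> \oo] --> `|c| `^ p * (0 : R).
  exact: cvgMr.
rewrite mulr0 in h; apply: cvg_trans h; apply: near_eq_cvg; apply: nearW => n.
by rewrite LpdistZ.
Qed.

Lemma Lpcvg_cst u : Lpcvg (fun=> u) u.
Proof.
rewrite /Lpcvg (_ : (fun n => _) = cst 0); first exact: cvg_cst.
apply/funext => n /=; rewrite /Lpdist; under eq_Rintegral do rewrite subrr normr0 powR0 ?gt_eqF//.
by rewrite /Rintegral integral0.
Qed.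

End fixed_p.

Lemma Lp_intg p u : 1 <= p -> Lp p u -> intg u.
Proof.
move=> p1 [mu' iu].
apply: le_rintegrable (rintegrableD mD (rintegrable_cst 1) iu) => // x Dx.
have [h|/ltW h] := leP `|u x| 1; first by rewrite (le_trans h)// lerDl powR_ge0.
by rewrite (@le_trans _ _ (`|u x| `^ p))// ?le1r_powR// lerDr.
Qed.

(** Young instead of Holder: only integrability is claimed. *)
Lemma Lp_mul p q u v : 0 < p -> 0 < q -> p^-1 + q^-1 = 1 -> Lp p u -> Lp q v ->
  intg (fun x => u x * v x).
Proof.
move=> p0 q0 pq [mu' iu] [mv iv].
apply: le_rintegrable (rintegrableD mD (rintegrableZ mD p^-1 iu) (rintegrableZ mD q^-1 iv)) => //.
  exact: measurable_funM.
move=> x Dx; rewrite normrM; apply: le_trans (conjugate_powR _ _ _ _ pq) _ => //.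
by rewrite mulrC [X in _ + X]mulrC.
Qed.

End LpSpaces.

(** * Semi-inner products and the completeness of square integrable functions *)

Section SemiInner.
Context (R : realType) (V : lmodType R).

(** On representatives, the scalar product of square integrable functions and the
Dirichlet form vanish on more than the zero function; hence no definiteness. *)
Definition semi_inner (S : set V) (b : V -> V -> R) : Prop :=
  [/\ forall a u v, S u -> S v -> S (a *: u + v),
      forall u v, S u -> S v -> b u v = b v u,
      forall a u v w, S u -> S v -> S w -> b (a *: u + v) w = a * b u w + b v w &
      forall u, S u -> 0 <= b u u].

Context (S : set V) (b : V -> V -> R) (Sb : semi_inner S b).
Local Notation N u := (Num.sqrt (b u u)).

Lemma semi_inner_expand a u v : S u -> S v ->
  b (a *: u + v) (a *: u + v) = a ^+ 2 * b u u + 2 * a * b u v + b v v.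
Proof.
case: Sb => clos sym lin _ Su Sv; have Sw := clos a u v Su Sv.
by rewrite lin// (sym u)// (sym v)// !lin// (sym v u)//; ring.
Qed.

(** The discriminant argument: [b (a *: u + v) (a *: u + v)] is nonnegative for
every [a]. *)
Lemma semi_inner_sqr_le u v : S u -> S v -> (b u v) ^+ 2 <= b u u * b v v.
Proof.
case: Sb => clos sym lin ge0 Su Sv.
have H a : 0 <= a ^+ 2 * b u u + 2 * a * b u v + b v v.
  by rewrite -semi_inner_expand//; apply: ge0; exact: clos.
have [b0|bn0] := eqVneq (b u u) 0.
  have [->|uvn0] := eqVneq (b u v) 0; first by rewrite expr0n/= mulr_ge0// ge0.
  (* the quadratic polynomial degenerates to an affine one with nonzero slope,
     which is negative somewhere *)
  have := H (- (b v v + 1) / (2 * b u v)).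
  rewrite b0 mulr0 add0r (_ : 2 * _ * _ = - (b v v + 1)); first by lra.
  by field; rewrite uvn0.
have buu : 0 < b u u by rewrite lt_neqAle eq_sym bn0 ge0.
(* the minimizer *)
have := H (- b u v / b u u).
have -> : (- b u v / b u u) ^+ 2 * b u u + 2 * (- b u v / b u u) * b u v + b v v =
  b v v - (b u v) ^+ 2 / b u u by field; rewrite gt_eqF.
by rewrite subr_ge0 ler_pdivrMr// mulrC.
Qed.

Lemma semi_inner_CS u v : S u -> S v -> `|b u v| <= N u * N v.
Proof.
move=> Su Sv; have ge0 : forall u, S u -> 0 <= b u u by case: Sb.
rewrite -sqrtrM ?ge0// -sqrtr_sqr ler_wsqrtr//; exact: semi_inner_sqr_le.
Qed.

Lemma semi_inner_triangle u v : S u -> S v -> N (u + v) <= N u + N v.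
Proof.
move=> Su Sv; have ge0 : forall u, S u -> 0 <= b u u by case: Sb.
rewrite -[leRHS]ger0_norm ?addr_ge0 ?sqrtr_ge0// -sqrtr_sqr ler_wsqrtr//.
have := semi_inner_expand 1 Su Sv; rewrite scale1r => ->.
have := le_trans (ler_norm _) (semi_inner_CS Su Sv).
rewrite sqrrD !sqr_sqrtr ?ge0// => H; lra.
Qed.

Lemma semi_innerZ a u : S u -> N (a *: u) = `|a| * N u.
Proof.
move=> Su; have [clos sym lin ge0] := Sb.
have S0 : S 0 by have := clos (-1) u u Su Su; rewrite scaleN1r addNr.
have b0 w : S w -> b 0 w = 0.
  by move=> Sw; have := lin 1 0 0 w S0 S0 Sw; rewrite scale1r addr0; lra.
have := semi_inner_expand a Su S0; rewrite addr0 => ->.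
by rewrite (sym u 0)// !b0// mulr0 !addr0 sqrtrM ?sqr_ge0// sqrtr_sqr.
Qed.

Lemma semi_inner_triangleB u v : S u -> S v -> N (u - v) <= N u + N v.
Proof.
move=> Su Sv; have [clos _ _ _] := Sb.
have S0 : S 0 by have := clos (-1) u u Su Su; rewrite scaleN1r addNr.
have SN : S ((-1) *: v) by have := clos (-1) v 0 Sv S0; rewrite addr0.
by rewrite -scaleN1r (le_trans (semi_inner_triangle Su SN))// semi_innerZ// normrN1 mul1r.
Qed.

End SemiInner.

Section L2.
Context d (T : measurableType d) (R : realType) (mu : {measure set T -> \bar R}).
Context (D : set T) (mD : measurable D) (Doo : (mu D < +oo)%E).
Implicit Types u v : T -> R.
Local Notation intg f := (mu.-integrable D (EFin \o f)).
Local Notation Lp := (Lp mu D).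

Definition L2dot u v : R := \int[mu]_(x in D) (u x * v x).
Definition L2norm u : R := Num.sqrt (L2dot u u).

Lemma half_conj : (2:R)^-1 + 2^-1 = 1.
Proof. by field. Qed.

Lemma L2_mul u v : Lp 2 u -> Lp 2 v -> intg (fun x => u x * v x).
Proof. by apply: (Lp_mul mD _ _ half_conj). Qed.

Lemma L2_semi_inner : semi_inner [set u : T -> R | Lp 2 u] L2dot.
Proof.
split=> [a u v Lu Lv|u v Lu Lv|a u v w Lu Lv Lw|u Lu].
- exact: (LpD mD (ltr0n R 2) (LpZ mD a Lu) Lv).
- by apply: eq_Rintegral => x _; exact: mulrC.
- have i1 : intg (fun x => u x * w x) by exact: L2_mul.
  have i2 : intg (fun x => v x * w x) by exact: L2_mul.
  rewrite /L2dot -(RintegralZl a mD i1) -(RintegralD mD (rintegrableZ mD a i1) i2).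
  by apply: eq_Rintegral => x _; rewrite mulrA -mulrDl.
- by apply: Rintegral_ge0 => x _; rewrite -expr2 sqr_ge0.
Qed.

Lemma Lpdist2E u v : Lpdist mu D 2 u v = L2dot (u - v) (u - v).
Proof.
apply: eq_Rintegral => x _; rewrite powR_mulrn// real_normK ?num_real//.
Qed.

Lemma L2norm_ge0 u : 0 <= L2norm u. Proof. exact: sqrtr_ge0. Qed.

Lemma L2dot_ge0 u : 0 <= L2dot u u.
Proof. by apply: Rintegral_ge0 => x _; rewrite -expr2 sqr_ge0. Qed.

Lemma L2norm_sqr u : L2norm u ^+ 2 = L2dot u u.
Proof. by rewrite sqr_sqrtr// L2dot_ge0. Qed.

Lemma L2_CS u v : Lp 2 u -> Lp 2 v -> `|L2dot u v| <= L2norm u * L2norm v.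
Proof. exact: (semi_inner_CS L2_semi_inner). Qed.

Lemma L2norm_abs u : L2norm (fun x => `|u x|) = L2norm u.
Proof.
congr Num.sqrt; apply: eq_Rintegral => x _.
by rewrite -expr2 real_normK ?num_real// expr2.
Qed.

(** The sum of the [`|w j.+1 - w j|] has a finite integral, hence is finite almost
everywhere, and there the series telescoping to [w] converges absolutely. *)
Lemma L2_complete_subseq (w : nat -> T -> R) (C : R) : (forall j, Lp 2 (w j)) ->
  (forall j, L2norm (w j.+1 - w j) <= C / 2 ^+ j.+1) ->
  exists u, measurable_fun D u /\ {ae mu, forall x, D x -> w j x @[j --> \oo] --> u x}.
Proof.
move=> Lw wC.
pose v j x := `|w j.+1 x - w j x|.
have v0 j x : (0 <= (v j x)%:E)%E by rewrite lee_fin normr_ge0.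
have Lv j : Lp 2 (v j) by apply: Lp_abs => //; exact: LpB.
have L1 : Lp 2 (fun=> 1).
  by apply: (@Lp_bounded _ _ _ _ _ mD Doo 2 _ _ 1) => // x _; rewrite normr1.
have C0 : 0 <= C.
  by have := le_trans (L2norm_ge0 _) (wC 0%N); rewrite pmulr_lge0// invr_gt0 exprn_gt0.
have iv j : intg (v j) by apply: Lp_intg (Lv j) => //; rewrite ler1n.
have iv_le j : \int[mu]_(x in D) v j x <= L2norm (fun=> 1) * C / 2 ^+ j.+1.
  have -> : \int[mu]_(x in D) v j x = L2dot (fun=> 1) (v j).
    by apply: eq_Rintegral => x _; rewrite mul1r.
  apply: le_trans (ler_norm _) _; apply: le_trans (L2_CS L1 (Lv j)) _.
  by rewrite L2norm_abs -mulrA ler_wpM2l ?L2norm_ge0//; exact: wC.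
pose S x := (\sum_(j <oo) (v j x)%:E)%E.
have mv j : measurable_fun D (EFin \o v j) by apply/measurable_EFinP; case: (Lv j).
have mS : measurable_fun D S
  by apply: (@ge0_emeasurable_sum _ _ _ D (fun j x => (v j x)%:E) xpredT)
  => [j x _ _|j _]; [exact: v0|exact: mv].
have iS : mu.-integrable D S.
  apply/integrableP; split=> //.
  rewrite (eq_integral S); last first.
    by move=> x _; rewrite gee0_abs//; apply: nneseries_ge0 => *; exact: v0.
  rewrite integral_nneseries//.
  pose K := L2norm (fun=> 1) * C.
  apply: (@le_lt_trans _ _ (\sum_(j <oo) (K / (2 ^ (j + 1))%:R)%:E)%E).
    apply: lee_nneseries => [j *|j *]; first by apply: integral_ge0 => x _; exact: v0.
    by rewrite -EFin_Rintegral// lee_fin natrX addn1 iv_le.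
  by rewrite (cvg_lim _ (@cvg_geometric_eseries_half R K 0))// ltry.
(* the upper limit is measurable, whether or not the sequence converges *)
exists (fun x => fine (limn_esup (fun j => (w j x)%:E))); split.
  apply: measurableT_comp => //.
  by apply: measurable_fun_limn_esup => j; apply/measurable_EFinP; case: (Lw j).
have := integrable_ae mD iS; apply: filterS => x Sx Dx.
have {}Sx := Sx Dx.
have cw : cvgn (fun j => w j x).
  have cv : cvgn (series (v^~ x)).
    apply: nondecreasing_is_cvgn.
      by apply/nondecreasing_seqP => n; rewrite /series/= big_nat_recr//= lerDl normr_ge0.
    exists (fine (S x)) => _ [n _ <-]; rewrite -lee_fin fineK//.
    rewrite /series/= -sumEFin; apply: nneseries_lim_ge => j _ _.
    exact: v0.
  have ct : cvgn (series (fun j => w j.+1 x - w j x)).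
    exact: (@normed_cvg _ (R^o : completeNormedModType R)).
  have -> : (fun j => w j x) = (fun j => w 0%N x + series (fun j => w j.+1 x - w j x) j).
    apply/funext => n; rewrite /series/=.
    by rewrite telescope_sumr// subrKC.
  by apply: is_cvgD => //; exact: is_cvg_cst.
have H : (w j x)%:E @[j --> \oo] --> (limn (fun j => w j x))%:E.
  by apply: cvg_EFin; [exact: nearW|].
rewrite is_cvg_limn_esupE; last by apply/cvg_ex; eexists; exact: H.
by rewrite (cvg_lim _ H).
Qed.

(** Fatou's lemma bounds the distance from the almost everywhere limit of a fast
subsequence to [un n].  The Cauchy hypothesis has the form in which minimizing
sequences provide it. *)
Lemma L2_complete (un : nat -> T -> R) (e : nat -> R) : (forall n, Lp 2 (un n)) ->
  (forall n m, L2norm (un n - un m) <= e n + e m) -> e n @[n --> \oo] --> (0 : R) ->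
  exists u, Lp 2 u /\ L2norm (u - un n) @[n --> \oo] --> 0.
Proof.
move=> Lun une e0.
have kex j : {k | e k <= 2^-1 ^+ j}.
  apply: cid; move/cvgrPdist_le : e0 => /(_ (2^-1 ^+ j)).
  have h : 0 < 2^-1 ^+ j :> R by rewrite exprn_gt0.
  move=> /(_ h)[K _ /(_ K (leqnn K))]; rewrite /= sub0r normrN => H.
  by exists K; exact: le_trans (ler_norm _) H.
pose w j := un (sval (kex j)).
have eh j : e (sval (kex j)) <= 2^-1 ^+ j by exact: (svalP (kex j)).
(* consecutive terms are within 2^-j + 2^-(j+1) = 3 / 2^(j+1) of each other *)
have [||u [mu' wu]] := @L2_complete_subseq w 4.
- by move=> j; exact: Lun.
- move=> j; apply: le_trans (une _ _) _.
  apply: le_trans (lerD (eh _) (eh _)) _.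
  rewrite exprS -exprVn exprS; have : 0 <= 2^-1 ^+ j :> R by rewrite exprn_ge0.
  lra.
have bound n (r : R) : e n < r ->
    (\int[mu]_(x in D) (`|u x - un n x| ^+ 2)%:E <= (r ^+ 2)%:E)%E.
  move=> enr.
  have [J HJ] : exists J, forall j, (J <= j)%N -> 2^-1 ^+ j <= r - e n :> R.
    have : (2^-1 : R) ^+ j @[j --> \oo] --> (0 : R).
      by apply: cvg_expr; rewrite gtr0_norm// invf_lt1// ltr1n.
    move/cvgrPdist_le => /(_ (r - e n)); rewrite subr_gt0 => /(_ enr)[J _ HJ].
    exists J => j Jj; have := HJ j Jj; rewrite /= sub0r normrN.
    exact: le_trans (ler_norm _).
  pose f j x := (`|w (j + J)%N x - un n x| ^+ 2)%:E.
  have mf j : measurable_fun D (f j).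
    apply/measurable_EFinP; apply: measurable_funX; apply: measurableT_comp => //.
    by apply: measurable_funB; [case: (Lun (sval (kex (j + J)%N)))|case: (Lun n)].
  have mu2 : measurable_fun D (fun x => (`|u x - un n x| ^+ 2)%:E).
    apply/measurable_EFinP; apply: measurable_funX; apply: measurableT_comp => //.
    by apply: measurable_funB => //; case: (Lun n).
  have -> : (\int[mu]_(x in D) (`|u x - un n x| ^+ 2)%:E =
             \int[mu]_(x in D) limn_einf (f^~ x))%E.
    apply: ae_eq_integral => //.
      apply: measurableT_comp => //.
      by apply: measurable_fun_limn_esup => j; exact: measurableT_comp.
    apply: filterS wu => x wu Dx; have {}wu := wu Dx.
    have H : f j x @[j --> \oo] --> (`|u x - un n x| ^+ 2)%:E.
      apply: cvg_EFin; first exact: nearW.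
      have h : `|w (j + J)%N x - un n x| @[j --> \oo] --> `|u x - un n x|.
        apply: cvg_norm; apply: cvgB; last exact: cvg_cst.
        by move: wu; rewrite -(cvg_shiftn J).
      exact: (cvgM h h).
    by rewrite is_cvg_limn_einfE ?(cvg_lim _ H)//; apply/cvg_ex; eexists; exact: H.
  have f0 j x : D x -> (0 <= f j x)%E by move=> _; rewrite lee_fin exprn_ge0.
  have := fatou mu mD mf f0; move=> /le_trans; apply.
  have fle j : (\int[mu]_(x in D) f j x <= (r ^+ 2)%:E)%E.
    have Lwu : Lp 2 (w (j + J)%N - un n) by apply: LpB => //; exact: Lun.
    have H x : `|w (j + J)%N x - un n x| ^+ 2 = (w (j + J)%N - un n) x * (w (j + J)%N - un n) x.
      by rewrite real_normK ?num_real// expr2.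
    under eq_integral do rewrite /f H.
    rewrite -EFin_Rintegral//; last exact: L2_mul.
    rewrite -[X in X%:E]/(L2dot _ _) -L2norm_sqr lee_fin.
    have h1 : L2norm (w (j + J)%N - un n) <= r.
      apply: le_trans (une _ _) _; have := HJ (j + J)%N (leq_addl _ _).
      by have := eh (j + J)%N; lra.
    by rewrite lerXn2r ?nnegrE ?L2norm_ge0// (le_trans _ h1)// L2norm_ge0.
  rewrite limn_einf_lim; apply: lime_le; first exact: is_cvg_einfs.
  apply: nearW => n'; apply: le_trans (fle n'); apply: ereal_inf_lbound.
  by exists n' => //=; exists n' => //=.
have Lu : Lp 2 u.
  suff : Lp 2 (fun x => (u x - un 0%N x) + un 0%N x).
    by congr (Lp 2 _); apply/funext => x; rewrite subrK.
  apply: LpD => //.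
  have mu0 : measurable_fun D (fun x => u x - un 0%N x).
    by apply: measurable_funB => //; case: (Lun 0%N).
  split=> //; apply/integrableP; split.
    by apply/measurable_EFinP; exact: measurable_powRabs.
  apply: le_lt_trans (ltry ((e 0%N + 1) ^+ 2)).
  have e01 : e 0%N < e 0%N + 1 by rewrite ltrDl.
  apply: le_trans (bound 0%N _ e01); rewrite le_eqVlt; apply/orP; left; apply/eqP.
  by apply: eq_integral => x _; rewrite /= ger0_norm ?powR_ge0// powR_mulrn.
exists u; split=> //.
apply/cvgrPdist_le => r r0.
move/cvgrPdist_lt : e0 => /(_ r r0); apply: filterS => n.
rewrite !sub0r !normrN => en.
have {}en : e n < r by exact: le_lt_trans (ler_norm _) en.
rewrite ger0_norm ?L2norm_ge0//.
have Luu : Lp 2 (u - un n) by apply: LpB.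
rewrite -(@ler_pXn2r _ 2)// ?nnegrE ?L2norm_ge0//; last exact: ltW.
rewrite L2norm_sqr -lee_fin EFin_Rintegral//; last exact: L2_mul.
apply: le_trans (bound n r en); rewrite le_eqVlt; apply/orP; left; apply/eqP.
by apply: eq_integral => x _; rewrite real_normK ?num_real// expr2.
Qed.

End L2.

(** * The Euclidean norm and vector fields *)

Section Euclid.
Context (R : realType) (d : nat).
Local Notation E := 'rV[R]_d.
Implicit Types x y z : E.

Lemma dotvC x y : dotv x y = dotv y x.
Proof. by apply: eq_bigr => i _; rewrite mulrC. Qed.

Lemma dotv_lin a x y z : dotv (a *: x + y) z = a * dotv x z + dotv y z.
Proof.
by rewrite /dotv mulr_sumr -big_split; apply: eq_bigr => i _; rewrite !mxE mulrDl mulrA.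
Qed.

Lemma dotv_ge0 x : 0 <= dotv x x.
Proof. by apply: sumr_ge0 => i _; rewrite -expr2 sqr_ge0. Qed.

Lemma dotv_semi_inner : semi_inner [set: E] (@dotv R d).
Proof.
split=> // [u v _ _|a u v w _ _ _|u _]; [exact: dotvC|exact: dotv_lin|exact: dotv_ge0].
Qed.

Lemma enorm_ge0 x : 0 <= enorm x. Proof. exact: sqrtr_ge0. Qed.

Lemma ler_enormD x y : enorm (x + y) <= enorm x + enorm y.
Proof. exact: (semi_inner_triangle dotv_semi_inner). Qed.

Lemma enormZ a x : enorm (a *: x) = `|a| * enorm x.
Proof. exact: (semi_innerZ dotv_semi_inner). Qed.

Lemma enorm0 : enorm (0 : E) = 0.
Proof. by rewrite -(scale0r (0 : E)) enormZ normr0 mul0r. Qed.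

Lemma enorm_delta i : enorm (delta_mx ord0 i : E) = 1.
Proof.
rewrite /enorm /dotv (bigD1 i)//= big1 ?addr0; last first.
  by move=> j ji; rewrite mxE (negbTE ji) mul0r.
by rewrite mxE !eqxx mulr1 sqrtr1.
Qed.

Lemma coord_le_enorm x i : `|x ord0 i| <= enorm x.
Proof.
rewrite -sqrtr_sqr ler_wsqrtr// /dotv (bigD1 i)//= -expr2 lerDl.
by apply: sumr_ge0 => j _; rewrite -expr2 sqr_ge0.
Qed.

Lemma enorm_le_sum x : enorm x <= \sum_(i < d) `|x ord0 i|.
Proof.
have s0 : 0 <= \sum_(i < d) `|x ord0 i| by apply: sumr_ge0.
rewrite -(ger0_norm s0) -sqrtr_sqr ler_wsqrtr// expr2 mulr_suml.
apply: ler_sum => i _; rewrite (bigD1 i)//= mulrDr -normrM ger0_norm -?expr2 ?sqr_ge0//.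
by rewrite lerDl mulr_ge0// sumr_ge0.
Qed.

(** Each term is at most the [p]-th root of the sum of the powers. *)
Lemma powR_sum_le (p : R) (a : 'I_d -> R) : 0 < p -> (forall i, 0 <= a i) ->
  (\sum_(i < d) a i) `^ p <= d%:R `^ p * \sum_(i < d) a i `^ p.
Proof.
move=> p0 a0; set s := \sum_(i < d) a i `^ p.
have s0 : 0 <= s by apply: sumr_ge0 => i _; exact: powR_ge0.
have am i : a i <= s `^ p^-1.
  rewrite -[leLHS]powRr1// -(mulfV (lt0r_neq0 p0)) powRrM; apply: powR_le.
  - by rewrite invr_ge0 ltW.
  - exact: powR_ge0.
  - by rewrite /s (bigD1 i)//= lerDl; apply: sumr_ge0 => j _; exact: powR_ge0.
have -> : s = (s `^ p^-1) `^ p by rewrite -powRrM mulVf ?lt0r_neq0// powRr1.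
rewrite -powRM ?powR_ge0//; apply: powR_le; [exact: ltW|exact: sumr_ge0|].
have -> : d%:R * s `^ p^-1 = \sum_(i < d) s `^ p^-1.
  by rewrite sumr_const card_ord mulr_natl.
by apply: ler_sum => i _; exact: am.
Qed.

End Euclid.

Section LpBridge.
Context (R : realType) (d : nat).
Local Notation E := 'rV[R]_d.
Local Notation lam := (@lebesgue_rV R d).
Context (Omega : set E) (mO : measurable Omega).
Local Notation Lp := (Lp lam Omega).

Lemma integral_powR_patch p (u : E -> R) : 0 < p ->
  (\int[lam]_x (`|(EFin \o (u \_ Omega)) x| `^ p) = \int[lam]_(x in Omega) (`|u x| `^ p)%:E)%E.
Proof.
move=> p0; rewrite [RHS]integral_mkcond; apply: eq_integral => x _.
rewrite /= !patchE; case: ifP => _ //.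
rewrite -[point in LHS]/(0 : R) -[point]/(0 : \bar R) normr0.
by rewrite powR0// gt_eqF.
Qed.

Lemma memLpP p (u : E -> R) : 0 < p -> memLp Omega p u <-> Lp p u.
Proof.
move=> p0; rewrite /memLp /Lp.
have mE : measurable_fun setT (u \_ Omega) <-> measurable_fun Omega u.
  by symmetry; exact: measurable_restrictT.
have nE : measurable_fun Omega u ->
   finite_norm lam p%:E (u \_ Omega) <-> lam.-integrable Omega (EFin \o (fun x => `|u x| `^ p)).
  move=> mu; rewrite /finite_norm unlock /= integral_powR_patch//.
  have E0 : (\int[lam]_(x in Omega) (`|u x| `^ p)%:E =
             \int[lam]_(x in Omega) `|(EFin \o (fun x => `|u x| `^ p)%R) x|)%E.
    by apply: eq_integral => x _; rewrite gee0_abs// lee_fin powR_ge0.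
  split=> [H|/integrableP[_ H]].
    apply/integrableP; split; first by apply/measurable_EFinP; exact: measurable_powRabs.
    by rewrite -E0; apply: lty_poweRy H; rewrite invr_neq0// gt_eqF.
  by apply: poweR_lty; rewrite E0.
split.
  rewrite inE => /andP[]; rewrite !inE /= => /mE mu fu; split=> //.
  exact/nE.
move=> [mu iu]; rewrite inE; apply/andP; rewrite !inE /=; split; first exact/mE.
exact/nE.
Qed.

Lemma normLpE p (u : E -> R) : 0 < p -> Lp p u ->
  normLp Omega p u = ((\int[lam]_(x in Omega) (`|u x| `^ p)) `^ p^-1)%:E.
Proof.
move=> p0 [mu iu]; rewrite /normLp unlock integral_powR_patch//.
by rewrite -poweR_EFin EFin_Rintegral.
Qed.

Lemma cvg0_powR (a : nat -> R) (r : R) : 0 < r -> (forall n, 0 <= a n) ->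
  a n @[n --> \oo] --> (0 : R) -> a n `^ r @[n --> \oo] --> (0 : R).
Proof.
move=> r0 a0 /cvgrPdist_lt ca; apply/cvgrPdist_le => e e0.
have e1 : 0 < e `^ r^-1 by exact: powR_gt0.
move: (ca _ e1); apply: filterS => n; rewrite !sub0r !normrN => h.
rewrite ger0_norm ?powR_ge0//; have -> : e = (e `^ r^-1) `^ r.
  by rewrite -powRrM mulVf ?gt_eqF// powRr1// ltW.
apply: powR_le; [exact: ltW|exact: a0|].
by rewrite ltW// (le_lt_trans _ h)// ler_norm.
Qed.

Lemma normLp_cvg0 p (u : nat -> E -> R) : 0 < p -> (forall n, Lp p (u n)) ->
  normLp Omega p (u n) @[n --> \oo] --> 0%E <->
  \int[lam]_(x in Omega) (`|u n x| `^ p) @[n --> \oo] --> 0.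
Proof.
move=> p0 Lu.
set a := fun n => \int[lam]_(x in Omega) (`|u n x| `^ p).
have a0 n : 0 <= a n by apply: Rintegral_ge0 => x _; exact: powR_ge0.
rewrite (_ : (fun n => normLp Omega p (u n)) = EFin \o (fun n => a n `^ p^-1)); last first.
  by apply/funext => n; rewrite normLpE.
split=> [/fine_cvg/= H|H].
  have := cvg0_powR p0 (fun n => powR_ge0 (a n) p^-1) H.
  apply: cvg_trans; apply: near_eq_cvg; apply: nearW => n.
  by rewrite -powRrM mulVf ?gt_eqF// powRr1.
by apply: cvg_EFin; [exact: nearW|]; apply: cvg0_powR => //; rewrite invr_gt0.
Qed.

Lemma Lp_enorm p (g : E -> E) : 0 < p -> (forall i, Lp p (fun x => g x ord0 i)) ->
  Lp p (fun x => enorm (g x)).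
Proof.
move=> p0 Lg.
have Ls : Lp p (fun x => \sum_(i < d) `|g x ord0 i|).
  by apply: Lp_sum => // i; exact: Lp_abs.
apply: (Lp_le mO p0 _ _ Ls).
  apply: (measurableT_comp (continuous_measurable_fun (@sqrt_continuous R))).
  by apply: measurable_sum => i; apply: measurable_funM; case: (Lg i).
move=> x _; rewrite ger0_norm ?enorm_ge0// ger0_norm ?sumr_ge0//.
exact: enorm_le_sum.
Qed.

End LpBridge.

(** * Weak gradients and Sobolev spaces *)

Lemma compact_measurable_rV (R : realType) (d : nat) (K : set 'rV[R]_d) :
  compact K -> measurable K.
Proof.
move=> /compact_rV_closed cK; rewrite -[K]setCK; apply: measurableC.
by apply: open_measurable_rV; exact: closed_openC.
Qed.

Section Sobolev.
Context (R : realType) (d : nat).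
Local Notation E := 'rV[R]_d.
Local Notation lam := (@lebesgue_rV R d).
Context (Omega : set E) (oO : open Omega) (bO : bounded_set Omega).
Local Notation Lp := (Lp lam Omega).
Local Notation Lpcvg := (Lpcvg lam Omega).
Local Notation test := (test_fun Omega).

Let mO : measurable Omega. Proof. exact: open_measurable_rV. Qed.
Let Ooo : (lam Omega < +oo)%E. Proof. exact: bounded_rV_finite. Qed.

Definition LpV p (g : E -> E) := forall i : 'I_d, Lp p (fun x => g x ord0 i).

Lemma test_smooth phi : test phi -> smooth phi.
Proof. by case. Qed.

Lemma test_measurable (D : set E) phi : test phi -> measurable_fun D phi.
Proof.
move=> tp; apply: measurable_funTS; apply: continuous_measurable_rV.
exact/smooth_continuous/test_smooth.
Qed.

Lemma test_supp_compact phi : test phi -> exists2 K, compact K /\ K `<=` Omega &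
  forall x, ~ K x -> phi x = 0.
Proof.
move=> [_ cK KO]; exists (closure [set x | phi x != 0]) => // x nK.
by apply/eqP/negPn/negP => px; apply: nK; exact: subset_closure.
Qed.

Lemma test_bounded phi : test phi -> exists2 M : R, 0 <= M & forall x, `|phi x| <= M.
Proof.
move=> tp; have [K [cK _] K0] := test_supp_compact tp.
by apply: compact_supp_bounded cK K0; exact/smooth_continuous/test_smooth.
Qed.

Lemma test_Lp p phi : 0 < p -> test phi -> Lp p phi.
Proof.
move=> p0 tp; have [M M0 HM] := test_bounded tp.
by apply: (@Lp_bounded _ _ _ _ _ mO Ooo p p0 phi M) => //; exact: test_measurable.
Qed.

Lemma gradE (phi : E -> R) (x : E) i : grad phi x ord0 i = 'D_(delta_mx ord0 i) phi x.
Proof. by rewrite mxE. Qed.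

Lemma test_grad phi i : test phi -> test (fun x => grad phi x ord0 i).
Proof.
move=> /(@test_fun_grad R d Omega _ (delta_mx ord0 i)).
by congr test_fun; apply/funext => x; rewrite gradE.
Qed.

Lemma test_grad_LpV p phi : 0 < p -> test phi -> LpV p (grad phi).
Proof. by move=> p0 tp i; apply: test_Lp => //; exact: test_grad. Qed.

Lemma grad_test_lin (a : R) (phi psi : E -> R) (x : E) : test phi -> test psi ->
  grad (fun x => a * phi x + psi x) x = a *: grad phi x + grad psi x.
Proof.
move=> /test_smooth sp /test_smooth sq; apply/rowP => i; rewrite !mxE.
have -> : (fun x => a * phi x + psi x) = (a \*: phi) + psi by [].
have dp v := @smooth_derivable R d phi x v sp.
have dq v := @smooth_derivable R d psi x v sq.
by rewrite deriveD//; [rewrite deriveZ|exact: derivableZ].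
Qed.

Lemma Lp_loc_integrable p u : 1 <= p -> Lp p u -> loc_integrable Omega u.
Proof.
move=> p1 Lu K cK KO.
apply: (integrableS mO) => //; last exact: Lp_intg Lu.
exact: compact_measurable_rV.
Qed.

Lemma loc_integrable_test u phi : loc_integrable Omega u -> test phi ->
  lam.-integrable Omega (EFin \o (fun x => u x * phi x)).
Proof.
move=> lu tp; have [K [cK KO] K0] := test_supp_compact tp.
have [M M0 HM] := test_bounded tp.
have mK := compact_measurable_rV cK.
have iu := lu K cK KO.
have muO := loc_integrable_measurable oO lu.
have iK : lam.-integrable K (EFin \o (fun x => u x * phi x)).
  have i2 : lam.-integrable K (EFin \o (fun x => M * `|u x|)).
    by apply: rintegrableZ => //; exact: rintegrable_abs iu.
  apply: (le_rintegrable mK _ _ i2).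
    apply: measurable_funM; last exact: test_measurable.
    exact: measurable_funS muO.
  by move=> x _; rewrite normrM mulrC ler_wpM2r.
move/(integrable_mkcond _ mK) : iK => iK.
apply/(integrable_mkcond _ mO); apply: eq_integrable iK => // x _.
rewrite !patchE; case: ifPn => [|]; rewrite ?inE => xK; first by rewrite mem_set//; exact: KO.
case: ifPn => // _; rewrite /= K0 ?mulr0//.
by move=> Kx; move: xK; rewrite mem_set.
Qed.

Lemma loc_integrable_lin (a : R) u v : loc_integrable Omega u ->
  loc_integrable Omega v -> loc_integrable Omega (fun x => a * u x + v x).
Proof.
move=> lu lv K cK KO; have mK := compact_measurable_rV cK.
by apply: rintegrableD => //; [apply: rintegrableZ => //; exact: lu|exact: lv].
Qed.

Lemma is_weak_grad_lin (a : R) u v g h : is_weak_grad Omega u g ->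
  is_weak_grad Omega v h ->
  is_weak_grad Omega (fun x => a * u x + v x) (fun x => a *: g x + h x).
Proof.
move=> [lu lg ug] [lv lh vh]; split; first exact: loc_integrable_lin.
  move=> i; under [fun x => _]eq_fun do rewrite !mxE; exact: loc_integrable_lin.
move=> phi i tp; have tg := test_grad i tp.
transitivity (\int[lam]_(x in Omega) (a * (u x * grad phi x ord0 i) + v x * grad phi x ord0 i)).
  by apply: eq_Rintegral => x _; rewrite mulrDl mulrA.
rewrite RintegralD//; [|apply: rintegrableZ => //;
  exact: loc_integrable_test|exact: loc_integrable_test].
rewrite RintegralZl//; last exact: loc_integrable_test.
rewrite ug// vh// mulrN -opprD; congr (- _).
rewrite -RintegralZl//; last exact: loc_integrable_test (lg i) tp.
rewrite -RintegralD//.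
- by apply: eq_Rintegral => x _; rewrite !mxE mulrDl mulrA.
- by apply: rintegrableZ => //; exact: loc_integrable_test (lg i) tp.
- exact: loc_integrable_test (lh i) tp.
Qed.

Lemma ae_rV_eq (g h : E -> E) :
  (forall i, {ae lam, forall x, Omega x -> g x ord0 i = h x ord0 i}) ->
  {ae lam, forall x, Omega x -> g x = h x}.
Proof.
move=> gh; have : {ae lam, forall x, forall i : 'I_d, Omega x -> g x ord0 i = h x ord0 i}.
  exact: filter_forall.
by apply: filterS => x H Ox; apply/rowP => i; exact: H.
Qed.

(** The fundamental lemma, applied to the components of the difference. *)
Lemma weak_grad_unique u v g h : is_weak_grad Omega u g -> is_weak_grad Omega v h ->
  {ae lam, forall x, Omega x -> u x = v x} ->
  {ae lam, forall x, Omega x -> g x = h x}.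
Proof.
move=> [lu lg ug] [lv lh vh] uv; apply: ae_rV_eq => i.
have lgh := loc_integrable_lin (-1) (lh i) (lg i).
have : {ae lam, forall x, Omega x -> -1 * h x ord0 i + g x ord0 i = 0}.
  apply: loc_integral_test0 lgh _ => // phi tp.
  have i1 := loc_integrable_test (lg i) tp; have i2 := loc_integrable_test (lh i) tp.
  transitivity (\int[lam]_(x in Omega) (g x ord0 i * phi x - h x ord0 i * phi x)).
    by apply: eq_Rintegral => x _; rewrite mulrDl mulN1r addrC mulNr.
  rewrite RintegralB//; apply/eqP; rewrite subr_eq0 -eqr_opp; apply/eqP.
  rewrite -ug// -vh//; have tg := test_grad i tp; apply: ae_eq_Rintegral => //.
  - exact: integrable_measurable (loc_integrable_test lu tg).
  - exact: integrable_measurable (loc_integrable_test lv tg).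
  - by apply: filterS uv => x H Ox; rewrite H.
by apply: filterS => x H Ox; have := H Ox; rewrite mulN1r addrC => /eqP; rewrite subr_eq0 => /eqP.
Qed.

Lemma weak_grad_test phi : test phi -> is_weak_grad Omega phi (grad phi).
Proof.
move=> tp; split.
- by apply: (@Lp_loc_integrable 1) => //; exact: test_Lp.
- by move=> i; apply: (@Lp_loc_integrable 1) => //; apply: test_Lp => //; exact: test_grad.
- move=> psi i tq; have := integral_test_by_parts (delta_mx ord0 i) tp (test_smooth tq).
  under eq_Rintegral do rewrite -gradE; move=> ->; congr (- _).
  by apply: eq_Rintegral => x _; rewrite gradE.
Qed.

(** Membership in [W01] with its witness exposed: the field is a parameter because
the linear combinations below need to name it, and convergence is measured
componentwise by integrals of powers. *)
Definition is_W01 p u g := [/\ Lp p u, LpV p g, is_weak_grad Omega u g &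
  exists phi : nat -> E -> R, [/\ forall n, test (phi n), Lpcvg p phi u &
    forall i, Lpcvg p (fun n x => grad (phi n) x ord0 i) (fun x => g x ord0 i)]].

Lemma W01P p u : 0 < p -> W01 Omega p u <-> exists g, is_W01 p u g.
Proof.
move=> p0; split=> -[g].
  move=> [/(memLpP mO _ p0) Lu Lg wg [phi [tp cu cg]]]; exists g.
  have {}Lg : LpV p g by move=> i; apply/(memLpP mO _ p0); exact: Lg.
  split=> //; exists phi; split=> // [|i].
    have Lup n : Lp p (u \- phi n) by apply: LpB => //; exact: test_Lp.
    exact/(normLp_cvg0 mO p0 Lup).
  have Lge n : LpV p (fun x => g x - grad (phi n) x).
    move=> j; under [fun x => _]eq_fun do rewrite !mxE.
    apply: LpB => //; have := test_Lp p0 (test_grad j (tp n)).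
    by congr (Lp p _); apply/funext => x; rewrite gradE.
  have Le n : Lp p (fun x => enorm (g x - grad (phi n) x)) by exact: (Lp_enorm mO p0 (Lge n)).
  have {}cg := (normLp_cvg0 mO p0 Le).1 cg.
  apply: (squeeze_cvgr _ (cvg_cst 0) cg); apply: nearW => n.
  rewrite Lpdist_ge0/=; apply: le_Rintegral => //.
  - have [_] := Lge n i; congr (lam.-integrable Omega (EFin \o _)).
    by apply/funext => x; rewrite !mxE.
  - by have [_] := Le n.
  - move=> x _; rewrite (ger0_norm (enorm_ge0 _)); apply: powR_le; first exact: ltW.
      exact: normr_ge0.
    by have := coord_le_enorm (g x - grad (phi n) x) i; rewrite !mxE.
move=> [Lu Lg wg [phi [tp cu cg]]]; exists g; split=> //.
- exact/(memLpP mO _ p0).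
- by move=> i; apply/(memLpP mO _ p0); exact: Lg.
exists phi; split => //.
  have Lup n : Lp p (u \- phi n) by apply: LpB => //; exact: test_Lp.
  exact/(normLp_cvg0 mO p0 Lup).
have Lge n : LpV p (fun x => g x - grad (phi n) x).
  move=> j; under [fun x => _]eq_fun do rewrite !mxE.
  apply: LpB => //; have := test_Lp p0 (test_grad j (tp n)).
  by congr (Lp p _); apply/funext => x; rewrite gradE.
have Le n : Lp p (fun x => enorm (g x - grad (phi n) x)) by exact: (Lp_enorm mO p0 (Lge n)).
apply/(normLp_cvg0 mO p0 Le).
(* the Euclidean norm is controlled by the sum of the components, at the cost of
   a power of the dimension *)
pose S n := d%:R `^ p * \sum_(i < d) Lpdist lam Omega p (fun x => g x ord0 i)
   (fun x => grad (phi n) x ord0 i).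
have cS : S n @[n --> \oo] --> d%:R `^ p * \sum_(i < d) (0 : R).
  apply: cvgMr; apply: cvg_big => [|i _]; last exact: cg.
  by move=> r; apply: add_continuous.
have S0 : d%:R `^ p * \sum_(i < d) (0 : R) = 0 by rewrite big1_eq mulr0.
rewrite S0 in cS.
apply: (squeeze_cvgr _ (cvg_cst 0) cS); apply: nearW => n.
apply/andP; split; first by apply: Rintegral_ge0 => x _; exact: powR_ge0.
have iD i : lam.-integrable Omega
    (EFin \o (fun x => `|g x ord0 i - grad (phi n) x ord0 i| `^ p)).
  have [_] := Lge n i; congr (lam.-integrable Omega (EFin \o _)).
  by apply/funext => x; rewrite !mxE.
rewrite /S /Lpdist -Rintegral_sum// -RintegralZl//; last exact: rintegrable_sum.
apply: le_Rintegral => //.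
- by have [_] := Le n.
- by apply: rintegrableZ => //; exact: rintegrable_sum.
- move=> x _; rewrite (ger0_norm (enorm_ge0 _)).
  apply: le_trans (powR_sum_le p0 _) => [|i]; last exact: normr_ge0.
  apply: powR_le; [exact: ltW|exact: enorm_ge0|].
  have := enorm_le_sum (g x - grad (phi n) x).
  by congr (_ <= _); apply: eq_bigr => i _; rewrite !mxE.
Qed.

Lemma wgradP u g : is_weak_grad Omega u g ->
  is_weak_grad Omega u (wgrad Omega u) /\
  {ae lam, forall x, Omega x -> wgrad Omega u x = g x}.
Proof.
move=> wg; have ww : is_weak_grad Omega u (wgrad Omega u).
  rewrite /wgrad; case: xgetP => [h -> //|/(_ g)]; by case.
by split=> //; apply: weak_grad_unique ww wg _; exact: aeW.
Qed.

(** The chosen representative of the gradient inherits measurability from local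
integrability, and the rest from almost everywhere equality. *)
Lemma is_W01_wgrad p u g : 0 < p -> is_W01 p u g -> is_W01 p u (wgrad Omega u).
Proof.
move=> p0 [Lu Lg wg [phi [tp cu cg]]]; have [ww wE] := wgradP wg.
have mw i : measurable_fun Omega (fun x => wgrad Omega u x ord0 i).
  by case: ww => _ /(_ i) lw _; exact: loc_integrable_measurable.
have Lw : LpV p (wgrad Omega u).
  move=> i; apply: Lp_ae_eq (Lg i) => //.
  by apply: filterS wE => x H Ox; rewrite H.
split; [exact: Lu|exact: Lw|exact: ww|].
exists phi; split; [exact: tp|exact: cu|move=> i].
apply: cvg_trans (cg i); apply: near_eq_cvg; apply: nearW => n.
have mphi : measurable_fun Omega (fun x => grad (phi n) x ord0 i).
  by apply: test_measurable; exact: test_grad.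
apply: ae_eq_Rintegral => //.
- by apply: measurable_powRabs; apply: measurable_funB => //; case: (Lg i).
- by apply: measurable_powRabs; exact: measurable_funB.
- by apply: filterS wE => x H Ox; rewrite H.
Qed.

Lemma W01_wgrad p u : 0 < p -> W01 Omega p u -> is_W01 p u (wgrad Omega u).
Proof. by move=> p0 /(W01P _ p0)[g]; exact: is_W01_wgrad. Qed.

Lemma is_W01_lin p (a : R) u v g h : 0 < p -> is_W01 p u g -> is_W01 p v h ->
  is_W01 p (fun x => a * u x + v x) (fun x => a *: g x + h x).
Proof.
move=> p0 [Lu Lg wg [phi [tp cu cg]]] [Lv Lh wh [psi [tq cv ch]]].
have Ltp n : Lp p (phi n) by exact: test_Lp.
have Ltq n : Lp p (psi n) by exact: test_Lp.
split.
- by apply: LpD => //; exact: LpZ.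
- move=> i; under [fun x => _]eq_fun do rewrite !mxE.
  by apply: LpD => //; exact: LpZ.
- exact: is_weak_grad_lin.
exists (fun n x => a * phi n x + psi n x); split.
- by move=> n; apply: (@test_funD R d Omega (fun x => a * phi n x)) => //; exact: test_funZ.
- exact: (LpcvgD mO p0 (LpZ mO a Lu) Lv (fun n => LpZ mO a (Ltp n)) Ltq
    (LpcvgZ mO p0 a Lu Ltp cu) cv).
- move=> i.
  rewrite (_ : (fun n x => _) = (fun n x => a * grad (phi n) x ord0 i + grad (psi n) x ord0 i)); last first.
    by apply/funext => n; apply/funext => x; rewrite grad_test_lin// !mxE.
  rewrite (_ : (fun x => (a *: g x + h x) ord0 i) = (fun x => a * g x ord0 i + h x ord0 i)); last first.
    by apply/funext => x; rewrite !mxE.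
  have Lgp n : Lp p (fun x => grad (phi n) x ord0 i) by apply: test_Lp => //; exact: test_grad.
  have Lgq n : Lp p (fun x => grad (psi n) x ord0 i) by apply: test_Lp => //; exact: test_grad.
  exact: (LpcvgD mO p0 (LpZ mO a (Lg i)) (Lh i) (fun n => LpZ mO a (Lgp n)) Lgq
    (LpcvgZ mO p0 a (Lg i) Lgp (cg i)) (ch i)).
Qed.

Lemma is_W01_test p phi : 0 < p -> test phi -> is_W01 p phi (grad phi).
Proof.
move=> p0 tp; split; [exact: test_Lp|exact: test_grad_LpV|exact: weak_grad_test|].
by exists (fun=> phi); split=> // [|i]; exact: Lpcvg_cst.
Qed.

Lemma W01_lin p (a : R) u v : 0 < p -> W01 Omega p u -> W01 Omega p v ->
  W01 Omega p (fun x => a * u x + v x) /\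
  {ae lam, forall x, Omega x ->
     wgrad Omega (fun x => a * u x + v x) x = a *: wgrad Omega u x + wgrad Omega v x}.
Proof.
move=> p0 /(W01_wgrad p0) Wu /(W01_wgrad p0) Wv.
have Wuv := is_W01_lin a p0 Wu Wv.
split; first by apply/(W01P _ p0); eexists; exact: Wuv.
by case: Wuv => _ _ /wgradP[].
Qed.

Lemma W01_test p phi : 0 < p -> test phi -> W01 Omega p phi /\
  {ae lam, forall x, Omega x -> wgrad Omega phi x = grad phi x}.
Proof.
move=> p0 tp; split; first by apply/(W01P _ p0); exists (grad phi); exact: is_W01_test.
by have [] := wgradP (weak_grad_test tp).
Qed.

Lemma W01_ae_wgrad p u v : 0 < p -> W01 Omega p u -> W01 Omega p v ->
  {ae lam, forall x, Omega x -> u x = v x} ->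
  {ae lam, forall x, Omega x -> wgrad Omega u x = wgrad Omega v x}.
Proof.
move=> p0 /(W01_wgrad p0)[_ _ wu _] /(W01_wgrad p0)[_ _ wv _].
exact: weak_grad_unique.
Qed.

End Sobolev.

(** * Minimizing sequences and the Poincare inequality *)

Section RieszMinimizer.
Context (R : realType) (V : lmodType R) (S : set V) (b : V -> V -> R).
Context (Sb : semi_inner S b).
Local Notation N u := (Num.sqrt (b u u)).

(** The first order optimality condition, in a quantitative form adapted to
approximate minimizers. *)
Lemma quadratic_bound (A B delta : R) : 0 <= B -> 0 < delta ->
  (forall t : R, - delta <= t * A + t ^+ 2 / 2 * B) ->
  `|A| <= Num.sqrt (2 * delta) * Num.sqrt B.
Proof.
move=> B0 d0 H; have d2 : 0 <= 2 * delta by rewrite mulr_ge0// ltW.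
rewrite -(sqrtrM _ d2) -sqrtr_sqr; apply: ler_wsqrtr.
have [B00|Bn0] := eqVneq B 0.
  have [->|An0] := eqVneq A 0; first by rewrite expr0n/= B00 mulr0.
  have := H (- (delta + 1) / A).
  by rewrite B00 mulr0 addr0 divfK//; lra.
have Bp : 0 < B by rewrite lt_neqAle eq_sym Bn0.
(* the minimizer of the quadratic *)
have := H (- A / B).
have -> : - A / B * A + (- A / B) ^+ 2 / 2 * B = - (A ^+ 2 / (2 * B)) by field.
by rewrite lerN2 ler_pdivrMr ?mulr_gt0//; lra.
Qed.

(** Members of a minimizing sequence of the energy [b u u / 2 - F u] are almost
critical points, and two almost critical points are close to each other.
Completeness enters only when passing to a limit. *)
Lemma riesz_minimizing (T : set V) (F : V -> R) (C : R) :
  T `<=` S -> T 0 -> (forall a u v, T u -> T v -> T (a *: u + v)) ->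
  (forall a u v, T u -> T v -> F (a *: u + v) = a * F u + F v) ->
  (forall u, T u -> `|F u| <= C * N u) ->
  exists (phi : nat -> V) (e : nat -> R),
   [/\ forall n, T (phi n), e n @[n --> \oo] --> 0,
       forall n psi, T psi -> `|b (phi n) psi - F psi| <= e n * N psi &
       forall n m, N (phi n - phi m) <= e n + e m].
Proof.
move=> TS T0 Tlin Flin FC; have [clos sym lin ge0] := Sb.
pose J u := b u u / 2 - F u.
have F0 : F 0 = 0.
  by have := Flin 1 0 0 T0 T0; rewrite scale1r addr0; lra.
have Jge u : T u -> - (C ^+ 2 / 2) <= J u.
  move=> Tu; rewrite /J; have := le_trans (ler_norm _) (FC u Tu).
  have := sqr_sqrtr (ge0 u (TS u Tu)); have := sqr_ge0 (N u - C).
  by rewrite sqrrB; lra.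
pose A := [set J u | u in T].
have A0 : has_inf A.
  split; first by exists (J 0), 0.
  by exists (- (C ^+ 2 / 2)) => _ [u Tu <-]; exact: Jge.
pose m := inf A.
have phiP n : {u | T u /\ J u < m + n.+1%:R^-1}.
  apply: cid; have n0 : 0 < n.+1%:R^-1 :> R by rewrite invr_gt0.
  by have [_ [u Tu <-] Ja] := inf_adherent n0 A0; exists u.
pose phi n := sval (phiP n).
have Tphi n : T (phi n) by have [] := svalP (phiP n).
have Jphi n : J (phi n) < m + n.+1%:R^-1 by have [] := svalP (phiP n).
pose e n := Num.sqrt (2 * n.+1%:R^-1 : R).
have crit n psi : T psi -> `|b (phi n) psi - F psi| <= e n * N psi.
  move=> Tp; apply: quadratic_bound; [exact: ge0 (TS _ Tp)|by rewrite invr_gt0|].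
  move=> t; have : m <= J (t *: psi + phi n).
    apply: inf_lbound; first by case: A0.
    by exists (t *: psi + phi n) => //; exact: Tlin.
  rewrite /J (semi_inner_expand Sb)//; try exact: TS.
  rewrite Flin// (sym psi (phi n))//; try exact: TS.
  by have := Jphi n; rewrite /J; move: (n.+1%:R^-1 : R) => i; lra.
exists phi, e; split=> //.
- rewrite /e; have h : 2 * n.+1%:R^-1 @[n --> \oo] --> 2 * (0 : R).
    by apply: cvgMr; exact: cvg_harmonic.
  have := cvg_comp _ _ h (@sqrt_continuous R (2 * 0)).
  by rewrite mulr0 sqrtr0.
- move=> n k; have TN : T (- phi k).
    by have := Tlin (-1) (phi k) 0 (Tphi k) T0; rewrite scaleN1r addr0.
  have Td : T (phi n - phi k).
    by have := Tlin 1 (phi n) (- phi k) (Tphi n) TN; rewrite scale1r.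
  set w := phi n - phi k in Td *.
  have bw : b w w = (b (phi n) w - F w) - (b (phi k) w - F w).
    have := lin (-1) (phi k) (phi n) w (TS _ (Tphi k)) (TS _ (Tphi n)) (TS _ Td).
    by rewrite scaleN1r addrC -/w => ->; lra.
  have H : b w w <= (e n + e k) * N w.
    rewrite {1}bw mulrDl (le_trans (ler_norm _))// (le_trans (ler_normB _ _))//.
    by rewrite lerD// crit.
  have [->|Nw] := eqVneq (N w) 0; first by rewrite addr_ge0// sqrtr_ge0.
  have Np : 0 < N w by rewrite lt_neqAle eq_sym Nw sqrtr_ge0.
  by rewrite -(ler_pM2r Np) -expr2 sqr_sqrtr// ge0//; exact: TS.
Qed.

End RieszMinimizer.

Section Dirichlet.
Context (R : realType) (d : nat).
Local Notation E := 'rV[R]_d.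
Local Notation lam := (@lebesgue_rV R d).
Context (Omega : set E) (oO : open Omega) (bO : bounded_set Omega).
Local Notation Lp := (Lp lam Omega).
Local Notation LpV := (LpV Omega).
Local Notation L2dot := (L2dot lam Omega).
Local Notation L2norm := (L2norm lam Omega).
Local Notation test := (test_fun Omega).

Let mO : measurable Omega. Proof. exact: open_measurable_rV. Qed.
Let Ooo : (lam Omega < +oo)%E. Proof. exact: bounded_rV_finite. Qed.

Lemma LpV_dotv_mul p q (g h : E -> E) : 0 < p -> 0 < q -> p^-1 + q^-1 = 1 ->
  LpV p g -> LpV q h -> lam.-integrable Omega (EFin \o (fun x => dotv (g x) (h x))).
Proof.
move=> p0 q0 pq Lg Lh; apply: rintegrable_sum => // i.
exact: (Lp_mul mO p0 q0 pq (Lg i) (Lh i)).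
Qed.

Definition L2dotV (g h : E -> E) : R := \int[lam]_(x in Omega) dotv (g x) (h x).

Lemma L2dotVE g h : LpV 2 g -> LpV 2 h ->
  L2dotV g h = \sum_(i < d) L2dot (fun x => g x ord0 i) (fun x => h x ord0 i).
Proof.
move=> Lg Lh; rewrite /L2dotV Rintegral_sum// => i.
exact: (L2_mul mO (Lg i) (Lh i)).
Qed.

Lemma L2norm_coord_le g i : LpV 2 g ->
  L2norm (fun x => g x ord0 i) <= Num.sqrt (L2dotV g g).
Proof.
move=> Lg; rewrite ler_wsqrtr// L2dotVE// (bigD1 i)//= lerDl.
by apply: sumr_ge0 => j _; exact: L2dot_ge0.
Qed.

Lemma LpV_lin p a (g h : E -> E) : 0 < p -> LpV p g -> LpV p h ->
  LpV p (fun x => a *: g x + h x).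
Proof.
move=> p0 Lg Lh i; under [fun x => _]eq_fun do rewrite !mxE.
exact: (LpD mO p0 (LpZ mO a (Lg i)) (Lh i)).
Qed.

Lemma L2dotV_lin a g h k : LpV 2 g -> LpV 2 h -> LpV 2 k ->
  L2dotV (fun x => a *: g x + h x) k = a * L2dotV g k + L2dotV h k.
Proof.
move=> Lg Lh Lk; have p2 : 0 < 2 :> R by [].
have i1 := LpV_dotv_mul p2 p2 (half_conj R) Lg Lk.
have i2 := LpV_dotv_mul p2 p2 (half_conj R) Lh Lk.
rewrite /L2dotV -(RintegralZl a mO i1) -(RintegralD mO (rintegrableZ mO a i1) i2).
by apply: eq_Rintegral => x _; rewrite dotv_lin.
Qed.

Lemma dotv_measurable (g h : E -> E) :
  (forall i, measurable_fun Omega (fun x => g x ord0 i)) ->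
  (forall i, measurable_fun Omega (fun x => h x ord0 i)) ->
  measurable_fun Omega (fun x => dotv (g x) (h x)).
Proof. by move=> mg mh; apply: measurable_sum => i; exact: measurable_funM. Qed.

(** Weak gradients are unique up to null sets, which the integral ignores. *)
Lemma dotH10E u v g h : is_W01 Omega 2 u g -> is_W01 Omega 2 v h ->
  dotH10 Omega u v = L2dotV g h.
Proof.
move=> Wu Wv; have p2 : 0 < 2 :> R by [].
have [_ Lgu _ _] := is_W01_wgrad oO p2 Wu; have [_ Lgv _ _] := is_W01_wgrad oO p2 Wv.
case: Wu => _ Lg wg _; case: Wv => _ Lh wh _.
have [_ gE] := wgradP oO wg; have [_ hE] := wgradP oO wh.
apply: ae_eq_Rintegral => //.
- by apply: dotv_measurable => i; [case: (Lgu i)|case: (Lgv i)].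
- by apply: dotv_measurable => i; [case: (Lg i)|case: (Lh i)].
- by apply: filterS2 gE hE => x gx hx Ox; rewrite gx// hx.
Qed.

Lemma dirichlet_semi_inner : semi_inner [set u : E -> R | W01 Omega 2 u] (dotH10 Omega).
Proof.
have p2 : 0 < 2 :> R by [].
split=> [a u v Wu Wv|u v _ _|a u v w Wu Wv Ww|u _].
- by have [] := W01_lin oO bO a p2 Wu Wv.
- by apply: eq_Rintegral => x _; exact: dotvC.
- have Iu := W01_wgrad oO bO p2 Wu; have Iv := W01_wgrad oO bO p2 Wv.
  have Iw := W01_wgrad oO bO p2 Ww.
  rewrite (dotH10E (is_W01_lin oO bO a p2 Iu Iv) Iw).
  by apply: L2dotV_lin; [case: Iu|case: Iv|case: Iw].
- by apply: Rintegral_ge0 => x _; exact: dotv_ge0.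
Qed.

Lemma H10_density u : W01 Omega 2 u -> exists phi : nat -> E -> R,
  [/\ forall n, test (phi n), L2norm (u - phi n) @[n --> \oo] --> 0 &
      normH10 Omega (u - phi n) @[n --> \oo] --> 0].
Proof.
have p2 : 0 < 2 :> R by [].
move=> Wu; have := W01_wgrad oO bO p2 Wu; set g := wgrad Omega u => Ig.
have [Lu Lg wg [phi [tp cu cg]]] := Ig.
have sq0 (a : nat -> R) : a n @[n --> \oo] --> (0:R) -> Num.sqrt (a n) @[n --> \oo] --> (0:R).
  by move=> /(cvg_comp _ _)/(_ (@sqrt_continuous R 0)); rewrite sqrtr0.
exists phi; split=> //; apply: sq0.
  by apply: cvg_trans cu; apply: near_eq_cvg; apply: nearW => n; rewrite Lpdist2E.
have It n := is_W01_test oO bO p2 (tp n).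
have Id n : is_W01 Omega 2 (u - phi n) (fun x => -1 *: grad (phi n) x + g x).
  have := is_W01_lin oO bO (-1) p2 (It n) Ig.
  by congr is_W01; apply/funext => x; rewrite mulN1r addrC.
have cS : \sum_(i < d) Lpdist lam Omega 2 (fun x => g x ord0 i)
   (fun x => grad (phi n) x ord0 i) @[n --> \oo] --> \sum_(i < d) (0 : R).
  apply: cvg_big => [|i _]; last exact: cg.
  by move=> r; apply: add_continuous.
rewrite big1_eq in cS; apply: cvg_trans cS; apply: near_eq_cvg; apply: nearW => n.
rewrite (dotH10E (Id n) (Id n)) L2dotVE; [|by case: (Id n)..].
apply: eq_bigr => i _; rewrite Lpdist2E; apply: eq_Rintegral => x _.
have h : (-1 *: grad (phi n) x + g x) ord0 i = g x ord0 i - grad (phi n) x ord0 i.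
  by rewrite mxE [X in X + _]mxE mulN1r addrC.
by rewrite h.
Qed.

(** Integrating [phi^2 * D x_i = phi^2] by parts gives
[int phi^2 = - 2 int x_i phi D_i phi], and [`|x_i| <= M] on [Omega]. *)
Lemma poincare_test (i0 : 'I_d) : exists2 C : R, 0 <= C &
  forall phi, test phi -> L2norm phi <= C * normH10 Omega phi.
Proof.
have p2 : 0 < 2 :> R by [].
have [M M0 HM] := bounded_rV_ex bO.
exists (2 * M); first by rewrite mulr_ge0// ltW.
move=> phi tp; pose e0 : E := delta_mx ord0 i0.
have It := is_W01_test oO bO p2 tp.
have [_ Lg _ _] := It.
have Lphi : Lp 2 phi by exact: (test_Lp oO bO).
have sphi := test_smooth tp.
pose x0 (x : E) : R := x ord0 i0.
have := integral_test_by_parts e0 (test_funM tp sphi) (@smooth_coord R d i0).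
have -> : \int[lam]_(x in Omega) ((phi * phi) x * 'D_e0 (fun x : E => x ord0 i0) x) = L2dot phi phi.
  by apply: eq_Rintegral => x _; rewrite derive_coord mxE !eqxx mulr1.
have mx0 (D : set E) : measurable_fun D (fun x => x0 x * phi x).
  have m1 : measurable_fun D x0 by apply: measurable_funTS; exact: measurable_coord.
  have m2 : measurable_fun D phi by exact: test_measurable tp.
  exact: measurable_funM m1 m2.
have x0M x : Omega x -> `|x0 x| <= M.
  move=> /HM /ltW; apply: le_trans.
  rewrite [leRHS]/Num.Def.normr/= mx_normrE.
  exact: (le_bigmax _ (fun ij => `|x ij.1 ij.2|) (ord0, i0)).
have x0le x : Omega x -> `|x0 x * phi x| <= `|M * phi x|.
  by move=> Ox; rewrite !normrM ler_wpM2r// [leRHS]gtr0_norm// x0M.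
have Lx0 : Lp 2 (fun x => x0 x * phi x).
  by apply: (Lp_le mO p2 _ x0le); [exact: mx0|exact: LpZ].
have -> : \int[lam]_(x in Omega) ('D_e0 (phi * phi) x * x ord0 i0) =
  2 * L2dot (fun x => x0 x * phi x) (fun x => grad phi x ord0 i0).
  rewrite -RintegralZl//; last by apply: L2_mul => //; exact: Lg.
  apply: eq_Rintegral => x _.
  rewrite gradE deriveM; [|exact: smooth_derivable..].
  by rewrite /GRing.scale/= /x0; ring.
move=> H.
have h1 := L2_CS mO Lx0 (Lg i0).
have h2 : L2norm (fun x => x0 x * phi x) <= M * L2norm phi.
  have -> : M * L2norm phi = L2norm (M *: phi).
    by have := semi_innerZ (@L2_semi_inner _ _ _ lam Omega mO) M Lphi; rewrite (gtr0_norm M0).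
  rewrite ler_wsqrtr//; apply: le_Rintegral => //.
  - exact: L2_mul.
  - by apply: L2_mul => //; exact: LpZ.
  - move=> x Ox; rewrite -!expr2 -real_normK ?num_real// -[leRHS]real_normK ?num_real//.
    by rewrite lerXn2r ?nnegrE//; exact: x0le.
have h3 : L2norm (fun x => grad phi x ord0 i0) <= normH10 Omega phi.
  by rewrite /normH10 (dotH10E It It); exact: L2norm_coord_le.
have n0 := L2norm_ge0 lam Omega phi.
have g0 := L2norm_ge0 lam Omega (fun x => grad phi x ord0 i0).
have nH : L2dot phi phi <= 2 * M * normH10 Omega phi * L2norm phi.
  rewrite H -mulrN -!mulrA ler_pM2l// (le_trans (ler_norm _))// normrN (le_trans h1)//.
  rewrite (@le_trans _ _ (M * L2norm phi * normH10 Omega phi))//.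
    by rewrite ler_pM// L2norm_ge0.
  by rewrite -mulrA ler_pM2l// mulrC.
have [->|nn0] := eqVneq (L2norm phi) 0; first by rewrite !mulr_ge0 ?sqrtr_ge0// ltW.
have np : 0 < L2norm phi by rewrite lt_neqAle eq_sym nn0.
by rewrite -(ler_pM2r np) -expr2 L2norm_sqr.
Qed.

End Dirichlet.

(** * The Riesz isometry *)

Section Riesz.
Context (R : realType) (d : nat) (d_gt0 : (0 < d)%N).
Local Notation E := 'rV[R]_d.
Local Notation lam := (@lebesgue_rV R d).
Context (Omega : set E) (oO : open Omega) (bO : bounded_set Omega).
Local Notation Lp := (Lp lam Omega).
Local Notation LpV := (LpV Omega).
Local Notation L2dot := (L2dot lam Omega).
Local Notation L2norm := (L2norm lam Omega).
Local Notation test := (test_fun Omega).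
Local Notation N := (normH10 Omega).

Let mO : measurable Omega. Proof. exact: open_measurable_rV. Qed.
Let Ooo : (lam Omega < +oo)%E. Proof. exact: bounded_rV_finite. Qed.
Let p2 : 0 < 2 :> R. Proof. by []. Qed.
Let p12 : 1 <= 2 :> R. Proof. by rewrite ler1n. Qed.
Let dirS := dirichlet_semi_inner oO bO.

Lemma normH10_ge0 u : 0 <= N u. Proof. exact: sqrtr_ge0. Qed.

Lemma W01_Lp p u : 0 < p -> W01 Omega p u -> Lp p u.
Proof. by move=> p0 /(W01_wgrad oO bO p0)[]. Qed.

Lemma W01_LpV p u : 0 < p -> W01 Omega p u -> LpV p (wgrad Omega u).
Proof. by move=> p0 /(W01_wgrad oO bO p0)[]. Qed.

Lemma test_W01 p phi : 0 < p -> test phi -> W01 Omega p phi.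
Proof. by move=> p0 tp; have [] := W01_test oO bO p0 tp. Qed.

Lemma W01_sub p u v : 0 < p -> W01 Omega p u -> W01 Omega p v -> W01 Omega p (v - u).
Proof.
move=> p0 Wu Wv; have [W _] := W01_lin oO bO (-1) p0 Wu Wv.
rewrite (_ : v - u = (fun x => -1 * u x + v x))//.
by apply/funext => x; rewrite mulN1r addrC.
Qed.

Lemma normH10Z a u : W01 Omega 2 u -> N (a *: u) = `|a| * N u.
Proof. exact: (semi_innerZ dirS). Qed.

Lemma normH10B u v : W01 Omega 2 u -> W01 Omega 2 v -> N (u - v) <= N u + N v.
Proof. exact: (semi_inner_triangleB dirS). Qed.

Lemma dotH10B u v w : W01 Omega 2 u -> W01 Omega 2 v -> W01 Omega 2 w ->
  dotH10 Omega (u - v) w = dotH10 Omega u w - dotH10 Omega v w.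
Proof.
move=> Wu Wv Ww; have [_ _ lin _] := dirS.
have -> : u - v = -1 *: v + u by rewrite scaleN1r addrC.
by rewrite (lin _ _ _ _ Wv Wu Ww) mulN1r addrC.
Qed.

Lemma dotH10C u v : W01 Omega 2 u -> W01 Omega 2 v -> dotH10 Omega u v = dotH10 Omega v u.
Proof. by move=> Wu Wv; have [_ sym _ _] := dirS; exact: sym. Qed.

Lemma poincare_H10 : exists2 C : R, 0 <= C &
  forall u, W01 Omega 2 u -> L2norm u <= C * N u.
Proof.
have [C C0 HC] := poincare_test oO bO (Ordinal d_gt0).
exists C => // u Wu; have [phi [tp c2 cN]] := H10_density oO bO Wu.
have Lu := W01_Lp p2 Wu.
have H n : L2norm u <= L2norm (u - phi n) + C * (N (u - phi n) + N u).
  have Lphi : Lp 2 (phi n) by exact: (test_Lp oO bO).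
  have Wphi : W01 Omega 2 (phi n) by exact: test_W01.
  have := semi_inner_triangle (@L2_semi_inner _ _ _ lam Omega mO) (LpB mO p2 Lu Lphi) Lphi.
  have -> : (fun x => u x - phi n x) + phi n = u.
    by apply/funext => x; rewrite -[LHS]/(u x - phi n x + phi n x) subrK.
  move=> /le_trans; apply; rewrite lerD2l (le_trans (HC _ (tp n)))// ler_wpM2l//.
  have := normH10B (W01_sub p2 Wphi Wu) Wu.
  have -> : u - phi n - u = -1 *: phi n.
    by rewrite addrAC subrr add0r scaleN1r.
  by rewrite (normH10Z (-1) Wphi) normrN1 mul1r.
have cH : L2norm (u - phi n) + C * (N (u - phi n) + N u) @[n --> \oo] --> 0 + C * (0 + N u).
  by apply: cvgD => //; apply: cvgMr; apply: cvgD => //; exact: cvg_cst.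
rewrite !add0r in cH; rewrite -(cvg_lim _ cH)//.
apply: limr_ge; first by apply/cvg_ex; eexists; exact: cH.
by apply: nearW => n; exact: H.
Qed.

Lemma L2dot_cvg (un : nat -> E -> R) u v : (forall n, Lp 2 (un n)) -> Lp 2 u -> Lp 2 v ->
  L2norm (u - un n) @[n --> \oo] --> 0 -> L2dot (un n) v @[n --> \oo] --> L2dot u v.
Proof.
move=> Lun Lu Lv cu; have Sb := @L2_semi_inner _ _ _ lam Omega mO.
apply/cvgrPdist_le => e e0.
have c2 : L2norm (u - un n) * L2norm v @[n --> \oo] --> 0 * L2norm v by apply: cvgMl.
rewrite mul0r in c2; move/cvgrPdist_le : c2 => /(_ e e0); apply: filterS => n.
rewrite sub0r normrN ger0_norm ?mulr_ge0 ?L2norm_ge0//; apply: le_trans.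
have Ld := LpB mO p2 Lu (Lun n).
have -> : L2dot u v - L2dot (un n) v = L2dot (u - un n) v.
  have [_ _ lin _] := Sb; have := lin (-1) _ _ _ (Lun n) Lu Lv.
  by rewrite scaleN1r addrC => ->; rewrite mulN1r addrC.
exact: (L2_CS mO Ld Lv).
Qed.

(** By the Poincare inequality the sequence is also Cauchy in mean square; the
limits of the functions and of their gradients match because the definition of
weak gradients passes to the limit. *)
Lemma H10_complete (phi : nat -> E -> R) (e : nat -> R) : (forall n, test (phi n)) ->
  (forall n m, N (phi n - phi m) <= e n + e m) -> e n @[n --> \oo] --> 0 ->
  exists u, W01 Omega 2 u /\ N (u - phi n) @[n --> \oo] --> 0.
Proof.
move=> tp phie e0; have [C C0 HC] := poincare_H10.
have Wp n : W01 Omega 2 (phi n) by exact: test_W01.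
have Lphi n : Lp 2 (phi n) by exact: W01_Lp.
have Wd n m := W01_sub p2 (Wp m) (Wp n).
have It n := is_W01_test oO bO p2 (tp n).
have Lg n i : Lp 2 (fun x => grad (phi n) x ord0 i) by case: (It n) => _ /(_ i).
have [||u [Lu cu]] := @L2_complete _ _ _ lam Omega mO Ooo phi (fun n => C * e n) Lphi.
- by move=> n m; rewrite -mulrDr (le_trans (HC _ (Wd n m)))// ler_wpM2l.
- by rewrite -[X in _ --> X](mulr0 C); apply: cvgMr.
have gex i : {g : E -> R | Lp 2 g /\
    L2norm (g - (fun x => grad (phi n) x ord0 i)) @[n --> \oo] --> 0}.
  apply: cid; apply: (@L2_complete _ _ _ lam Omega mO Ooo
    (fun n x => grad (phi n) x ord0 i) e (fun n => Lg n i)) => // n m.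
  apply: le_trans (phie n m).
  have Inm := is_W01_lin oO bO (-1) p2 (It m) (It n).
  have -> : N (phi n - phi m) = N (fun x => -1 * phi m x + phi n x).
    by congr N; apply/funext => x; rewrite mulN1r addrC.
  rewrite /normH10 (dotH10E oO Inm Inm).
  have [_ L _ _] := Inm; have := L2norm_coord_le oO i L.
  congr (L2norm _ <= _); apply/funext => x.
  by rewrite mxE [X in X + _]mxE mulN1r addrC.
pose g (x : E) : E := \row_i sval (gex i) x.
have gE i : (fun x => g x ord0 i) = sval (gex i) by apply/funext => x; rewrite mxE.
have Lgi i : Lp 2 (fun x => g x ord0 i) by rewrite gE; have [] := svalP (gex i).
have cgi i : L2norm ((fun x => g x ord0 i) - (fun x => grad (phi n) x ord0 i)) @[n --> \oo] --> 0.
  by rewrite gE; have [] := svalP (gex i).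
have sq0 (a : nat -> R) : Num.sqrt (a n) @[n --> \oo] --> (0:R) -> (forall n, 0 <= a n) ->
    a n @[n --> \oo] --> (0:R).
  move=> ca a0.
  have H : Num.sqrt (a n) * Num.sqrt (a n) @[n --> \oo] --> (0 : R) * 0 by exact: (cvgM ca ca).
  rewrite mulr0 in H; rewrite (_ : a = fun n => Num.sqrt (a n) * Num.sqrt (a n))//.
  by apply/funext => n; rewrite -expr2 sqr_sqrtr.
have Iu : is_W01 Omega 2 u g.
  split=> //; last first.
    exists phi; split=> // [|i].
      apply: cvg_trans (sq0 _ cu (fun n => L2dot_ge0 _ _ _)).
      by apply: near_eq_cvg; apply: nearW => n; rewrite Lpdist2E.
    apply: cvg_trans (sq0 _ (cgi i) (fun n => L2dot_ge0 _ _ _)).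
    by apply: near_eq_cvg; apply: nearW => n; rewrite Lpdist2E.
  split.
  - exact: (Lp_loc_integrable oO bO p12 Lu).
  - by move=> i; exact: (Lp_loc_integrable oO bO p12 (Lgi i)).
  move=> psi i tq; have Lq := test_Lp oO bO p2 tq.
  have Lqi := test_Lp oO bO p2 (test_grad i tq).
  have c1 := L2dot_cvg Lphi Lu Lqi cu.
  have c2 : - L2dot (fun x => grad (phi n) x ord0 i) psi @[n --> \oo] -->
      - L2dot (fun x => g x ord0 i) psi.
    by apply: cvgN; exact: (L2dot_cvg (fun n => Lg n i) (Lgi i) Lq (cgi i)).
  apply: (cvg_unique _ c1) => //.
  rewrite (_ : (fun n => L2dot (phi n) _) = (fun n => - L2dot (fun x => grad (phi n) x ord0 i) psi))//.
  by apply/funext => n; case: (It n) => _ _ [_ _ h] _; exact: h.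
have Wu : W01 Omega 2 u by apply/(W01P oO bO _ p2); exists g.
exists u; split=> //.
have cS : Num.sqrt (\sum_(i < d) L2dot ((fun x => g x ord0 i) - (fun x => grad (phi n) x ord0 i))
  ((fun x => g x ord0 i) - (fun x => grad (phi n) x ord0 i))) @[n --> \oo] --> (0 : R).
  have c : \sum_(i < d) L2dot ((fun x => g x ord0 i) - (fun x => grad (phi n) x ord0 i))
    ((fun x => g x ord0 i) - (fun x => grad (phi n) x ord0 i)) @[n --> \oo] --> \sum_(i < d) (0 : R).
    apply: cvg_big => [|i _]; first by move=> r; apply: add_continuous.
    exact: (sq0 _ (cgi i) (fun n => L2dot_ge0 _ _ _)).
  rewrite big1_eq in c.
  by have := cvg_comp _ _ c (@sqrt_continuous R 0); rewrite sqrtr0.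
apply: cvg_trans cS; apply: near_eq_cvg; apply: nearW => n.
have Id := is_W01_lin oO bO (-1) p2 (It n) Iu.
have -> : u - phi n = (fun x => -1 * phi n x + u x).
  by apply/funext => x; rewrite mulN1r addrC.
rewrite /normH10 (dotH10E oO Id Id) L2dotVE//; [|by case: Id..].
congr Num.sqrt; apply: eq_bigr => i _; apply: eq_Rintegral => x _.
have -> : (-1 *: grad (phi n) x + g x) ord0 i = g x ord0 i - grad (phi n) x ord0 i.
  by rewrite mxE [X in X + _]mxE mulN1r addrC.
by [].
Qed.

Definition toH10 (u : E -> R) (Wu : W01 Omega 2 u) : H10 Omega := SigSub (mem_set Wu).

Lemma H10P (u : H10 Omega) : W01 Omega 2 (val u).
Proof. by have := valP u; rewrite inE. Qed.

Section functional.
Context (f : H10 Omega -> R) (Hf : Hm1 f).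

Lemma Hm1_lin (a : R) (u v w : H10 Omega) :
  (forall x, val w x = a * val u x + val v x) -> f w = a * f u + f v.
Proof. by case: Hf => H _ e; apply: H; apply: aeW => x _; exact: e. Qed.

Lemma Hm1_0 (Z : W01 Omega 2 0) : f (toH10 Z) = 0.
Proof.
have := @Hm1_lin 1 (toH10 Z) (toH10 Z) (toH10 Z); rewrite /= => H.
have {}H : f (toH10 Z) = 1 * f (toH10 Z) + f (toH10 Z).
  by apply: H => x; rewrite mul1r; rewrite -[(0 : E -> R) x]/(0 : R) addr0.
lra.
Qed.

Lemma W010 : W01 Omega 2 0.
Proof. by have := H10_0 Omega; rewrite inE. Qed.

(** Continuity at 0 and homogeneity.  A function is scaled to a norm just below the
radius; the [e] avoids dividing by a norm that may vanish. *)
Lemma Hm1_bounded : exists2 C : R, 0 <= C & forall u : H10 Omega, `|f u| <= C * N (val u).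
Proof.
have [_ /(_ (toH10 W010) 1 ltr01)[r r0 Hr]] := Hf.
exists r^-1 => [|u]; first by rewrite invr_ge0 ltW.
rewrite mulrC ler_pdivlMr//; apply/ler_addgt0Pr => e e0.
have s0 : 0 < N (val u) + e by rewrite ltr_wpDl// normH10_ge0.
set s := N (val u) + e in s0 *.
have Wu := H10P u.
have Ww : W01 Omega 2 (fun x => (r / s) * val u x + 0).
  by have [] := W01_lin oO bO (r / s) p2 Wu W010.
have fw : f (toH10 Ww) = (r / s) * f u.
  by rewrite (@Hm1_lin (r / s) u (toH10 W010) (toH10 Ww))// Hm1_0 addr0.
have rs0 : 0 < r / s by rewrite divr_gt0.
have := Hr (toH10 Ww).
have -> : val (toH10 Ww) \- val (toH10 W010) = (r / s) *: val u.
  by apply/funext => x; rewrite /= -[(0 : E -> R) x]/(0 : R) subr0 addr0.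
rewrite (normH10Z _ Wu) (gtr0_norm rs0) Hm1_0 subr0 fw normrM (gtr0_norm rs0) => H.
have : r / s * N (val u) < r.
  by rewrite mulrAC ltr_pdivrMr// ltr_pM2l// /s ltrDl.
move=> /H; rewrite mulrAC ltr_pdivrMr// mul1r mulrC => /ltW.
by [].
Qed.

(** The energy is minimized over test functions, the completeness being known for
sequences of those; the representation then extends to the whole space by
density. *)
Lemma riesz_H10 : exists u : H10 Omega, mDelta u = f.
Proof.
have [C C0 fC] := Hm1_bounded.
(* [f] is defined on a subtype; it is extended by 0 to all functions *)
pose F (v : E -> R) : R := if pselect (W01 Omega 2 v) is left Wv then f (toH10 Wv) else 0.
have FE v (Wv : W01 Omega 2 v) : F v = f (toH10 Wv).
  by rewrite /F; case: pselect => // Wv'; congr (f _); exact: val_inj.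
have FC v : W01 Omega 2 v -> `|F v| <= C * N v by move=> Wv; rewrite (FE _ Wv); exact: fC.
have Flin a u v : W01 Omega 2 u -> W01 Omega 2 v -> F (a *: u + v) = a * F u + F v.
  move=> Wu Wv; have [Ww _] := W01_lin oO bO a p2 Wu Wv.
  rewrite (FE _ Wu) (FE _ Wv) (FE _ Ww); exact: Hm1_lin.
have tW : [set phi : E -> R | test phi] `<=` [set u | W01 Omega 2 u].
  by move=> phi; exact: test_W01.
have [||||phi [e [tp e0 crit cau]]] := @riesz_minimizing _ _ _ _ dirS
  [set phi : E -> R | test phi] F C tW.
- exact: test_fun0.
- move=> a u v tu tv; apply: test_funD => //; exact: test_funZ.
- by move=> a u v /tW Wu /tW Wv; exact: Flin.
- by move=> u /tW; exact: FC.
have [u [Wu cu]] := H10_complete tp cau e0.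
have uF psi : test psi -> dotH10 Omega u psi = F psi.
  move=> tq; have Wq := tW _ tq.
  have c1 : `|dotH10 Omega u psi - F psi| <= 0.
    have cc : N (u - phi n) * N psi + e n * N psi @[n --> \oo] --> 0 * N psi + 0 * N psi.
      by apply: cvgD; apply: cvgMl.
    rewrite !mul0r addr0 in cc; rewrite -(cvg_lim _ cc)//.
    apply: limr_ge; first by apply/cvg_ex; eexists; exact: cc.
    apply: nearW => n; have Wn := tW _ (tp n).
    have -> : dotH10 Omega u psi - F psi =
        dotH10 Omega (u - phi n) psi + (dotH10 Omega (phi n) psi - F psi).
      by rewrite (dotH10B Wu Wn Wq) addrA subrK.
    apply: le_trans (ler_normD _ _) _; apply: lerD; last exact: crit.
    exact: (semi_inner_CS dirS (W01_sub p2 Wn Wu) Wq).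
  by move: c1; rewrite normr_le0 subr_eq0 => /eqP.
exists (toH10 Wu); apply/funext => w; have Ww := H10P w.
rewrite /mDelta /=; have [psi [tq _ cw]] := H10_density oO bO Ww.
have -> : f w = F (val w) by rewrite (FE _ Ww); congr (f _); exact: val_inj.
apply/eqP; rewrite -subr_eq0 -normr_le0.
have cc : (N u + C) * N (val w - psi n) @[n --> \oo] --> (N u + C) * 0.
  by apply: cvgMr.
rewrite mulr0 in cc; rewrite -(cvg_lim _ cc)//.
apply: limr_ge; first by apply/cvg_ex; eexists; exact: cc.
apply: nearW => n; have Wn := tW _ (tq n).
have Wd := W01_sub p2 Wn Ww.
have -> : dotH10 Omega u (val w) - F (val w) =
   dotH10 Omega u (val w - psi n) - F (val w - psi n).
  have FB : F (val w - psi n) = F (val w) - F (psi n).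
    have -> : val w - psi n = -1 *: psi n + val w by rewrite scaleN1r addrC.
    by rewrite (Flin _ _ _ Wn Ww) mulN1r addrC.
  rewrite FB -(uF _ (tq n)) (dotH10C Wu Wd) (dotH10B Ww Wn Wu).
  by rewrite (dotH10C Ww Wu) (dotH10C Wn Wu) opprB addrA subrK.
rewrite mulrDl (le_trans (ler_normB _ _))// lerD//; last exact: FC.
exact: (semi_inner_CS dirS Wu Wd).
Qed.

Lemma mDelta_invK : mDelta (mDelta_inv f) = f.
Proof.
have [u uf] := riesz_H10.
rewrite /mDelta_inv; case: xgetP => [v -> //|/(_ u)].
by case.
Qed.

End functional.
End Riesz.

(** * Hahn-Banach extension under a convex majorant *)

Section HahnBanach.
Context (R : realType) (V : lmodType R) (D : set V) (q : V -> R).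

Definition linear_rel (G : set (V * R)) : Prop :=
  G (0, 0) /\
  forall a u r v s, G (u, r) -> G (v, s) -> G (a *: u + v, a * r + s).

Definition dominated_rel (G : set (V * R)) : Prop :=
  forall u r, G (u, r) -> D u /\ r <= q u.

Context (D_lin : forall a u v, D u -> D v -> D (a *: u + v)).
Context (q_convex : forall (t : R) u v, 0 <= t <= 1 -> D u -> D v ->
  q (t *: u + (1 - t) *: v) <= t * q u + (1 - t) * q v).

(** The value [c] at the new vector has to lie above the slopes
[(r - q (u - t *: v)) / t] and below the slopes [(q (u + t *: v) - r) / t].
Convexity puts the former below the latter: in the combination with weights
proportional to [t2] and [t1] the multiples of [v] cancel. *)
Lemma extension_value (G : set (V * R)) (v : V) : linear_rel G -> dominated_rel G -> D v ->
  exists c : R, forall u r s, G (u, r) -> r + s * c <= q (u + s *: v).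
Proof.
move=> [G0 Glin] Gdom Dv.
pose A := [set c : R | exists u r t, [/\ G (u, r), 0 < t & c = (r - q (u - t *: v)) / t]].
have D0 : D 0 by have [] := Gdom _ _ G0.
have DZ a : D (a *: v) by have := D_lin a Dv D0; rewrite addr0.
have DZu u r a : G (u, r) -> D (u + a *: v).
  by move=> /Gdom[Du _]; rewrite addrC; exact: D_lin.
have cross u1 r1 t1 u2 r2 t2 : G (u1, r1) -> G (u2, r2) -> 0 < t1 -> 0 < t2 ->
    (r1 - q (u1 - t1 *: v)) / t1 <= (q (u2 + t2 *: v) - r2) / t2.
  move=> G1 G2 t10 t20; set l := t2 / (t1 + t2).
  have t12 : 0 < t1 + t2 by exact: addr_gt0.
  have l01 : 0 <= l <= 1.
    apply/andP; split; first by rewrite /l divr_ge0// ltW.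
    by rewrite /l ler_pdivrMr// mul1r lerDr ltW.
  have l1 : 1 - l = t1 / (t1 + t2) by rewrite /l; field; rewrite gt_eqF.
  have Gl : G (l *: u1 + (1 - l) *: u2, l * r1 + (1 - l) * r2).
    have h := Glin (1 - l) u2 r2 0 0 G2 G0; rewrite !addr0 in h.
    exact: Glin.
  have [_ h1] := Gdom _ _ Gl.
  have D1 : D (u1 - t1 *: v) by rewrite -scaleNr; exact: DZu G1.
  have D2 : D (u2 + t2 *: v) by exact: DZu G2.
  have h2 := q_convex l01 D1 D2.
  have E : l *: (u1 - t1 *: v) + (1 - l) *: (u2 + t2 *: v) = l *: u1 + (1 - l) *: u2.
    rewrite scalerBr scalerDr !scalerA addrACA -scaleNr -scalerDl.
    rewrite (_ : - (l * t1) + (1 - l) * t2 = 0) ?scale0r ?addr0//.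
    by rewrite l1 /l; field; rewrite gt_eqF.
  rewrite E in h2; have := le_trans h1 h2.
  rewrite l1 /l => h.
  rewrite ler_pdivrMr// mulrAC ler_pdivlMr//.
  have : (t2 * r1 + t1 * r2) / (t1 + t2) <= (t2 * q (u1 - t1 *: v) + t1 * q (u2 + t2 *: v)) / (t1 + t2).
    by rewrite !mulrDl; lra.
  by rewrite ler_pM2r ?invr_gt0//; lra.
have ubA u r t : G (u, r) -> 0 < t -> ubound A ((q (u + t *: v) - r) / t).
  by move=> Gu t0 _ [u1 [r1 [t1 [G1 t10 ->]]]]; exact: cross.
have A0 : A !=set0 by exists ((0 - q (0 - 1 *: v)) / 1), 0, 0, 1; split.
have hA : has_sup A by split=> //; eexists; exact: (ubA 0 0 1 G0 ltr01).
exists (sup A) => u r s Gu; have [s0|s0|->] := ltgtP s 0.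
- have : (r - q (u - (- s) *: v)) / (- s) <= sup A.
    apply: sup_upper_bound => //; exists u, r, (- s); split=> //.
    by rewrite oppr_gt0.
  by rewrite ler_pdivrMr ?oppr_gt0// scaleNr opprK; lra.
- have : sup A <= (q (u + s *: v) - r) / s by apply: sup_le_ub => //; exact: ubA.
  by rewrite ler_pdivlMr//; lra.
- by rewrite mul0r scale0r !addr0; have [] := Gdom _ _ Gu.
Qed.

(** Zorn's lemma, applied to linear relations instead of partial functions: the
supremum of a chain is then its union, and single-valuedness is automatic since
a relation containing [(0, r)] with [r != 0] contains all multiples of it and
cannot be dominated. *)
Lemma hahn_banach (G0 : set (V * R)) : q 0 = 0 ->
  linear_rel G0 -> dominated_rel G0 ->
  exists L : V -> R,
   [/\ forall a u v, D u -> D v -> L (a *: u + v) = a * L u + L v,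
       forall u, D u -> L u <= q u &
       forall u r, G0 (u, r) -> L u = r].
Proof.
move=> q0 G0lin G0dom.
(* joined with [G0], so that the empty chain has an upper bound *)
pose P (A : set (V * R)) := linear_rel (G0 `|` A) /\ dominated_rel (G0 `|` A).
have [|A [[Alin Adom] Amax]] := @Zorn_bigcup _ P.
  move=> F FP Ftot.
  (* two elements of the union of a chain lie in one of its members *)
  have key x y : (G0 `|` \bigcup_(X in F) X) x -> (G0 `|` \bigcup_(X in F) X) y ->
      exists2 B, linear_rel B /\ dominated_rel B & [/\ B x, B y & B `<=` G0 `|` \bigcup_(X in F) X].
    have sub X : F X -> G0 `|` X `<=` G0 `|` \bigcup_(X in F) X.
      by move=> FX z [|Xz]; [left|right; exists X].
    move=> [x0|[X FX Xx]] [y0|[Y FY Yy]].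
    - by exists G0 => //; split=> // z; left.
    - by exists (G0 `|` Y); [exact: FP|split; [left|right|exact: sub]].
    - by exists (G0 `|` X); [exact: FP|split; [right|left|exact: sub]].
    - have [XY|YX] := Ftot X Y FX FY.
        by exists (G0 `|` Y); [exact: FP|split; [right; exact: XY|right|exact: sub]].
      by exists (G0 `|` X); [exact: FP|split; [right|right; exact: YX|exact: sub]].
  split; last by move=> u r /[dup] h /(key _ _ h)[B [_ Bdom] [Bx _ _]]; exact: Bdom.
  split; first by left; case: G0lin.
  move=> a u r v s hu hv; have [B [[_ Blin] _] [Bu Bv BG]] := key _ _ hu hv.
  by apply: BG; exact: Blin.
set G := G0 `|` A in Alin Adom.
have [G00 Glin] := Alin.
have total v : D v -> exists r, G (v, r).
  move=> Dv; apply: contrapT => nv.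
  have [c Hc] := extension_value Alin Adom Dv.
  (* the extension of [G] by the value [c] at [v] *)
  pose B := [set x : V * R | exists u r s, G (u, r) /\ x = (u + s *: v, r + s * c)].
  have GB : G `<=` B.
    by move=> [u r] Gu; exists u, r, 0; rewrite scale0r mul0r !addr0.
  have G0B : G0 `|` B = B by apply/setUidPr => x G0x; apply: GB; left.
  apply: (Amax B).
    split; first by move=> x Ax; apply: GB; right.
    move=> BA; apply: nv; exists c; right; apply: BA.
    by exists 0, 0, 1; rewrite scale1r mul1r !add0r.
  rewrite /P G0B; split.
    split; first exact: GB.
    move=> a _ _ _ _ [u [r [s [Gu [-> ->]]]]] [u' [r' [s' [Gu' [-> ->]]]]].
    exists (a *: u + u'), (a * r + r'), (a * s + s'); split; first exact: Glin.
    congr pair; last by ring.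
    by rewrite scalerDr scalerA scalerDl addrACA.
  move=> _ _ [u [r [s [Gu [-> ->]]]]]; split; last exact: Hc.
  by rewrite addrC; apply: D_lin => //; have [] := Adom _ _ Gu.
have single u r s : G (u, r) -> G (u, s) -> r = s.
  move=> Gr Gs.
  have H a : a * (r - s) <= 0.
    have h := Glin (-1) _ _ _ _ Gs Gr.
    have := Glin a _ _ 0 0 h G00; rewrite scaleN1r addNr scaler0 !addr0.
    by move=> /Adom[_]; rewrite q0 mulN1r addrC.
  have := H 1; have := H (-1); lra.
pose L v := xget 0 [set r | G (v, r)].
have LG u : D u -> G (u, L u).
  by move=> /total[r Gr]; rewrite /L; case: xgetP => // /(_ r).
exists L; split.
- move=> a u v Du Dv; apply: single (LG _ (D_lin a Du Dv)) _.
  by apply: Glin; exact: LG.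
- by move=> u /LG /Adom[].
- move=> u r G0u; have Gu : G (u, r) by left.
  by have [Du _] := Adom _ _ Gu; exact: single (LG _ Du) Gu.
Qed.

End HahnBanach.

Section Sigma.
Context (R : realType) (d : nat) (p mu : R) (p_gt1 : 1 < p) (mu_gt0 : 0 < mu).
Local Notation E := 'rV[R]_d.
Local Notation sigma := (@sigma R d p mu).

Let p0 : 0 < p. Proof. exact: lt_trans p_gt1. Qed.
Let c0 : 0 <= mu / p. Proof. by rewrite divr_ge0// ltW. Qed.

Lemma sigma_ge0 y : 0 <= sigma y.
Proof. by rewrite addr_ge0 ?enorm_ge0// mulr_ge0// powR_ge0. Qed.

Lemma powR_convex (t a b : R) : 0 <= t <= 1 -> 0 <= a -> 0 <= b ->
  (t * a + (1 - t) * b) `^ p <= t * a `^ p + (1 - t) * b `^ p.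
Proof.
move=> /andP[t0 t1] a0 b0.
have /= := @convex_powR R p (ltW p_gt1) (Itv01 t0 t1) a b.
rewrite !inE/= !in_itv/= a0 b0 => /(_ isT isT).
by rewrite !convRE.
Qed.

Lemma sigma_convex (t : R) y z : 0 <= t <= 1 ->
  sigma (t *: y + (1 - t) *: z) <= t * sigma y + (1 - t) * sigma z.
Proof.
move=> t01; have /andP[t0 t1] := t01; have t1' : 0 <= 1 - t by rewrite subr_ge0.
have h : enorm (t *: y + (1 - t) *: z) <= t * enorm y + (1 - t) * enorm z.
  by apply: le_trans (ler_enormD _ _) _; rewrite !enormZ !ger0_norm.
have h2 := powR_convex t01 (enorm_ge0 y) (enorm_ge0 z).
have h3 := le_trans (powR_le (ltW p0) (enorm_ge0 _) h) h2.
rewrite /Defs.sigma.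
have := ler_wpM2l c0 h3; lra.
Qed.

(** The power is differentiable away from 0 only, hence the separate case of the
limit 0. *)
Lemma cvg_powR_pos (a : nat -> R) (l : R) : (forall n, 0 <= a n) -> 0 <= l ->
  a n @[n --> \oo] --> l -> a n `^ p @[n --> \oo] --> l `^ p.
Proof.
move=> a0; rewrite le_eqVlt => /orP[/eqP <-|l0] al.
  by rewrite powR0 ?gt_eqF//; exact: cvg0_powR.
have cl : {for l, continuous (fun x : R => x `^ p)}.
  apply: differentiable_continuous; apply/derivable1_diffP.
  by apply: derivable_powR; rewrite in_itv/= l0.
exact: (cvg_comp _ _ al cl).
Qed.

Lemma enorm_cvg (y : nat -> E) (z : E) :
  (forall i, y n ord0 i @[n --> \oo] --> z ord0 i) ->
  enorm (y n) @[n --> \oo] --> enorm z.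
Proof.
move=> yz; have h : dotv (y n) (y n) @[n --> \oo] --> dotv z z.
  apply: cvg_big => [|i _]; first by move=> r; apply: add_continuous.
  exact: (cvgM (yz i) (yz i)).
exact: (cvg_comp _ _ h (@sqrt_continuous R _)).
Qed.

Lemma sigma_cvg (y : nat -> E) (z : E) :
  (forall i, y n ord0 i @[n --> \oo] --> z ord0 i) ->
  sigma (y n) @[n --> \oo] --> sigma z.
Proof.
move=> yz; have h := enorm_cvg yz.
apply: cvgD => //; apply: cvgMr.
by apply: cvg_powR_pos => // [n|]; exact: enorm_ge0.
Qed.

Lemma sigma_le (y : E) (m : R) : enorm y <= m -> sigma y <= m + mu / p * m `^ p.
Proof.
move=> ym; apply: lerD => //; apply: ler_wpM2l => //.
by apply: powR_le; [exact: ltW|exact: enorm_ge0|].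
Qed.

Lemma measurable_sigma d' (T : measurableType d') (D : set T) (g : T -> E) :
  (forall i, measurable_fun D (fun x => g x ord0 i)) ->
  measurable_fun D (fun x => sigma (g x)).
Proof.
move=> mg; have me : measurable_fun D (fun x => enorm (g x)).
  apply: (measurableT_comp (continuous_measurable_fun (@sqrt_continuous R))).
  by apply: measurable_sum => i; exact: measurable_funM.
apply: measurable_funD => //; apply: measurable_funM => //.
exact: (measurableT_comp (measurable_powR p)).
Qed.

End Sigma.

(** * The increment of the energy and the functionals below it *)

Section Dual.
Context (R : realType) (d : nat) (p mu : R) (p_gt1 : 1 < p) (mu_gt0 : 0 < mu).
Local Notation E := 'rV[R]_d.
Local Notation lam := (@lebesgue_rV R d).
Local Notation sigma := (@sigma R d p mu).
Context (Omega : set E) (oO : open Omega) (bO : bounded_set Omega).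
Local Notation Lp := (Lp lam Omega).
Local Notation LpV := (LpV Omega).
Local Notation intg f := (lam.-integrable Omega (EFin \o f)).

Let mO : measurable Omega. Proof. exact: open_measurable_rV. Qed.
Let Ooo : (lam Omega < +oo)%E. Proof. exact: bounded_rV_finite. Qed.
Let p0 : 0 < p. Proof. exact: lt_trans p_gt1. Qed.

Lemma sigma_intg (g : E -> E) : LpV p g -> intg (fun x => sigma (g x)).
Proof.
move=> Lg; have Le := Lp_enorm mO p0 Lg; have i1 := Lp_intg mO Ooo (ltW p_gt1) Le.
have [_ i2] := Le.
have := rintegrableD mO i1 (rintegrableZ mO (mu / p) i2).
congr (lam.-integrable _ (EFin \o _)); apply/funext => x.
by rewrite /Defs.sigma ger0_norm// enorm_ge0.
Qed.

Context (W : E -> E) (LW : LpV p W).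

Definition sigma_incr (y : E -> E) : R :=
  \int[lam]_(x in Omega) (sigma (W x + y x) - sigma (W x)).

Lemma LpVD (g h : E -> E) : LpV p g -> LpV p h -> LpV p (fun x => g x + h x).
Proof.
move=> Lg Lh i; have := LpD mO p0 (Lg i) (Lh i).
by congr (Lp p _); apply/funext => x; rewrite mxE.
Qed.

Lemma sigma_incr_intg y : LpV p y -> intg (fun x => sigma (W x + y x) - sigma (W x)).
Proof. by move=> Ly; apply: rintegrableB => //; apply: sigma_intg => //; exact: LpVD. Qed.

Lemma sigma_incr0 : sigma_incr 0 = 0.
Proof.
rewrite /sigma_incr; under eq_Rintegral do rewrite addr0 subrr.
by rewrite /Rintegral integral0.
Qed.

Lemma sigma_incr_convex (t : R) (u v : E -> E) : 0 <= t <= 1 -> LpV p u -> LpV p v ->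
  sigma_incr (t *: u + (1 - t) *: v) <= t * sigma_incr u + (1 - t) * sigma_incr v.
Proof.
move=> t01 Lu Lv; have iu := sigma_incr_intg Lu; have iv := sigma_incr_intg Lv.
have Lw : LpV p (t *: u + (1 - t) *: v).
  apply: (LpVD (g := t *: u)).
    by move=> i; have := LpZ mO t (Lu i); congr (Lp p _); apply/funext => x; rewrite mxE.
  by move=> i; have := LpZ mO (1 - t) (Lv i); congr (Lp p _); apply/funext => x; rewrite mxE.
rewrite /sigma_incr -(RintegralZl t mO iu) -(RintegralZl (1 - t) mO iv).
rewrite -(RintegralD mO (rintegrableZ mO t iu) (rintegrableZ mO (1 - t) iv)).
apply: (le_Rintegral mO (sigma_incr_intg Lw)
  (rintegrableD mO (rintegrableZ mO t iu) (rintegrableZ mO (1 - t) iv))).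
move=> x _; have -> : W x + (t *: u + (1 - t) *: v) x =
    t *: (W x + u x) + (1 - t) *: (W x + v x).
  rewrite -[(t *: u + (1 - t) *: v) x]/(t *: u x + (1 - t) *: v x) !scalerDr addrACA.
  by rewrite -scalerDl subrKC scale1r.
have := sigma_convex p_gt1 mu_gt0 (W x + u x) (W x + v x) t01.
move: (sigma (t *: _ + _)) (sigma (W x)) (sigma (W x + u x)) (sigma (W x + v x)).
move=> a b c e H; rewrite (_ : t * (c - b) + _ = t * c + (1 - t) * e - b) ?lerD2r//; ring.
Qed.

(** Dominated convergence, the continuous function [sigma] being bounded along
[W + y n] by its growth at [enorm W + Y]. *)
Lemma sigma_incr_cvg (y : nat -> E -> E) (Y : E -> R) : (forall n, LpV p (y n)) -> Lp p Y ->
  (forall n x, Omega x -> enorm (y n x) <= Y x) ->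
  (forall x i, Omega x -> y n x ord0 i @[n --> \oo] --> 0) ->
  sigma_incr (y n) @[n --> \oo] --> 0.
Proof.
move=> Ly LY yY y0; pose Z x := enorm (W x) + `|Y x|.
have LZ : Lp p Z by apply: LpD => //; [exact: Lp_enorm|exact: Lp_abs].
have Z0 x : 0 <= Z x by rewrite addr_ge0// enorm_ge0.
have c0 : 0 <= mu / p by rewrite divr_ge0// ltW.
have iZ : intg (fun x => Z x + mu / p * Z x `^ p).
  have [_ i2] := LZ; have i1 := Lp_intg mO Ooo (ltW p_gt1) LZ.
  have := rintegrableD mO i1 (rintegrableZ mO (mu / p) i2).
  by congr (lam.-integrable _ (EFin \o _)); apply/funext => x; rewrite ger0_norm.
have leZ x v : Omega x -> enorm v <= Y x -> sigma (W x + v) <= Z x + mu / p * Z x `^ p.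
  move=> Ox vY; apply: sigma_le => //; apply: le_trans (ler_enormD _ _) _.
  by rewrite lerD2l (le_trans vY)// ler_norm.
have mWy n : measurable_fun Omega (fun x => sigma (W x + y n x)).
  by apply: measurable_sigma => i; have [] := LpVD LW (Ly n) i.
have mW : measurable_fun Omega (fun x => sigma (W x)).
  by apply: measurable_sigma => i; have [] := LW i.
have [|||||_ H] := @RintegralDCT _ _ _ lam Omega mO
  (fun n x => sigma (W x + y n x) - sigma (W x)) (fun=> 0)
  (fun x => (Z x + mu / p * Z x `^ p) + (Z x + mu / p * Z x `^ p)).
- by move=> n; exact: (measurable_funB (mWy n) mW).
- exact: measurable_cst.
- move=> x Ox; have h : sigma (W x + y n x) @[n --> \oo] --> sigma (W x).
    apply: sigma_cvg => // i.
    rewrite (_ : (fun n => _) = (fun n => W x ord0 i + y n x ord0 i)); last first.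
      by apply/funext => n; rewrite mxE.
    rewrite -[X in _ --> X]addr0; apply: cvgD; first exact: cvg_cst.
    exact: y0.
  have h2 : sigma (W x + y n x) - sigma (W x) @[n --> \oo] --> sigma (W x) - sigma (W x).
    by apply: cvgB; [exact: h|exact: cvg_cst].
  by rewrite subrr in h2.
- exact: rintegrableD.
- move=> n x Ox; apply: le_trans (ler_normB _ _) _.
  have nY : enorm (0 : E) <= Y x by rewrite enorm0 (le_trans _ (yY n x Ox))// enorm_ge0.
  have h1 := leZ _ _ Ox (yY n x Ox); have := leZ _ _ Ox nY; rewrite addr0 => h2.
  rewrite (ger0_norm (sigma_ge0 p_gt1 mu_gt0 _)) (ger0_norm (sigma_ge0 p_gt1 mu_gt0 _)).
  exact: (lerD h1 h2).
by move: H; rewrite [X in _ --> X](_ : _ = 0)// /Rintegral integral0.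
Qed.

Context (L : (E -> E) -> R).
Context (L_lin : forall (a : R) (u v : E -> E), LpV p u -> LpV p v ->
  L (a *: u + v) = a * L u + L v).
Context (L_le : forall y, LpV p y -> L y <= sigma_incr y).

Let LpV0 : LpV p 0.
Proof. by move=> i; have := Lp0 lam Omega p0; congr (Lp p _); apply/funext => x; rewrite mxE. Qed.

Let L0 : L 0 = 0.
Proof. have := L_lin 1 LpV0 LpV0; rewrite scale1r addr0; lra. Qed.

Let LZ a y : LpV p y -> L (a *: y) = a * L y.
Proof. by move=> Ly; have := L_lin a Ly LpV0; rewrite addr0 L0 addr0. Qed.

Let LD y z : LpV p y -> LpV p z -> L (y + z) = L y + L z.
Proof. by move=> Ly Lz; have := L_lin 1 Ly Lz; rewrite scale1r mul1r. Qed.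

Let LpVZ a y : LpV p y -> LpV p (a *: y).
Proof.
by move=> Ly i; have := LpZ mO a (Ly i); congr (Lp p _); apply/funext => x; rewrite mxE.
Qed.

Let LpV_sum (I : Type) (s : seq I) (y : I -> E -> E) : (forall i, LpV p (y i)) ->
  LpV p (\sum_(i <- s) y i).
Proof.
move=> Ly; elim: s => [|i s IH]; first by rewrite big_nil.
by rewrite big_cons; exact: LpVD.
Qed.

Let L_sum (I : Type) (s : seq I) (y : I -> E -> E) : (forall i, LpV p (y i)) ->
  L (\sum_(i <- s) y i) = \sum_(i <- s) L (y i).
Proof.
move=> Ly; elim: s => [|i s IH]; first by rewrite !big_nil.
by rewrite !big_cons LD//; [rewrite IH|exact: LpV_sum].
Qed.

(** [L] is squeezed between the increments in the directions [y n] and [- y n].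
This replaces continuity of [L] for the norm. *)
Lemma dual_cvg (y : nat -> E -> E) (Y : E -> R) : (forall n, LpV p (y n)) -> Lp p Y ->
  (forall n x, Omega x -> enorm (y n x) <= Y x) ->
  (forall x i, Omega x -> y n x ord0 i @[n --> \oo] --> 0) ->
  L (y n) @[n --> \oo] --> 0.
Proof.
move=> Ly LY yY y0.
have c1 := sigma_incr_cvg Ly LY yY y0.
have LNy n : LpV p (-1 *: y n) by exact: LpVZ.
have c2 : - sigma_incr (-1 *: y n) @[n --> \oo] --> (0 : R).
  rewrite -oppr0; apply: cvgN; apply: (sigma_incr_cvg LNy LY).
    move=> n x Ox; rewrite -[(-1 *: y n) x]/(-1 *: y n x) enormZ normrN1 mul1r.
    exact: yY.
  move=> x i Ox; rewrite (_ : (fun n => _) = (fun n => - y n x ord0 i)); last first.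
    by apply/funext => n; rewrite -[(-1 *: y n) x]/(-1 *: y n x) mxE mulN1r.
  by rewrite -[X in _ --> X]oppr0; apply: cvgN; exact: y0.
apply: (squeeze_cvgr _ c2 c1); apply: nearW => n; apply/andP; split; last exact: L_le.
by have := L_le (LNy n); rewrite LZ// mulN1r lerNl.
Qed.

Definition chi (A : set E) (z : E) (x : E) : E := \1_(A `&` Omega) x *: z.

Lemma chi_LpV A z : measurable A -> LpV p (chi A z).
Proof.
move=> mA i; apply: (@Lp_bounded _ _ _ _ _ mO Ooo p p0 _ (`|z ord0 i|)).
  rewrite (_ : (fun x => _) = (fun x => \1_(A `&` Omega) x * z ord0 i)).
    by apply: measurable_funM => //; apply: measurable_indic; exact: measurableI.
  by apply/funext => x; rewrite mxE.
move=> x _; rewrite mxE normrM ler_piMl//.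
by rewrite indicE; case: (_ \in _); rewrite ?normr1 ?normr0.
Qed.

(** The majorant sees no difference between 0 and [chi A z], nor [chi A (- z)]. *)
Lemma chi_null A z : measurable A -> lam A = 0%E -> L (chi A z) = 0.
Proof.
move=> mA A0; have H (w : E) : L (chi A w) <= 0.
  have Lc := chi_LpV w mA; apply: (le_trans (L_le Lc)).
  rewrite le_eqVlt; apply/orP; left; apply/eqP.
  transitivity (\int[lam]_(x in Omega) (0 : R)); last by rewrite /Rintegral integral0.
  apply: ae_eq_Rintegral => //.
    exact: integrable_measurable (sigma_incr_intg Lc).
  exists A; split=> // x /= h; apply: contrapT => nA; apply: h => Ox.
  by rewrite /chi indicE memNset ?scale0r ?addr0 ?subrr// => -[].
apply/eqP; rewrite eq_le H/=.
have := H (- z); have -> : chi A (- z) = -1 *: chi A z.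
  by apply/funext => x; rewrite /chi scalerN -scaleN1r.
by rewrite LZ; [lra|exact: chi_LpV].
Qed.

Section density.
Context (i : 'I_d).
Local Notation e_ := (delta_mx ord0 i : E).

Definition indic_charge (A : set E) : \bar R := (L (chi A e_))%:E.

Let nu0 : indic_charge set0 = 0%E.
Proof. by rewrite /indic_charge chi_null. Qed.

Let nu_fin A : measurable A -> indic_charge A \is a fin_num.
Proof. by []. Qed.

Lemma chiU A B z : A `&` B = set0 -> chi (A `|` B) z = chi A z + chi B z.
Proof.
move=> AB0; apply/funext => x; rewrite -[RHS]/(chi A z x + chi B z x) /chi -scalerDl.
congr (_ *: _); rewrite !indicE.
have [Ox|nO] := pselect (Omega x); last first.
  by rewrite !memNset ?addr0// => -[].
have [Ax|nA] := pselect (A x); have [Bx|nB] := pselect (B x).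
- by have : (A `&` B) x by []; rewrite AB0.
- rewrite (mem_set (_ : ((A `|` B) `&` Omega) x)); last by split=> //; left.
  by rewrite (mem_set (_ : (A `&` Omega) x))// memNset ?addr0// => -[].
- rewrite (mem_set (_ : ((A `|` B) `&` Omega) x)); last by split=> //; right.
  by rewrite (mem_set (_ : (B `&` Omega) x))// memNset ?add0r// => -[].
- by rewrite !memNset ?addr0// => -[] // [].
Qed.

Lemma L_chiU A B z : measurable A -> measurable B -> A `&` B = set0 ->
  L (chi (A `|` B) z) = L (chi A z) + L (chi B z).
Proof. by move=> mA mB AB; rewrite chiU// LD//; exact: chi_LpV. Qed.

Let nu_sigma : semi_sigma_additive indic_charge.
Proof.
move=> F mF tF mU.
have part n : (\sum_(0 <= k < n) indic_charge (F k))%E =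
  (L (chi (\big[setU/set0]_(k < n) F k) e_))%:E.
  elim: n => [|n IH]; first by rewrite big_geq// big_ord0 chi_null.
  rewrite big_nat_recr//= IH big_ord_recr/= L_chiU ?EFinD//.
    exact: bigsetU_measurable.
  by apply: (@trivIset_bigsetUI _ predT) => //; rewrite /predT /= trueE.
(* the tail fields are bounded and tend to 0 pointwise, so [dual_cvg] gives
   countable additivity *)
pose y n := chi (~` (\big[setU/set0]_(k < n) F k) `&` \bigcup_k F k) e_.
have my n : measurable (~` (\big[setU/set0]_(k < n) F k) `&` \bigcup_k F k).
  by apply: measurableI => //; apply: measurableC; exact: bigsetU_measurable.
have yE n : L (chi (\big[setU/set0]_(k < n) F k) e_) = L (chi (\bigcup_k F k) e_) - L (y n).
  apply/eqP; rewrite eq_sym subr_eq; apply/eqP; rewrite /y -L_chiU//.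
  - congr (L (chi _ _)); rewrite setUIr setUv setTI.
    apply/esym/setUidPr; rewrite -bigcup_mkord; exact: bigcup_subset.
  - exact: bigsetU_measurable.
  - by rewrite setIA setICr set0I.
under eq_fun do rewrite part yE.
rewrite /indic_charge; apply: cvg_EFin; first exact: nearW.
rewrite -[X in _ --> X]subr0; apply: cvgB; first exact: cvg_cst.
apply: (@dual_cvg y (fun=> enorm e_)).
- by move=> n; exact: chi_LpV.
- apply: (@Lp_bounded _ _ _ _ _ mO Ooo p p0 _ `|enorm e_|) => //.
- move=> n x Ox; rewrite /y /chi enormZ ler_piMl ?enorm_ge0//.
  by rewrite indicE; case: (_ \in _); rewrite ?normr1 ?normr0.
- move=> x j Ox; have [[k _ Fkx]|nF] := pselect ((\bigcup_k F k) x).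
    apply: cvg_near_cst; exists k.+1 => // n /= kn.
    rewrite /y /chi indicE memNset ?scale0r ?mxE// => -[[+ _] _].
    by apply; rewrite -bigcup_mkord; exists k.
  apply: cvg_near_cst; apply: nearW => n.
  by rewrite /y /chi indicE memNset ?scale0r ?mxE// => -[[_ +] _].
Qed.

HB.instance Definition _ := isCharge.Build _ _ _ indic_charge nu0 nu_fin nu_sigma.

Lemma indic_charge_density : exists g : E -> R, lam.-integrable setT (EFin \o g) /\
  forall A, measurable A -> L (chi A e_) = \int[lam]_(x in A) g x.
Proof.
have dom : indic_charge `<< lam.
  by apply/null_content_dominatesP => A mA A0; rewrite /indic_charge chi_null.
pose G := Radon_Nikodym indic_charge lam.
have GE : EFin \o (fine \o G) = G.
  by apply/funext => x; rewrite /= fineK//; exact: Radon_Nikodym_fin_num.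
exists (fine \o G); split; first by rewrite GE; exact: Radon_Nikodym_integrable.
move=> A mA; rewrite /Rintegral.
have -> : (\int[lam]_(x in A) (((fine \o G) x)%:E) = \int[lam]_(x in A) G x)%E.
  by apply: eq_integral => x _; rewrite -[in RHS]GE.
by rewrite -(Radon_Nikodym_integral dom mA).
Qed.

End density.
End Dual.

(** * Representation of the dominated functionals *)

Import HBNNSimple.

Section DualRepresentation.
Context (R : realType) (d : nat) (p mu : R) (p_gt1 : 1 < p) (mu_gt0 : 0 < mu).
Local Notation E := 'rV[R]_d.
Local Notation lam := (@lebesgue_rV R d).
Local Notation sigma := (@sigma R d p mu).
Context (Omega : set E) (oO : open Omega) (bO : bounded_set Omega).
Local Notation Lp := (Lp lam Omega).
Local Notation LpV := (LpV Omega).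
Local Notation intg f := (lam.-integrable Omega (EFin \o f)).

Let mO : measurable Omega. Proof. exact: open_measurable_rV. Qed.
Let Ooo : (lam Omega < +oo)%E. Proof. exact: bounded_rV_finite. Qed.
Let p0 : 0 < p. Proof. exact: lt_trans p_gt1. Qed.

Lemma ae_le_of_integral (f : E -> R) : intg f ->
  (forall A, measurable A -> A `<=` Omega -> \int[lam]_(x in A) f x <= 0) ->
  {ae lam, forall x, Omega x -> f x <= 0}.
Proof.
move=> fi fA; have mf := integrable_measurable fi.
pose A := Omega `&` f @^-1` `]0, +oo[%classic.
have mA : measurable A by exact: mf mO _ (measurable_itv _).
have AO : A `<=` Omega by move=> x [].
have fpos x : A x -> 0 < f x by move=> [_]; rewrite /= in_itv/= andbT.
have iA : lam.-integrable A (EFin \o f) by exact: (integrableS mO mA AO fi).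
have I0 : (\int[lam]_(x in A) `|(EFin \o f) x| = 0)%E.
  transitivity (\int[lam]_(x in A) (f x)%:E)%E.
    by apply: eq_integral => x /[!inE] Ax; rewrite /= ger0_norm// ltW// fpos.
  rewrite -(EFin_Rintegral mA iA); congr EFin; apply/eqP; rewrite eq_le fA//=.
  by apply: Rintegral_ge0 => x Ax; rewrite ltW// fpos.
have mfA : measurable_fun A (EFin \o f) by case/integrableP: iA.
have := (ae_eq_integral_abs lam mA mfA).1 I0.
apply: filterS => x h Ox; rewrite leNgt; apply/negP => fx0.
have Ax : A x by split=> //; rewrite /= in_itv/= andbT.
by have /= := h Ax; move=> [] fx; move: fx0; rewrite fx ltxx.
Qed.

Lemma rat_approx (z : E) : exists q : nat -> 'rV[rat]_d,
  forall i, ratr (q n ord0 i) @[n --> \oo] --> z ord0 i.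
Proof.
have H n i : {r : rat | `|z ord0 i - ratr r| < n.+1%:R^-1}.
  apply: cid; have n0 : 0 < n.+1%:R^-1 :> R by rewrite invr_gt0.
  have /rat_in_itvoo [r] : z ord0 i - n.+1%:R^-1 < z ord0 i + n.+1%:R^-1.
    by rewrite ltrD2l gtrN.
  by rewrite in_itv/= => h; exists r; rewrite distrC ltr_distl.
exists (fun n => \row_i sval (H n i)) => i; apply/cvgrPdist_lt => e e0.
have := near_infty_natSinv_lt (PosNum e0); apply: filterS => n /= ne.
by rewrite mxE (lt_trans _ ne)//; exact: (svalP (H n i)).
Qed.

Context (W : E -> E) (LW : LpV p W).
Context (L : (E -> E) -> R).
Context (L_lin : forall (a : R) (u v : E -> E), LpV p u -> LpV p v ->
  L (a *: u + v) = a * L u + L v).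
Context (L_le : forall y, LpV p y -> L y <= sigma_incr p mu Omega W y).

Section with_density.
Context (g : E -> E).
Context (g_int : forall i, lam.-integrable setT (EFin \o (fun x => g x ord0 i))).
Context (g_nu : forall i A, measurable A ->
  L (chi Omega A (delta_mx ord0 i)) = \int[lam]_(x in A) g x ord0 i).

Let giS A i : measurable A -> lam.-integrable A (EFin \o (fun x => g x ord0 i)).
Proof. by move=> mA; exact: (integrableS measurableT mA (@subsetT _ A) (g_int i)). Qed.

Let dotg_int A z : measurable A -> lam.-integrable A (EFin \o (fun x => dotv (g x) z)).
Proof.
move=> mA; apply: rintegrable_sum => // i.
have := rintegrableZ mA (z ord0 i) (giS i mA).
by congr (lam.-integrable _ (EFin \o _)); apply/funext => x; rewrite mulrC.
Qed.

Let L0 : L 0 = 0.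
Proof.
have h : LpV p 0.
  by move=> i; have := Lp0 lam Omega p0; congr (Lp p _); apply/funext => x; rewrite mxE.
by have := L_lin 1 h h; rewrite scale1r addr0; lra.
Qed.

Let L_sum (I : Type) (s : seq I) (a : I -> R) (y : I -> E -> E) : (forall i, LpV p (y i)) ->
  LpV p (\sum_(i <- s) a i *: y i) /\
  L (\sum_(i <- s) a i *: y i) = \sum_(i <- s) a i * L (y i).
Proof.
move=> Ly; elim: s => [|i s [IH1 IH2]].
  rewrite !big_nil L0; split=> // i.
  by have := Lp0 lam Omega p0; congr (Lp p _); apply/funext => x; rewrite mxE.
rewrite !big_cons L_lin// IH2; split=> //.
by have := LpV_lin oO (a i) p0 (Ly i) IH1.
Qed.

Lemma L_chi A z : measurable A -> L (chi Omega A z) = \int[lam]_(x in A) dotv (g x) z.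
Proof.
move=> mA.
have -> : chi Omega A z = \sum_(i < d) z ord0 i *: chi Omega A (delta_mx ord0 i).
  apply/funext => x; apply/rowP => j; rewrite fct_sumE summxE (bigD1 j)//= big1 ?addr0.
    by rewrite /chi !mxE !eqxx mulr1 mulrC.
  by move=> i ij; rewrite /chi !mxE (eq_sym j) (negbTE ij) andbF !mulr0.
have Lc i : LpV p (chi Omega A (delta_mx ord0 i)) by exact: (chi_LpV p_gt1 oO bO).
have [_ ->] := L_sum (index_enum 'I_d) (fun i => z ord0 i) Lc.
rewrite /dotv Rintegral_sum//.
  apply: eq_bigr => i _; rewrite g_nu// -RintegralZl//; last exact: giS.
  by apply: eq_Rintegral => x _; rewrite mulrC.
move=> i; have := rintegrableZ mA (z ord0 i) (giS i mA).
by congr (lam.-integrable _ (EFin \o _)); apply/funext => x; rewrite mulrC.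
Qed.

Lemma LpV_cst (z : E) : LpV p (fun=> z).
Proof. by move=> i; apply: (@Lp_bounded _ _ _ _ _ mO Ooo p p0 _ `|z ord0 i|). Qed.

(** For a Borel subset [A] of [Omega], comparing [L] with its majorant on the
indicator of [A] times [z] is comparing the integrals over [A] of both sides. *)
Lemma pointwise_subgradient (z : E) :
  {ae lam, forall x, Omega x -> dotv (g x) z + sigma (W x) <= sigma (W x + z)}.
Proof.
have iz := sigma_incr_intg mu p_gt1 oO bO LW (LpV_cst z).
have ig := dotg_int z mO.
have := @ae_le_of_integral (fun x => dotv (g x) z - (sigma (W x + z) - sigma (W x)))
  (rintegrableB mO ig iz).
have H : forall A, measurable A -> A `<=` Omega ->
    \int[lam]_(x in A) (dotv (g x) z - (sigma (W x + z) - sigma (W x))) <= 0.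
  move=> A mA AO; have izA := integrableS mO mA AO iz.
  rewrite (RintegralB mA (dotg_int z mA) izA) subr_le0 -L_chi//.
  apply: le_trans (L_le (chi_LpV p_gt1 oO bO z mA)) _.
  rewrite le_eqVlt; apply/orP; left; apply/eqP; rewrite /sigma_incr.
  rewrite [LHS]Rintegral_mkcond [RHS]Rintegral_mkcond; apply: eq_Rintegral => x _.
  have [Ax|nA] := pselect (A x).
    have Ox := AO x Ax; rewrite !patchE (mem_set Ax) (mem_set Ox) /chi indicE.
    have AOx : (A `&` Omega) x by split.
    by rewrite (mem_set AOx) scale1r.
  rewrite [RHS]patchE (memNset nA) patchE; case: (x \in Omega) => //.
  by rewrite /chi indicE memNset ?scale0r ?addr0 ?subrr// => -[].
move=> /(_ H); apply: filterS => x h Ox; have := h Ox.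
by rewrite subr_le0 lerBrDr.
Qed.

(** The exceptional null set may depend on [z], so only rational vectors are used
and the others are reached by continuity of [sigma]. *)
Lemma ae_subgradient :
  {ae lam, forall x, Omega x -> subdiff_sigma p mu (W x) (g x)}.
Proof.
pose q n : 'rV[rat]_d := odflt 0 (unpickle n).
have : {ae lam, forall x, forall n, Omega x ->
   dotv (g x) (map_mx ratr (q n)) + sigma (W x) <= sigma (W x + map_mx ratr (q n))}.
  by apply/ae_foralln => n; exact: pointwise_subgradient.
apply: filterS => x h Ox z.
have [r rz] := rat_approx z.
have rz' i : (map_mx ratr (r n) : E) ord0 i @[n --> \oo] --> z ord0 i.
  rewrite (_ : (fun n => _) = (fun n => ratr (r n ord0 i))); first exact: rz.
  by apply/funext => n; rewrite mxE.
have c1 : dotv (g x) (map_mx ratr (r n)) + sigma (W x) @[n --> \oo] -->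
    dotv (g x) z + sigma (W x).
  apply: cvgD; last exact: cvg_cst.
  apply: cvg_big => [|i _]; first by move=> s; apply: add_continuous.
  by apply: cvgMr; exact: rz'.
have c2 : sigma (W x + map_mx ratr (r n)) @[n --> \oo] --> sigma (W x + z).
  apply: sigma_cvg => // i.
  rewrite (_ : (fun n => _) = (fun n => W x ord0 i + (map_mx ratr (r n) : E) ord0 i)).
    by rewrite mxE; apply: cvgD; [exact: cvg_cst|exact: rz'].
  by apply/funext => n; rewrite mxE.
rewrite -(cvg_lim _ c1)// -(cvg_lim _ c2)//; apply: ler_lim.
- by apply/cvg_ex; eexists; exact: c1.
- by apply/cvg_ex; eexists; exact: c2.
apply: nearW => n; have := h (pickle (r n)) Ox.
by rewrite /q pickleK.
Qed.

(** A slope is at most the increment of [sigma] over a step, divided by its length;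
a step of length [1 + enorm w] keeps the point within twice that length, and thus
the quotient of the order of the power [p - 1] of it. *)
Lemma subgradient_growth (w y : E) i : subdiff_sigma p mu w y ->
  `|y ord0 i| <= (1 + mu / p) * 2 `^ p * (1 + enorm w) `^ (p - 1).
Proof.
move=> wy; set t := 1 + enorm w.
have t1 : 1 <= t by rewrite lerDl enorm_ge0.
have t0 : 0 < t by exact: lt_le_trans t1.
have c0 : 0 <= mu / p by rewrite divr_ge0// ltW.
have edelta (s : R) : `|s| = t -> sigma (w + s *: delta_mx ord0 i) <= (1 + mu / p) * (2 * t) `^ p.
  move=> st; have h : enorm (w + s *: delta_mx ord0 i) <= 2 * t.
    apply: le_trans (ler_enormD _ _) _; rewrite enormZ st enorm_delta.
    by rewrite mulr1 mulrDl mul1r lerD2r lerDr.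
  apply: le_trans (sigma_le p_gt1 mu_gt0 h) _; rewrite [leRHS]mulrDl mul1r lerD2r.
  by rewrite le1r_powR//; [lra|exact: ltW].
have key (s : R) : `|s| = t -> y ord0 i * s <= (1 + mu / p) * (2 * t) `^ p.
  move=> st; apply: le_trans (edelta s st).
  have := wy (s *: delta_mx ord0 i).
  have -> : dotv y (s *: delta_mx ord0 i) = y ord0 i * s.
    rewrite /dotv (bigD1 i)//= big1 ?addr0; last first.
      by move=> j ji; rewrite !mxE (negbTE ji) !mulr0.
    by rewrite !mxE !eqxx mulr1.
  by apply: le_trans; rewrite lerDl; exact: sigma_ge0.
have H : `|y ord0 i| * t <= (1 + mu / p) * (2 * t) `^ p.
  have [y0|/ltW y0] := leP 0 (y ord0 i).
    by rewrite ger0_norm// key// gtr0_norm.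
  by rewrite ler0_norm// mulNr -mulrN key// normrN gtr0_norm.
rewrite -(ler_pM2r t0) (le_trans H)// powRM//; last exact: ltW.
rewrite -[leRHS]mulrA [_ `^ _ * t]mulrC mulr_powRB1//; last exact: ltW.
by rewrite mulrA.
Qed.

(** [p / (p - 1)] is the exponent for which the bound of [subgradient_growth]
becomes a [p]-th power. *)
Lemma density_LpV : LpV (p / (p - 1)) g.
Proof.
have p10 : 0 < p - 1 by rewrite subr_gt0.
have q0 : 0 < p / (p - 1) by rewrite divr_gt0.
move=> i; set K := (1 + mu / p) * 2 `^ p.
have K0 : 0 <= K by rewrite mulr_ge0 ?powR_ge0// addr_ge0// divr_ge0// ltW.
pose h x := K * (1 + enorm (W x)) `^ (p - 1).
have h0 x : 0 <= h x by rewrite mulr_ge0// powR_ge0.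
have Lt : Lp p (fun x => 1 + enorm (W x)).
  apply: (LpD mO p0); last exact: Lp_enorm.
  by apply: (@Lp_bounded _ _ _ _ _ mO Ooo p p0 _ 1) => // x _; rewrite normr1.
have [mt it] := Lt.
have Lh : Lp (p / (p - 1)) h.
  split.
    apply: measurable_funM => //; exact: (measurableT_comp (measurable_powR _) mt).
  have := rintegrableZ mO (K `^ (p / (p - 1))) it.
  congr (lam.-integrable _ (EFin \o _)); apply/funext => x.
  have e0 : 0 <= 1 + enorm (W x) by rewrite addr_ge0// enorm_ge0.
  rewrite (ger0_norm (h0 x)) (ger0_norm e0) /h powRM ?powR_ge0// -powRrM.
  by rewrite mulrCA mulfV ?mulr1// gt_eqF.
have mg : measurable_fun Omega (fun x => g x ord0 i).
  exact: integrable_measurable (giS i mO).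
(* the bound holds almost everywhere; truncating at [h] makes it hold everywhere *)
pose m x := Num.min `|g x ord0 i| (h x).
have mm : measurable_fun Omega m.
  by apply: measurable_minr; [exact: measurableT_comp|case: Lh].
have Lm : Lp (p / (p - 1)) m.
  apply: (Lp_le mO q0 mm _ Lh) => x _.
  by rewrite !ger0_norm// ?le_min ?normr_ge0 ?h0// ge_min lexx orbT.
have Lg : Lp (p / (p - 1)) (fun x => `|g x ord0 i|).
  apply: (Lp_ae_eq mO _ _ Lm); first exact: measurableT_comp.
  apply: filterS ae_subgradient => x sub Ox; apply/min_idPl.
  exact: subgradient_growth (sub Ox).
by apply: (Lp_le mO q0 mg _ Lg) => x _; rewrite normr_id.
Qed.

(** The components of a field are treated one at a time. *)
Definition along (i : 'I_d) (u : E -> R) (x : E) : E := u x *: delta_mx ord0 i.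

Let along_LpV i u : Lp p u -> LpV p (along i u).
Proof.
move=> Lu j; have := LpZ mO ((delta_mx ord0 i : E) ord0 j) Lu.
by congr (Lp p _); apply/funext => x; rewrite !mxE mulrC.
Qed.

Let enorm_along i u x : enorm (along i u x) = `|u x|.
Proof. by rewrite /along enormZ enorm_delta mulr1. Qed.

Let gu_int i u : Lp p u -> intg (fun x => u x * g x ord0 i).
Proof.
move=> Lu; have p10 : 0 < p - 1 by rewrite subr_gt0.
apply: (Lp_mul mO p0 (divr_gt0 p0 p10) _ Lu (density_LpV i)).
by field; rewrite !gt_eqF.
Qed.

Let L_alongB i u v : Lp p u -> Lp p v ->
  L (along i (fun x => u x - v x)) = L (along i u) - L (along i v).
Proof.
move=> Lu Lv; have -> : along i (fun x => u x - v x) = (-1) *: along i v + along i u.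
  apply/funext => x; rewrite -[RHS]/(-1 *: along i v x + along i u x).
  by rewrite scaleN1r /along scalerBl addrC.
rewrite (L_lin _ (along_LpV i Lv) (along_LpV i Lu)).
by rewrite mulN1r addrC.
Qed.

Let absg i : intg (fun x => `|g x ord0 i|).
Proof. exact: rintegrable_abs (giS i mO). Qed.

Lemma L_along_nnsfun i (h : {nnsfun E >-> R}) :
  L (along i (fun x => h x * \1_Omega x)) = \int[lam]_(x in Omega) (h x * g x ord0 i).
Proof.
pose s := finmap.enum_fset (fset_set (range h)).
have hE x : h x = \sum_(r <- s) r * \1_(h @^-1` [set r]) x.
  by rewrite fimfunE fsbig_finite//; exact: fimfunP.
have mr r : measurable (h @^-1` [set r]) by exact: measurable_sfunP.
have Lc r : LpV p (chi Omega (h @^-1` [set r]) (delta_mx ord0 i)).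
  exact: (chi_LpV p_gt1 oO bO).
have -> : along i (fun x => h x * \1_Omega x) =
    \sum_(r <- s) r *: chi Omega (h @^-1` [set r]) (delta_mx ord0 i).
  apply/funext => x; rewrite /along hE fct_sumE mulr_suml scaler_suml.
  apply: eq_bigr => r _.
  rewrite -[RHS]/(r *: (\1_(h @^-1` [set r] `&` Omega) x *: delta_mx ord0 i)).
  by rewrite scalerA indicI /= mulrA.
have [_ ->] := L_sum s id Lc.
have i1 r : intg (fun x => \1_(h @^-1` [set r]) x * g x ord0 i).
  apply: (le_rintegrable mO _ _ (absg i)).
    apply: measurable_funM; first exact: measurable_indic.
    exact: integrable_measurable (giS i mO).
  move=> x _; rewrite normrM ler_piMl//.
  by rewrite indicE; case: (_ \in _); rewrite ?normr1 ?normr0.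
have ig r : intg (fun x => r * (\1_(h @^-1` [set r]) x * g x ord0 i)).
  exact: (rintegrableZ mO r (i1 r)).
transitivity (\int[lam]_(x in Omega) (\sum_(r <- s) r * (\1_(h @^-1` [set r]) x * g x ord0 i))).
  rewrite Rintegral_sum//; apply: eq_bigr => r _.
  have -> : chi Omega (h @^-1` [set r]) (delta_mx ord0 i) =
      chi Omega (h @^-1` [set r] `&` Omega) (delta_mx ord0 i).
    by apply/funext => x; rewrite /chi -setIA setIid.
  have mrO : measurable (h @^-1` [set r] `&` Omega) by exact: measurableI.
  rewrite (g_nu i mrO) (RintegralZl r mO (i1 r)); congr (_ * _).
  rewrite [LHS]Rintegral_mkcond [RHS]Rintegral_mkcond; apply: eq_Rintegral => x _.
  rewrite !patchE indicE in_setI; case: (x \in Omega); rewrite ?andbF ?andbT//.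
  by case: (_ \in _); rewrite ?mul1r ?mul0r.
by apply: eq_Rintegral => x _; rewrite [in RHS]hE mulr_suml; apply: eq_bigr => r _; rewrite mulrA.
Qed.

(** [u] is an increasing limit of simple functions: [dual_cvg] handles the left
side, dominated convergence the right side. *)
Lemma L_along_ge0 i (u : E -> R) : Lp p u -> (forall x, 0 <= u x) ->
  L (along i u) = \int[lam]_(x in Omega) (u x * g x ord0 i).
Proof.
move=> Lu u0; have [mu' _] := Lu.
have mE : measurable_fun Omega (EFin \o u) by exact/measurable_EFinP.
pose h n := nnsfun_approx mO mE n.
have u0E x : Omega x -> (0 <= (EFin \o u) x)%E by move=> _; rewrite lee_fin.
have hc x : Omega x -> h n x @[n --> \oo] --> u x.
  move=> Ox; have := cvg_nnsfun_approx mO mE u0E Ox.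
  by move=> /fine_cvg.
have hu n x : Omega x -> h n x <= u x.
  move=> Ox; have nd : nondecreasing_seq (fun n => h n x).
    by move=> m k mk; have /lefP/(_ x) := nd_nnsfun_approx mO mE mk.
  rewrite -(cvg_lim _ (hc x Ox))//; apply: nondecreasing_cvgn_le nd _ _.
  by apply/cvg_ex; eexists; exact: (hc x Ox).
have Lh n : Lp p (fun x => h n x * \1_Omega x).
  apply: (Lp_le mO p0 _ _ Lu).
    by apply: measurable_funM => //; apply: measurable_funTS => //; exact: measurable_indic.
  move=> x Ox; rewrite indicE mem_set// mulr1 !ger0_norm//; exact: hu.
have c1 : L (along i (fun x => u x - h n x * \1_Omega x)) @[n --> \oo] --> 0.
  apply: (dual_cvg p_gt1 mu_gt0 oO bO LW L_lin L_le _ Lu).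
  - by move=> n; exact: along_LpV (LpB mO p0 Lu (Lh n)).
  - move=> n x Ox; rewrite enorm_along indicE mem_set// mulr1.
    rewrite (ger0_norm (_ : 0 <= u x - h n x)) ?subr_ge0; last exact: hu.
    by rewrite lerBlDr lerDl fun_ge0.
  - move=> x j Ox.
    have : (u x - h n x) * (delta_mx ord0 i : E) ord0 j @[n --> \oo] -->
        (u x - u x) * (delta_mx ord0 i : E) ord0 j.
      by apply: cvgMl; apply: cvgB; [exact: cvg_cst|exact: hc].
    rewrite subrr mul0r => H.
    rewrite (_ : (fun n => _) = (fun n => (u x - h n x) * (delta_mx ord0 i : E) ord0 j))//.
    by apply/funext => n; rewrite /along mxE indicE mem_set// mulr1.
have gi := gu_int i Lu.
have mg : measurable_fun Omega (fun x => g x ord0 i).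
  exact: integrable_measurable (giS i mO).
have iabs : intg (fun x => `|u x * g x ord0 i|) by exact: rintegrable_abs gi.
have [|||||_ c2] := @RintegralDCT _ _ _ lam Omega mO (fun n x => h n x * g x ord0 i)
  (fun x => u x * g x ord0 i) (fun x => `|u x * g x ord0 i|).
- by move=> n; apply: measurable_funM mg; exact: measurable_funTS.
- exact: measurable_funM mu' mg.
- by move=> x Ox; apply: cvgMl; exact: hc.
- exact: iabs.
- by move=> n x Ox; rewrite !normrM ler_wpM2r// !ger0_norm//; exact: hu.
have c3 : L (along i u) - \int[lam]_(x in Omega) (h n x * g x ord0 i) @[n --> \oo] --> (0 : R).
  rewrite (_ : (fun n => _) = (fun n => L (along i (fun x => u x - h n x * \1_Omega x))))//.
  by apply/funext => n; rewrite (L_alongB i Lu (Lh n)) L_along_nnsfun.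
have c4 : L (along i u) - \int[lam]_(x in Omega) (h n x * g x ord0 i) @[n --> \oo] -->
    L (along i u) - \int[lam]_(x in Omega) (u x * g x ord0 i).
  by apply: cvgB; [exact: cvg_cst|exact: c2].
apply/eqP; rewrite -subr_eq0; apply/eqP; apply: (cvg_unique _ c4) => //.
Qed.

Lemma L_dotv y : LpV p y -> L y = \int[lam]_(x in Omega) dotv (y x) (g x).
Proof.
move=> Ly.
have La i u : Lp p u -> L (along i u) = \int[lam]_(x in Omega) (u x * g x ord0 i).
  move=> Lu; have [mu' _] := Lu.
  have Lpos : Lp p (fun x => Num.max (u x) 0).
    apply: (Lp_le mO p0 _ _ Lu) => [|x _]; first exact: measurable_maxr.
    by case: (leP (u x) 0) => ux; rewrite ?normr0.
  have Lneg : Lp p (fun x => Num.max (- u x) 0).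
    apply: (Lp_le mO p0 _ _ Lu) => [|x _].
      by apply: measurable_maxr => //; exact: measurableT_comp.
    by case: (leP (- u x) 0) => ux; rewrite ?normr0// normrN.
  have uE x : u x = Num.max (u x) 0 - Num.max (- u x) 0.
    case: (leP (u x) 0) => ux.
      by rewrite max_l ?oppr_ge0// sub0r opprK.
    by rewrite max_r ?subr0// oppr_le0 ltW.
  have -> : along i u = along i (fun x => Num.max (u x) 0 - Num.max (- u x) 0).
    by apply/funext => x; rewrite /along -uE.
  have pos (v : E -> R) (x : E) : 0 <= Num.max (v x) 0 by rewrite le_max lexx orbT.
  rewrite (L_alongB i Lpos Lneg) (L_along_ge0 i Lpos (pos u)).
  rewrite (L_along_ge0 i Lneg (pos (fun x : E => - u x))).
  rewrite -(RintegralB mO (gu_int i Lpos) (gu_int i Lneg)).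
  by apply: eq_Rintegral => x _; rewrite -mulrBl -uE.
have -> : y = \sum_(i < d) 1 *: along i (fun x => y x ord0 i).
  apply/funext => x; rewrite fct_sumE; apply/rowP => j.
  rewrite summxE (bigD1 j)//= big1 ?addr0 ?scale1r.
    by rewrite /along mxE mxE !eqxx mulr1.
  by move=> k kj; rewrite scale1r /along !mxE (eq_sym j) (negbTE kj) andbF mulr0.
have Lai i : LpV p (along i (fun x => y x ord0 i)) by exact: along_LpV (Ly i).
have [_ ->] := L_sum (index_enum 'I_d) (fun=> 1) Lai.
transitivity (\int[lam]_(x in Omega) \sum_(i < d) (y x ord0 i * g x ord0 i)).
  rewrite Rintegral_sum//; last by move=> i; exact: gu_int (Ly i).
  by apply: eq_bigr => i _; rewrite mul1r La.
apply: eq_Rintegral => x _; apply: eq_bigr => i _; congr (_ * _).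
rewrite fct_sumE summxE (bigD1 i)//= big1 ?addr0 ?scale1r.
  by rewrite /along mxE mxE !eqxx mulr1.
by move=> k ki; rewrite scale1r /along !mxE (eq_sym i) (negbTE ki) andbF mulr0.
Qed.

End with_density.

Lemma dual_representation : exists g : E -> E,
  [/\ LpV (p / (p - 1)) g,
      {ae lam, forall x, Omega x -> subdiff_sigma p mu (W x) (g x)} &
      forall y, LpV p y -> L y = \int[lam]_(x in Omega) dotv (y x) (g x)].
Proof.
have nu_d i := indic_charge_density p_gt1 mu_gt0 oO bO LW L_lin L_le i.
pose gi i := sval (cid (nu_d i)).
pose g (x : E) : E := \row_i gi i x.
have gE i : (fun x => g x ord0 i) = gi i by apply/funext => x; rewrite mxE.
have g_int i : lam.-integrable setT (EFin \o (fun x => g x ord0 i)).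
  by rewrite gE; have [] := svalP (cid (nu_d i)).
have g_nu i A : measurable A -> L (chi Omega A (delta_mx ord0 i)) = \int[lam]_(x in A) g x ord0 i.
  by move=> mA; rewrite gE; have [_] := svalP (cid (nu_d i)); apply.
exists g; split; [exact: density_LpV|exact: ae_subgradient|exact: L_dotv].
Qed.

End DualRepresentation.

(** * Distributions with a Sobolev representative *)

Section Distributions.
Context (R : realType) (d : nat) (d_gt0 : (0 < d)%N).
Local Notation E := 'rV[R]_d.
Local Notation lam := (@lebesgue_rV R d).
Context (p : R) (p_gt1 : 1 < p).
Context (Omega : set E) (oO : open Omega) (bO : bounded_set Omega).
Local Notation Lp := (Lp lam Omega).
Local Notation LpV := (LpV Omega).
Local Notation L2norm := (L2norm lam Omega).
Local Notation test := (test_fun Omega).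
Local Notation N := (normH10 Omega).
Local Notation H := (H10 Omega -> R).

Let mO : measurable Omega. Proof. exact: open_measurable_rV. Qed.
Let Ooo : (lam Omega < +oo)%E. Proof. exact: bounded_rV_finite. Qed.
Let p0 : 0 < p. Proof. exact: lt_trans p_gt1. Qed.
Let p2 : 0 < 2 :> R. Proof. by []. Qed.
Let dirS := dirichlet_semi_inner oO bO.

Lemma W01_mul_test_intg u phi : W01 Omega p u -> test phi ->
  lam.-integrable Omega (EFin \o (fun x => u x * phi x)).
Proof.
move=> Wu tp; apply: (loc_integrable_test oO _ tp).
exact: (Lp_loc_integrable oO bO (ltW p_gt1) (W01_Lp oO bO p0 Wu)).
Qed.

(** The constant sequence is an admissible approximation of a test function. *)
Lemma is_tilde_test (f : H) ft phi (tp : test phi) : is_tilde p f ft ->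
  \int[lam]_(x in Omega) (ft x * phi x) = f (toH10 (test_W01 oO bO p2 tp)).
Proof.
move=> [_ /(_ (toH10 (test_W01 oO bO p2 tp)) (fun=> phi) (fun=> tp)) h].
have N0 : normH10 Omega (phi \- phi) = 0.
  have -> : phi \- phi = 0 *: phi by apply/funext => x; rewrite /= subrr scale0r.
  by rewrite (normH10Z oO bO 0 (test_W01 oO bO p2 tp)) normr0 mul0r.
have : \int[lam]_(x in Omega) (ft x * phi x) @[n --> \oo] --> f (toH10 (test_W01 oO bO p2 tp)).
  by apply: h; rewrite /= N0; exact: cvg_cst.
by move=> /cvg_lim <-//; apply/esym/cvg_lim => //; exact: cvg_cst.
Qed.

Lemma tilde_unique (f : H) ft ft' : is_tilde p f ft -> is_tilde p f ft' ->
  {ae lam, forall x, Omega x -> ft x = ft' x}.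
Proof.
move=> Tf Tf'; have [Wf _] := Tf; have [Wf' _] := Tf'.
have lf := Lp_loc_integrable oO bO (ltW p_gt1) (W01_Lp oO bO p0 Wf).
have lf' := Lp_loc_integrable oO bO (ltW p_gt1) (W01_Lp oO bO p0 Wf').
have ld := loc_integrable_lin (-1) lf' lf.
have : {ae lam, forall x, Omega x -> -1 * ft' x + ft x = 0}.
  apply: (loc_integral_test0 oO ld) => phi tp.
  have i1 := W01_mul_test_intg Wf tp; have i2 := W01_mul_test_intg Wf' tp.
  transitivity (\int[lam]_(x in Omega) (ft x * phi x - ft' x * phi x)).
    by apply: eq_Rintegral => x _; rewrite mulrDl mulN1r addrC mulNr.
  by rewrite (RintegralB mO i1 i2) (is_tilde_test tp Tf) (is_tilde_test tp Tf') subrr.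
apply: filterS => x h Ox; have := h Ox.
by rewrite mulN1r addrC => /eqP; rewrite subr_eq0 => /eqP.
Qed.

Lemma tildeP (f : H) : XD p f -> is_tilde p f (tilde p f).
Proof. by move=> [_ [ft Tf]]; rewrite /tilde; case: xgetP => [h -> //|/(_ ft)]. Qed.

Lemma tilde_wgrad (f : H) ft : is_tilde p f ft ->
  {ae lam, forall x, Omega x -> wgrad Omega (tilde p f) x = wgrad Omega ft x}.
Proof.
move=> Tf; have Tt : is_tilde p f (tilde p f).
  by rewrite /tilde; case: xgetP => [h -> //|/(_ ft)].
have [Wf _] := Tf; have [Wt _] := Tt.
exact: (W01_ae_wgrad oO bO p0 Wt Wf (tilde_unique Tt Tf)).
Qed.

Lemma XD_LpV (f : H) : XD p f -> LpV p (wgrad Omega (tilde p f)).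
Proof. by move=> /tildeP[Wf _]; exact: (W01_LpV oO bO p0 Wf). Qed.

Lemma Hm1_comb (a : R) (f h : H) : Hm1 f -> Hm1 h -> Hm1 (fun u => a * f u + h u).
Proof.
move=> [fl fc] [hl hc]; split=> [b u v w e|u e e0].
  by rewrite (fl _ _ _ _ e) (hl _ _ _ _ e); ring.
have a1 : 0 < `|a| + 1 by rewrite ltr_wpDl.
have e1 : 0 < e / 2 / (`|a| + 1) by rewrite !divr_gt0.
have e2 : 0 < e / 2 by rewrite divr_gt0.
have [r1 r10 H1] := fc u _ e1; have [r2 r20 H2] := hc u _ e2.
exists (Num.min r1 r2) => [|v]; first by rewrite lt_min r10.
rewrite lt_min => /andP[/H1 h1 /H2 h2].
have -> : a * f v + h v - (a * f u + h u) = a * (f v - f u) + (h v - h u) by ring.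
rewrite (le_lt_trans (ler_normD _ _))// [ltRHS]splitr.
rewrite ler_ltD// normrM; rewrite ltr_pdivlMr// in h1.
by rewrite mulrC (le_trans _ (ltW h1))// ler_wpM2l// lerDl.
Qed.

Lemma is_tilde_comb (a : R) (f h : H) ft ht : is_tilde p f ft -> is_tilde p h ht ->
  is_tilde p (fun u => a * f u + h u) (fun x => a * ft x + ht x).
Proof.
move=> [Wf cf] [Wh ch]; split; first by have [] := W01_lin oO bO a p0 Wf Wh.
move=> phi phin tn cn.
have c : a * \int[lam]_(x in Omega) (ft x * phin n x) +
   \int[lam]_(x in Omega) (ht x * phin n x) @[n --> \oo] --> a * f phi + h phi.
  by apply: cvgD; [apply: cvgMr; exact: cf|exact: ch].
rewrite (_ : (fun n => _) = (fun n => a * \int[lam]_(x in Omega) (ft x * phin n x) +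
   \int[lam]_(x in Omega) (ht x * phin n x)))//.
apply/funext => n.
have i1 := W01_mul_test_intg Wf (tn n); have i2 := W01_mul_test_intg Wh (tn n).
rewrite -(RintegralZl a mO i1) -(RintegralD mO (rintegrableZ mO a i1) i2).
by apply: eq_Rintegral => x _; rewrite mulrDl mulrA.
Qed.

Lemma XD_comb (a : R) (f h : H) : XD p f -> XD p h -> XD p (fun u => a * f u + h u).
Proof.
move=> [Hf [ft Tf]] [Hh [ht Th]]; split; first exact: Hm1_comb.
by eexists; exact: (is_tilde_comb a Tf Th).
Qed.

Lemma XD_comb_wgrad (a : R) (f h : H) : XD p f -> XD p h ->
  {ae lam, forall x, Omega x -> wgrad Omega (tilde p (fun u => a * f u + h u)) x =
     a *: wgrad Omega (tilde p f) x + wgrad Omega (tilde p h) x}.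
Proof.
move=> /tildeP Tf /tildeP Th; have [Wf _] := Tf; have [Wh _] := Th.
have h1 := tilde_wgrad (is_tilde_comb a Tf Th).
have [_ h2] := W01_lin oO bO a p0 Wf Wh.
by apply: filterS2 h1 h2 => x e1 e2 Ox; rewrite e1// e2.
Qed.

(** These functionals belong to [XD] with representative [phi] itself, so that the
relations tested with [XD] contain those tested with test functions. *)
Definition test_functional (phi : E -> R) : H :=
  fun v => \int[lam]_(x in Omega) (phi x * val v x).

Lemma test_functional_bound phi : test phi -> exists2 C : R, 0 <= C &
  forall u v, W01 Omega 2 u -> W01 Omega 2 v ->
    `|\int[lam]_(x in Omega) (phi x * v x) - \int[lam]_(x in Omega) (phi x * u x)| <=
      C * N (v - u).
Proof.
move=> tp; have [C C0 HC] := poincare_H10 d_gt0 oO bO.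
have Lphi := test_Lp oO bO p2 tp.
exists (L2norm phi * C) => [|u v Wu Wv]; first by rewrite mulr_ge0// L2norm_ge0.
have Lu := W01_Lp oO bO p2 Wu; have Lv := W01_Lp oO bO p2 Wv.
have Wd := W01_sub oO bO p2 Wu Wv; have Ld := W01_Lp oO bO p2 Wd.
rewrite -(RintegralB mO (L2_mul mO Lphi Lv) (L2_mul mO Lphi Lu)).
rewrite (_ : Rintegral _ _ _ = L2dot lam Omega phi (v - u)); last first.
  by apply: eq_Rintegral => x _; rewrite -mulrBr.
apply: le_trans (L2_CS mO Lphi Ld) _; rewrite -mulrA ler_wpM2l ?L2norm_ge0//.
exact: HC.
Qed.

Lemma test_functional_Hm1 phi : test phi -> Hm1 (test_functional phi).
Proof.
move=> tp; have Lphi := test_Lp oO bO p2 tp; split=> [a u v w e|u e e0].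
  have Lu := W01_Lp oO bO p2 (H10P u); have Lv := W01_Lp oO bO p2 (H10P v).
  have Lw := W01_Lp oO bO p2 (H10P w).
  have i1 := L2_mul mO Lphi Lu; have i2 := L2_mul mO Lphi Lv.
  rewrite /test_functional -(RintegralZl a mO i1) -(RintegralD mO (rintegrableZ mO a i1) i2).
  apply: ae_eq_Rintegral => //.
  - exact: integrable_measurable (L2_mul mO Lphi Lw).
  - exact: integrable_measurable (rintegrableD mO (rintegrableZ mO a i1) i2).
  - by apply: filterS e => x h Ox; rewrite h//; ring.
have [C C0 HC] := test_functional_bound tp.
have C1 : 0 < C + 1 by rewrite ltr_wpDl.
exists (e / (C + 1)) => [|v vu]; first by rewrite divr_gt0.
apply: le_lt_trans (HC _ _ (H10P u) (H10P v)) _.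
rewrite ltr_pdivlMr// in vu; apply: le_lt_trans vu.
by rewrite mulrC ler_wpM2l ?normH10_ge0// lerDl.
Qed.

Lemma test_functional_tilde phi : test phi -> is_tilde p (test_functional phi) phi.
Proof.
move=> tp; split; first exact: (test_W01 oO bO p0 tp).
move=> u phin tn cn; have [C C0 HC] := test_functional_bound tp.
have c : C * N (phin n \- val u) @[n --> \oo] --> C * 0 by apply: cvgMr.
rewrite mulr0 in c; apply/cvgrPdist_le => e e0.
move/cvgrPdist_le : c => /(_ e e0); apply: filterS => n.
rewrite sub0r normrN => h; rewrite distrC.
apply: le_trans (HC _ _ (H10P u) (test_W01 oO bO p2 (tn n))) _.
by apply: le_trans h; exact: ler_norm.
Qed.

Lemma test_functional_XD phi : test phi -> XD p (test_functional phi).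
Proof.
move=> tp; split; first exact: test_functional_Hm1.
by exists phi; exact: test_functional_tilde.
Qed.

Lemma Hm1_zero : Hm1 ((fun=> 0) : H).
Proof.
have := test_functional_Hm1 (test_fun0 Omega); congr Hm1; apply/funext => v.
rewrite /test_functional; under eq_Rintegral do rewrite mul0r.
by rewrite /Rintegral integral0.
Qed.

Lemma XD_zero : XD p ((fun=> 0) : H).
Proof.
have := test_functional_XD (test_fun0 Omega).
rewrite (_ : test_functional _ = fun=> 0)//; apply/funext => v.
rewrite /test_functional; under eq_Rintegral do rewrite mul0r.
by rewrite /Rintegral integral0.
Qed.

Lemma oppH10_subproof (u : H10 Omega) : W01 Omega 2 (fun x => - val u x).
Proof.
have [Ww _] := W01_lin oO bO (-1) p2 (H10P u) (W010 Omega).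
rewrite (_ : (fun x => _) = (fun x => -1 * val u x + (0 : E -> R) x))//.
by apply/funext => x; rewrite mulN1r -[(0 : E -> R) x]/(0 : R) addr0.
Qed.

Definition oppH10 (u : H10 Omega) : H10 Omega := toH10 (oppH10_subproof u).

Lemma Hm1_opp (f : H) u : Hm1 f -> f (oppH10 u) = - f u.
Proof.
move=> Hf; rewrite (Hm1_lin Hf (a := -1) (u := u) (v := toH10 (W010 Omega))).
  by rewrite Hm1_0// addr0 mulN1r.
by move=> x; rewrite /= -[(0 : E -> R) x]/(0 : R) addr0 mulN1r.
Qed.

Lemma mDelta_Hm1 (u : H10 Omega) : Hm1 (mDelta u).
Proof.
have Wu := H10P u; split=> [a v v' w e|v e e0].
  have Wv := H10P v; have Wv' := H10P v'; have Ww := H10P w.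
  have [Wc ec] := W01_lin oO bO a p2 Wv Wv'.
  have ew := W01_ae_wgrad oO bO p2 Ww Wc e.
  have Lu := W01_LpV oO bO p2 Wu.
  have Lv := W01_LpV oO bO p2 Wv; have Lv' := W01_LpV oO bO p2 Wv'.
  have Lw := W01_LpV oO bO p2 Ww.
  have i1 := LpV_dotv_mul oO p2 p2 (half_conj R) Lu Lv.
  have i2 := LpV_dotv_mul oO p2 p2 (half_conj R) Lu Lv'.
  have i3 := LpV_dotv_mul oO p2 p2 (half_conj R) Lu Lw.
  rewrite /mDelta /dotH10 -(RintegralZl a mO i1) -(RintegralD mO (rintegrableZ mO a i1) i2).
  apply: ae_eq_Rintegral => //.
  - exact: integrable_measurable i3.
  - exact: integrable_measurable (rintegrableD mO (rintegrableZ mO a i1) i2).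
  - apply: filterS2 ew ec => x e1 e2 Ox; rewrite e1// e2//.
    by rewrite dotvC dotv_lin dotvC [X in _ + X]dotvC.
have C1 : 0 < N (val u) + 1 by rewrite ltr_wpDl// normH10_ge0.
exists (e / (N (val u) + 1)) => [|w vw]; first by rewrite divr_gt0.
have Wv := H10P v; have Ww := H10P w; have Wd := W01_sub oO bO p2 Wv Ww.
have -> : mDelta u w - mDelta u v = dotH10 Omega (val u) (val w - val v).
  rewrite /mDelta (dotH10C oO bO Wu Ww) (dotH10C oO bO Wu Wv).
  by rewrite -(dotH10B oO bO Ww Wv Wu) (dotH10C oO bO Wd Wu).
apply: le_lt_trans (semi_inner_CS dirS Wu Wd) _.
rewrite ltr_pdivlMr// in vw; apply: le_lt_trans vw.
have h (a b : R) : 0 <= b -> a * b <= b * (a + 1).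
  by move=> b0; rewrite mulrC ler_wpM2l// lerDl.
exact: h (normH10_ge0 _ _).
Qed.

Lemma mDelta_opp (u : H10 Omega) : mDelta (oppH10 u) = \- mDelta u.
Proof.
apply/funext => v; have Wu := H10P u; have Wv := H10P v.
have e1 := dotH10C oO bO (H10P (oppH10 u)) Wv.
have e2 : dotH10 Omega (val v) (val (oppH10 u)) = - dotH10 Omega (val v) (val u).
  exact: Hm1_opp u (mDelta_Hm1 v).
exact: (etrans e1 (etrans e2 (congr1 -%R (dotH10C oO bO Wv Wu)))).
Qed.

(** [u - v] has Dirichlet norm 0, and a bounded functional does not see it. *)
Lemma mDelta_inj (f : H) (u v : H10 Omega) : Hm1 f -> mDelta u = mDelta v -> f u = f v.
Proof.
move=> Hf uv; have Wu := H10P u; have Wv := H10P v; have Wd := W01_sub oO bO p2 Wv Wu.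
have [C C0 HC] := Hm1_bounded oO bO Hf.
have N0 : N (val u - val v) = 0.
  have h : dotH10 Omega (val u - val v) (val u - val v) = 0.
    rewrite (dotH10B oO bO Wu Wv Wd).
    by have /(congr1 (fun F => F (toH10 Wd))) := uv; rewrite /mDelta /= => ->; rewrite subrr.
  by rewrite /normH10 h sqrtr0.
have := HC (toH10 Wd); rewrite /= N0 mulr0 normr_le0.
have -> : f (toH10 Wd) = -1 * f v + f u.
  by apply: (Hm1_lin Hf) => x; rewrite /= mulN1r addrC.
by rewrite mulN1r addrC subr_eq0 => /eqP.
Qed.

End Distributions.

(** * The subdifferential *)

Section Subdifferential.
Context (R : realType) (d : nat) (d_gt0 : (0 < d)%N).
Local Notation E := 'rV[R]_d.
Local Notation lam := (@lebesgue_rV R d).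
Context (p mu : R) (p_gt1 : 1 < p) (mu_gt0 : 0 < mu).
Context (Omega : set E) (oO : open Omega) (bO : bounded_set Omega).
Local Notation LpV := (LpV Omega).
Local Notation sigma := (@sigma R d p mu).
Local Notation H := (H10 Omega -> R).
Local Notation W f := (wgrad Omega (tilde p f)).
Local Notation incr := (sigma_incr p mu Omega).

Let mO : measurable Omega. Proof. exact: open_measurable_rV. Qed.
Let p0 : 0 < p. Proof. exact: lt_trans p_gt1. Qed.
Let p2 : 0 < 2 :> R. Proof. by []. Qed.

(** The minimum of the two functions turns the almost everywhere inequality into one
that holds everywhere. *)
Lemma ae_le_Rintegral (f g : E -> R) : lam.-integrable Omega (EFin \o f) ->
  lam.-integrable Omega (EFin \o g) ->
  {ae lam, forall x, Omega x -> f x <= g x} ->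
  \int[lam]_(x in Omega) f x <= \int[lam]_(x in Omega) g x.
Proof.
move=> fi gi fg; have mf := integrable_measurable fi; have mg := integrable_measurable gi.
pose m x := Num.min (f x) (g x).
have mm : measurable_fun Omega m by exact: measurable_minr.
have fm : {ae lam, forall x, Omega x -> f x = m x}.
  by apply: filterS fg => x h Ox; rewrite /m min_l// h.
have mi : lam.-integrable Omega (EFin \o m) := ae_eq_rintegrable mO mm fm fi.
rewrite (ae_eq_Rintegral mO mf mm fm); apply: (le_Rintegral mO mi gi) => x _.
by rewrite /m ge_min lexx orbT.
Qed.

Lemma sigma_incr_ae (V y z : E -> E) : LpV p V -> LpV p y -> LpV p z ->
  {ae lam, forall x, Omega x -> y x = z x} -> incr V y = incr V z.
Proof.
move=> LV Ly Lz yz; apply: (ae_eq_Rintegral mO).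
- exact: integrable_measurable (sigma_incr_intg mu p_gt1 oO bO LV Ly).
- exact: integrable_measurable (sigma_incr_intg mu p_gt1 oO bO LV Lz).
- by apply: filterS yz => x h Ox; rewrite h.
Qed.

Lemma FD_XD (f : H) : XD p f ->
  FD p mu f = (\int[lam]_(x in Omega) sigma (W f x))%:E.
Proof.
move=> Xf; rewrite /FD asboolT// EFin_Rintegral//.
exact: (sigma_intg mu p_gt1 oO bO (XD_LpV p_gt1 oO bO Xf)).
Qed.

Lemma FD_notXD (f : H) : ~ XD p f -> FD p mu f = +oo%E.
Proof. by move=> nXf; rewrite /FD asboolF. Qed.

Lemma addH (f h : H) : f \+ h = (fun u => 1 * f u + h u).
Proof. by apply/funext => u; rewrite mul1r. Qed.

Lemma XD_add (f h : H) : XD p f -> XD p h -> XD p (f \+ h).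
Proof. by rewrite addH; exact: XD_comb. Qed.

Lemma FD_incr (f h : H) : XD p f -> XD p h ->
  (\int[lam]_(x in Omega) sigma (W (f \+ h) x)) =
  \int[lam]_(x in Omega) sigma (W f x) + incr (W f) (W h).
Proof.
move=> Xf Xh; have Lf := XD_LpV p_gt1 oO bO Xf; have Lh := XD_LpV p_gt1 oO bO Xh.
have Xs := XD_add Xf Xh; have Ls := XD_LpV p_gt1 oO bO Xs.
have i1 := sigma_intg mu p_gt1 oO bO Lf.
have i2 := sigma_incr_intg mu p_gt1 oO bO Lf Lh.
rewrite /sigma_incr -(RintegralD mO i1 i2); apply: (ae_eq_Rintegral mO).
- exact: integrable_measurable (sigma_intg mu p_gt1 oO bO Ls).
- exact: integrable_measurable (rintegrableD mO i1 i2).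
- have e := XD_comb_wgrad p_gt1 oO bO 1 Xf Xh; rewrite -addH in e.
  apply: filterS e => x e Ox; rewrite (e Ox) scale1r [RHS]addrC.
  by rewrite subrK addrC.
Qed.

(** Testing with [h = - f] compares [FD f] with [FD 0], which is finite. *)
Lemma subdiff_XD (f k : H) : Hm1 f -> subdiff_FD p mu f k -> XD p f.
Proof.
move=> Hf [Hk kf]; apply: contrapT => nXf.
have HN : Hm1 (\- f).
  have := Hm1_comb (-1) Hf (Hm1_zero d_gt0 oO bO); congr Hm1.
  by apply/funext => u; rewrite addr0 mulN1r.
have := kf _ HN; rewrite FD_notXD//.
have -> : f \+ \- f = (fun=> 0) by apply/funext => u /=; rewrite subrr.
by rewrite (FD_XD (XD_zero d_gt0 p_gt1 oO bO)) addey.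
Qed.

Lemma FD_le_add (f h : H) (c : R) : XD p f -> XD p h ->
  (c%:E + FD p mu f <= FD p mu (f \+ h)%R)%E = (c <= incr (W f) (W h)).
Proof.
move=> Xf Xh; rewrite (FD_XD (XD_add Xf Xh)) (FD_incr Xf Xh) (FD_XD Xf).
move: (incr _ _) (Rintegral _ _ _) => a b.
by rewrite -EFinD lee_fin addrC lerD2l.
Qed.

(** Perturbations that leave [XD] give no condition, since the functional is
infinite there. *)
Lemma subdiffP (f k : H) : Hm1 f -> XD p f -> subdiff_FD p mu f k <->
  Hm1 k /\ forall h, XD p h -> h (mDelta_inv k) <= incr (W f) (W h).
Proof.
move=> Hf Xf; split=> [[Hk kf]|[Hk kf]]; split; [exact: Hk| |exact: Hk|].
  by move=> h Xh; rewrite -(FD_le_add _ Xf Xh); exact: (kf h Xh.1).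
move=> h Hh.
have [Xs|nXs] := pselect (XD p (f \+ h)); last by rewrite (FD_notXD nXs) leey.
have Xh : XD p h.
  have := XD_comb p_gt1 oO bO (-1) Xf Xs; congr XD; apply/funext => u /=.
  by rewrite mulN1r addrA addNr add0r.
by rewrite (FD_le_add _ Xf Xh); exact: kf h Xh.
Qed.

Lemma conj_exponent : p^-1 + (p / (p - 1))^-1 = 1.
Proof. by field; rewrite !gt_eqF// ?subr_gt0. Qed.

Lemma conj_exponent_gt0 : 0 < p / (p - 1).
Proof. by rewrite divr_gt0// subr_gt0. Qed.

Lemma subgradient_of_field (f : H) (g : E -> E) (divg : H10 Omega) : Hm1 f -> XD p f ->
  LpV (p / (p - 1)) g ->
  {ae lam, forall x, Omega x -> subdiff_sigma p mu (W f x) (g x)} ->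
  (forall h : H, XD p h ->
     h divg + \int[lam]_(x in Omega) dotv (W h x) (g x) = 0) ->
  subdiff_FD p mu f (\- mDelta divg).
Proof.
move=> Hf Xf Lg sub orth.
have Hk : Hm1 (\- mDelta divg).
  rewrite -(mDelta_opp oO bO divg); exact: mDelta_Hm1.
apply/(subdiffP _ Hf Xf); split=> // h Xh.
have Lf := XD_LpV p_gt1 oO bO Xf; have Lh := XD_LpV p_gt1 oO bO Xh.
have [Hh _] := Xh.
have -> : h (mDelta_inv (\- mDelta divg)) = h (oppH10 oO bO divg).
  apply: (mDelta_inj oO bO Hh).
  by rewrite (mDelta_invK d_gt0 oO bO Hk) mDelta_opp.
rewrite (Hm1_opp oO bO _ Hh).
have -> : - h divg = \int[lam]_(x in Omega) dotv (W h x) (g x).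
  by apply/eqP; rewrite eq_sym -addr_eq0 addrC orth.
have i1 := LpV_dotv_mul oO p0 conj_exponent_gt0 conj_exponent Lh Lg.
apply: (ae_le_Rintegral i1 (sigma_incr_intg mu p_gt1 oO bO Lf Lh)).
apply: filterS sub => x s Ox; rewrite lerBrDr dotvC; exact: s.
Qed.

(** The map from the gradient of the representative of [h] to [h u].  Gradients of
representatives are determined up to null sets only, which a relation
accommodates by containing all fields equal to them almost everywhere. *)
Definition gradient_relation (u : H10 Omega) : set ((E -> E) * R) :=
  [set yr | exists h : H, [/\ XD p h, LpV p yr.1,
     {ae lam, forall x, Omega x -> yr.1 x = W h x} & yr.2 = h u]].

Lemma gradient_relation_linear u : linear_rel (gradient_relation u).
Proof.
split.
  exists (fun=> 0); have X0 := XD_zero d_gt0 p_gt1 oO bO; split=> //.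
    move=> i; have := Lp0 lam Omega p0; congr (Lp _ _ _ _).
    by apply/funext => x; rewrite mxE.
  have T0 : is_tilde p ((fun=> 0) : H) (fun=> 0).
    have := test_functional_tilde d_gt0 p_gt1 oO bO (test_fun0 Omega).
    rewrite (_ : test_functional _ = fun=> 0)//; apply/funext => v.
    rewrite /test_functional; under eq_Rintegral do rewrite mul0r.
    by rewrite /Rintegral integral0.
  have e1 := tilde_wgrad p_gt1 oO bO T0.
  have [_ e2] := W01_test oO bO p0 (test_fun0 Omega).
  apply: filterS2 e1 e2 => x h1 h2 Ox; rewrite h1// h2//.
  by apply/rowP => i; rewrite !mxE derive_cst.
move=> a y r z s [h [/= Xh Ly yh ->]] [h' [/= Xh' Lz zh' ->]].
exists (fun u => a * h u + h' u); split; last by [].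
- exact: (XD_comb p_gt1 oO bO a Xh Xh').
- exact: (LpV_lin oO a p0 Ly Lz).
- have e := XD_comb_wgrad p_gt1 oO bO a Xh Xh'.
  apply: filterS3 yh zh' e => x e1 e2 e3 Ox; rewrite (e3 Ox).
  by rewrite -[LHS]/(a *: y x + z x) (e1 Ox) (e2 Ox).
Qed.

(** Test functions represent integration against themselves, so the representation
of the extension on their gradients computes the divergence of [g]. *)
Lemma field_of_subgradient (f k : H) : Hm1 f -> XD p f -> subdiff_FD p mu f k ->
  exists (g : E -> E) (divg : H10 Omega),
   [/\ LpV (p / (p - 1)) g, is_div Omega g (val divg),
       {ae lam, forall x, Omega x -> subdiff_sigma p mu (W f x) (g x)},
       (forall h : H, XD p h ->
          h divg + \int[lam]_(x in Omega) dotv (W h x) (g x) = 0) &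
       k = \- mDelta divg].
Proof.
move=> Hf Xf /(subdiffP _ Hf Xf)[Hk kf].
have Lf := XD_LpV p_gt1 oO bO Xf.
set u := mDelta_inv k in kf.
have dom : dominated_rel [set y : E -> E | LpV p y] (incr (W f)) (gradient_relation u).
  move=> y r [h [/= Xh Ly yh ->]]; split=> //.
  by rewrite (sigma_incr_ae Lf Ly (XD_LpV p_gt1 oO bO Xh) yh); exact: kf.
have [a v w Lv Lw|t v w t01 Lv Lw|L [L_lin L_le L_ext]] :=
  @hahn_banach R _ [set y : E -> E | LpV p y] (incr (W f)) _ _ _
    (sigma_incr0 _ _ _ _) (gradient_relation_linear u) dom.
- exact: (LpV_lin oO a p0 Lv Lw).
- exact: sigma_incr_convex.
have [g [Lg sub Lrep]] := dual_representation p_gt1 mu_gt0 oO bO Lf L_lin L_le.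
have WE h : XD p h -> \int[lam]_(x in Omega) dotv (W h x) (g x) = h u.
  move=> Xh; have Lh := XD_LpV p_gt1 oO bO Xh.
  by rewrite -(Lrep _ Lh); apply: L_ext; exists h; split=> //; exact: aeW.
exists g, (oppH10 oO bO u); split=> //.
- move=> phi tp.
  have Xp := test_functional_XD d_gt0 p_gt1 oO bO tp.
  have Lgp := test_grad_LpV oO bO p0 tp.
  have Tp := test_functional_tilde d_gt0 p_gt1 oO bO tp.
  have e1 := tilde_wgrad p_gt1 oO bO Tp; have [_ e2] := W01_test oO bO p0 tp.
  have LE : L (grad phi) = \int[lam]_(x in Omega) (phi x * val u x).
    apply: L_ext; exists (test_functional phi); split=> //=.
    by apply: filterS2 e1 e2 => x h1 h2 Ox; rewrite h1// h2.
  have iu : lam.-integrable Omega (EFin \o (fun x => phi x * val u x)).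
    exact: (L2_mul mO (test_Lp oO bO p2 tp) (W01_Lp oO bO p2 (H10P u))).
  transitivity (- \int[lam]_(x in Omega) (phi x * val u x)).
    rewrite -(RintegralN mO iu); apply: eq_Rintegral => x _.
    by rewrite /= mulNr mulrC.
  congr (- _); rewrite -LE (Lrep _ Lgp); apply: eq_Rintegral => x _.
  exact: dotvC.
- move=> h Xh; have [Hh _] := Xh.
  by rewrite (Hm1_opp oO bO u Hh) (WE h Xh) addNr.
- rewrite (mDelta_opp oO bO u) (mDelta_invK d_gt0 oO bO Hk).
  by apply/funext => v; rewrite /= opprK.
Qed.

End Subdifferential.

Theorem theorem1p5 (R : realType) (d : nat) (d_gt0 : (0 < d)%N)
    (p : R) (p_gt1 : 1 < p) (mu : R) (mu_gt0 : 0 < mu)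
    (Omega : set 'rV[R]_d) (oOmega : open Omega) (bOmega : bounded_set Omega)
    (f : H10 Omega -> R) (f_Hm1 : Hm1 f) :
  subdiff_FD p mu f !=set0 ->
  subdiff_FD p mu f =
  [set k | exists (g : 'rV[R]_d -> 'rV[R]_d) (divg : H10 Omega),
    [/\ memLpV Omega (p / (p - 1)) g,
        is_div Omega g (val divg),
        {ae @lebesgue_rV R d, forall x, Omega x ->
          subdiff_sigma p mu (wgrad Omega (tilde p f) x) (g x)},
        (forall h : H10 Omega -> R, XD p h ->
          h divg + \int[@lebesgue_rV R d]_(x in Omega)
                     dotv (wgrad Omega (tilde p h) x) (g x) = 0) &
        k = \- mDelta divg]].
Proof.
move=> [k0 k0f]; have Xf := subdiff_XD d_gt0 p_gt1 oOmega bOmega f_Hm1 k0f.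
have mO : measurable Omega by exact: open_measurable_rV.
have q0 := conj_exponent_gt0 p_gt1.
apply/seteqP; split=> [k kf|k [g [divg [Lg _ sub orth ->]]]].
  have [g [divg [Lg dg sub orth kE]]] :=
    field_of_subgradient d_gt0 p_gt1 mu_gt0 oOmega bOmega f_Hm1 Xf kf.
  by exists g, divg; split=> // i; apply/(memLpP mO _ q0); exact: Lg.
have Lg' : LpV Omega (p / (p - 1)) g by move=> i; apply/(memLpP mO _ q0); exact: Lg.
exact: (subgradient_of_field d_gt0 p_gt1 oOmega bOmega f_Hm1 Xf Lg' sub orth).
Qed.
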